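(* Let $M$ be a closed orientable smooth manifold, $\mathcal M$ the space of smooth Riemannian metrics on $M$, and $g_0\in\mathcal M$ a fixed metric. The weak Riemannian structure on $\mathcal M$ $$(a,b)_g=\int_M\mathrm{tr}(AB)\,d\mu(g_0),\qquad a,b\in T_g\mathcal M=S_2,$$ has the following geometric characteristics: 1) covariant derivative $\nabla_ab=d_ab-\frac12(aB+bA)$; 2) curvature tensor $R(a,b)c=-\frac14\,g\,[[A,B],C]$; 3) sectional curvature in the plane section $\sigma$ given by an orthonormal pair $a,b\in T_g\mathcal M$: $$K_\sigma=\frac14\int_M\mathrm{tr}\big([A,B]^2\big)\,d\mu(g_0);$$ 4) the geodesic going out from $g\in\mathcal M$ in direction $a\in T_g\mathcal M$ is $g_t=g\,e^{tA}$.
   Context: $S_2$ is the Fréchet space of smooth symmetric 2-forms on $M$; $\mathcal M\subset S_2$ is the open cone of positive definite ones. $\mu(g_0)$ is the Riemannian volume form of $g_0$ (it does not depend on $g$). For $a,b,c\in S_2$ and $g\in\mathcal M$: $A=g^{-1}a$, $B=g^{-1}b$, $C=g^{-1}c$ are the endomorphisms of $TM$ obtained by raising the first index with $g$; $aB$ is the 2-form $a_{ik}B^k_j$, $gE$ the 2-form $g_{ik}E^k_j$; $[A,B]=AB-BA$. $d_ab=\frac{d}{dt}|_{t=0}b(g+ta)$ is the directional derivative in $S_2$ of a vector field $b=b(g)$. The covariant derivative is the torsion-free one compatible with the weak metric; $R(a,b)c=\nabla_a\nabla_bc-\nabla_b\nabla_ac-\nabla_{[a,b]}c$; the sectional curvature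 for orthonormal $a,b$ is $(R(a,b)b,a)_g$. *)

(* Defs.v *)
From HB Require Import structures.
From mathcomp Require Import all_boot all_order all_algebra.
From mathcomp Require Import all_classical all_reals all_analysis.

Set Implicit Arguments.
Unset Strict Implicit.
Unset Printing Implicit Defensive.

Import Order.TTheory GRing.Theory Num.Theory.
Import numFieldNormedType.Exports.

Local Open Scope classical_set_scope.
Local Open Scope ring_scope.

Section Euclidean.
Variables (R : realType) (n : nat).

Definition partials (W : normedModType R) (s : seq 'I_n) (f : 'rV[R]_n -> W) :
    'rV[R]_n -> W :=
  foldr (fun j h => fun v => 'D_(delta_mx 0 j) h v) f s.

(* A function is C^oo on an open set iff its iterated partial derivatives of
   all orders exist and are Frechet differentiable there. *)
Definition smooth_on (W : normedModType R) (U : set 'rV[R]_n)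
    (f : 'rV[R]_n -> W) :=
  forall s v, U v -> differentiable (partials s f) v.

(* e^A as the sum of its power series *)
Definition expmx (A : 'M[R]_n) : 'M[R]_n :=
  lim (series (fun k : nat => (k`!%:R)^-1 *: A ^+ k) @ \oo).

End Euclidean.

(* The integral over R^n as an iterated integral; below it is only applied to
   continuous functions with compact support. *)
Fixpoint rV_integral (R : realType) (n : nat) : ('rV[R]_n -> R) -> R :=
  match n with
  | 0%N => fun f => f 0
  | m.+1 => fun f =>
      \int[lebesgue_measure]_(x in [set: R])
        rV_integral (fun v : 'rV[R]_m =>
          f (row_mx (x%:M : 'rV[R]_1) v : 'rV[R]_m.+1))
  end.

Section Manifold.
Variables (R : realType) (n : nat).

(* [cmap] and [cinv] are total functions; they are only meaningful on [cdom]
   and on its image, respectively. *)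
Record chart (T : topologicalType) := Chart {
  cdom : set T;
  cmap : T -> 'rV[R]_n;
  cinv : 'rV[R]_n -> T;
  cdom_open : open cdom;
  cimg_open : open (cmap @` cdom);
  cmapK : forall x, cdom x -> cinv (cmap x) = x;
  cmap_continuous : {within cdom, continuous cmap};
  cinv_continuous : {within cmap @` cdom, continuous cinv}
}.

Definition cimg (T : topologicalType) (c : chart T) : set 'rV[R]_n :=
  cmap c @` cdom c.

(* the part of the image of [c] on which the transition to [c'] is defined *)
Definition overlap (T : topologicalType) (c c' : chart T) : set 'rV[R]_n :=
  cimg c `&` cinv c @^-1` cdom c'.

Definition transition (T : topologicalType) (c c' : chart T) :
  'rV[R]_n -> 'rV[R]_n := cmap c' \o cinv c.

Definition compatible (T : topologicalType) (c c' : chart T) :=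
  smooth_on (overlap c c') (transition c c') /\
  smooth_on (overlap c' c) (transition c' c).

(* smooth n-dimensional manifolds without boundary, given by a maximal atlas *)
Record manifold := Manifold {
  carrier :> topologicalType;
  carrier_hausdorff : hausdorff_space carrier;
  carrier_second_countable : @second_countable carrier;
  atlas : set (chart carrier);
  atlas_cover : forall x, exists2 c, atlas c & cdom c x;
  atlas_compatible : forall c c', atlas c -> atlas c' -> compatible c c';
  atlas_maximal : forall c,
    (forall c', atlas c' -> compatible c c') -> atlas c
}.

Arguments atlas : clear implicits.

Record orientation (M : manifold) := Orientation {
  oatlas : set (chart M);
  oatlas_atlas : oatlas `<=` atlas M;
  oatlas_cover : forall x, exists2 c, oatlas c & cdom c x;
  oatlas_det : forall c c' v, oatlas c -> oatlas c' -> overlap c c' v ->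
    0 < \det ('J (transition c c') v)
}.

Arguments oatlas {M} o.

Record partition_of_unity (M : manifold) (O : orientation M) :=
    PartitionOfUnity {
  pou_card : nat;
  pou_chart : 'I_pou_card -> chart M;
  pou_oatlas : forall i, oatlas O (pou_chart i);
  pou_fun : 'I_pou_card -> M -> R;
  pou_continuous : forall i, continuous (pou_fun i);
  pou_ge0 : forall i x, 0 <= pou_fun i x;
  pou_support : forall i,
    closure [set x | pou_fun i x != 0] `<=` cdom (pou_chart i);
  pou_sum : forall x, \sum_i pou_fun i x = 1
}.

End Manifold.

Arguments atlas {R n} m.
Arguments oatlas {R n M} o : rename.
Arguments pou_card {R n M O} p : rename.
Arguments pou_chart {R n M O} p _ : rename.
Arguments pou_fun {R n M O} p _ _ : rename.

Section TwoForms.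
Variables (R : realType) (n : nat) (M : manifold R n).

Definition chart_at (x : M) : chart R n M := s2val (cid2 (atlas_cover x)).

(* The tangent space at [x] is identified with R^n by means of [chart_at x], so
   that a field of bilinear forms, of class C^oo or not, is given by the
   matrices (a_ij) of its components in these charts. *)
Definition two_form : Type := M -> 'M[R]_n.

HB.instance Definition _ := GRing.Lmodule.copy two_form (M -> 'M[R]_n).

(* fields of endomorphisms of the tangent bundle *)
Definition endo : Type := M -> 'M[R]_n.

(* Components of [a] in the chart [c] at the point with coordinates [v]; entry
   (k, l) of the Jacobian is the derivative with respect to the [k]th
   coordinate of the [l]th component. *)
Definition local_form (c : chart R n M) (a : two_form) (v : 'rV[R]_n) :
    'M[R]_n :=
  let P := 'J (transition c (chart_at (cinv c v))) v in
  P *m a (cinv c v) *m P^T.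

Definition jets (a : two_form) :
    prod_topology (fun i : chart R n M * seq 'I_n =>
      {family [set K | [/\ atlas M i.1, compact K & K `<=` cimg i.1]],
        'rV[R]_n -> 'M[R]_n}) :=
  fun i => partials i.2 (local_form i.1 a).

(* The C^oo topology: uniform convergence on compact sets, in all charts, of
   all partial derivatives. It induces the Frechet topology on [S2]. *)
HB.instance Definition _ := Topological.copy two_form (initial_topology jets).

Definition S2 : set two_form :=
  [set a | (forall x, (a x)^T = a x) /\
    forall c, atlas M c -> smooth_on (cimg c) (local_form c a)].

Definition Met : set two_form :=
  [set g | S2 g /\
    forall x (v : 'rV[R]_n), v != 0 -> 0 < (v *m g x *m v^T) 0 0].

(* The integral of [f] against the volume form of [g0], which in the charts of
   an orientation is sqrt (det g0) dx^1 /\ ... /\ dx^n; it does not depend on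
   the partition of unity. *)
Definition vol_integral (O : orientation M) (P : partition_of_unity O)
    (g0 : two_form) (f : M -> R) : R :=
  \sum_i
    let c := pou_chart P i in
    rV_integral
      ((fun v => pou_fun P i (cinv c v) * f (cinv c v) *
                 Num.sqrt (\det (local_form c g0 v))) \_ (cimg c)).

Definition sharp (g a : two_form) : endo := fun x => invmx (g x) *m a x.

Definition fmul (a : two_form) (B : endo) : two_form := fun x => a x *m B x.

Definition comm (A B : endo) : endo := fun x => A x *m B x - B x *m A x.

Definition weak_metric (O : orientation M) (P : partition_of_unity O)
    (g0 g a b : two_form) : R :=
  vol_integral P g0 (fun x => \tr (sharp g a x *m sharp g b x)).

End TwoForms.

Section Calculus.
Variables (R : realType) (V : lmodType R) (W : preTopologicalLmodType R).

Definition dquot (f : V -> W) (x a : V) (h : R) : W :=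
  h^-1 *: (f (x + h *: a) - f x).

Definition dderivable (f : V -> W) (x a : V) : Prop :=
  exists l : W, dquot f x a @ 0^' --> l.

Definition dder (f : V -> W) (x a : V) : W :=
  xget 0 [set l : W | dquot f x a @ 0^' --> l].

Definition dders (f : V -> W) (s : seq V) : V -> W :=
  foldr (fun a F => fun x => dder F x a) f s.

End Calculus.

Section Connections.
Variables (R : realType) (n : nat) (M : manifold R n).

Local Notation two_form := (two_form M).
Local Notation S2 := (@S2 R n M).
Local Notation Met := (@Met R n M).

(* Maps on the open subset [Met] of the Frechet space [S2] with values in
   [S] that are C^oo: the iterated directional derivatives of all orders exist
   and are jointly continuous in the base point and the directions. Values
   outside [Met] are irrelevant. *)
Definition smooth_map (W : preTopologicalLmodType R) (S : set W)
    (f : two_form -> W) :=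
  (forall s g, (forall a, a \in s -> S2 a) -> Met g -> S (dders f s g) /\
     forall a, S2 a -> dderivable (dders f s) g a) /\
  forall k,
    {within [set p : two_form * prod_topology (fun _ : 'I_k => two_form) |
               Met p.1 /\ forall i, S2 (p.2 i)],
     continuous (fun p : two_form * prod_topology (fun _ : 'I_k => two_form) =>
                   dders f [seq p.2 i | i : 'I_k] p.1)}.

(* vector fields on [Met] *)
Definition vfield : Type := two_form -> two_form.

Definition smooth_field (b : vfield) := smooth_map S2 b.

Definition smooth_function (f : two_form -> R^o) := smooth_map setT f.

Definition bracket (a b : vfield) : vfield :=
  fun g => dder b g (a g) - dder a g (b g).

Record levi_civita (ip : two_form -> two_form -> two_form -> R)
    (nabla : vfield -> vfield -> vfield) : Prop := LeviCivita {
  lc_smooth : forall a b, smooth_field a -> smooth_field b ->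
    smooth_field (nabla a b);
  lc_addl : forall a a' b g,
    smooth_field a -> smooth_field a' -> smooth_field b -> Met g ->
    nabla (fun h => a h + a' h) b g = nabla a b g + nabla a' b g;
  lc_scalel : forall f a b g,
    smooth_function f -> smooth_field a -> smooth_field b -> Met g ->
    nabla (fun h => f h *: a h) b g = f g *: nabla a b g;
  lc_addr : forall a b b' g,
    smooth_field a -> smooth_field b -> smooth_field b' -> Met g ->
    nabla a (fun h => b h + b' h) g = nabla a b g + nabla a b' g;
  lc_leibniz : forall f a b g,
    smooth_function f -> smooth_field a -> smooth_field b -> Met g ->
    nabla a (fun h => f h *: b h) g =
      dder f g (a g) *: b g + f g *: nabla a b g;
  lc_torsion : forall a b g,
    smooth_field a -> smooth_field b -> Met g ->
    nabla a b g - nabla b a g = bracket a b g;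
  lc_metric : forall a b c g,
    smooth_field a -> smooth_field b -> smooth_field c -> Met g ->
    dquot (fun h => ip h (b h) (c h) : R^o) g (a g) @ 0^' -->
      (ip g (nabla a b g) (c g) + ip g (b g) (nabla a c g) : R^o)
}.

Definition curvature (nabla : vfield -> vfield -> vfield) (a b c : vfield) :
    vfield :=
  fun g => nabla a (nabla b c) g - nabla b (nabla a c) g
           - nabla (bracket a b) c g.

Definition sectional_curvature (ip : two_form -> two_form -> two_form -> R)
    (nabla : vfield -> vfield -> vfield) (a b : vfield) (g : two_form) : R :=
  ip g (curvature nabla a b b g) (a g).

(* the velocity of a curve *)
Definition cder (u : R -> two_form) : R -> two_form :=
  fun t => dder (u : R^o -> two_form) t 1.

Definition smooth_curve (J : set R) (u : R -> two_form) :=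
  forall k t, J t -> S2 (iter k cder u t) /\
    dderivable (iter k cder u : R^o -> two_form) t 1.

(* The equation nabla_{u'} u' = 0: since [Met] is open in the vector space
   [S2], the covariant derivative along [u] of a field [b] is
   b' + Gamma_u(u', b), where Gamma(a, b) = nabla_a b for constant fields
   [a] and [b]. *)
Definition geodesic (nabla : vfield -> vfield -> vfield) (J : set R)
    (u : R -> two_form) :=
  smooth_curve J u /\
  forall t, J t -> Met (u t) /\
    cder (cder u) t + nabla (cst (cder u t)) (cst (cder u t)) (u t) = 0.

End Connections.

(* Main.v *)
Require Import Defs.
From HB Require Import structures.
From mathcomp Require Import all_boot all_order all_algebra.
From mathcomp Require Import perm.
From mathcomp Require Import all_classical all_reals all_analysis.
From mathcomp Require Import ring lra.

Set Implicit Arguments.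
Unset Strict Implicit.
Unset Printing Implicit Defensive.

Import Order.TTheory GRing.Theory Num.Theory.
Import numFieldNormedType.Exports.

Local Open Scope classical_set_scope.
Local Open Scope ring_scope.

(** Write a.b for the form a g^-1 b, so that the connection of the theorem is
    d_a b - (a.b + b.a)/2.

    This operation has the algebraic properties of a connection and is
    torsion-free since its second term is symmetric. It is metric: the derivative
    of the weak metric, the integral of tr (g^-1 b g^-1 c), along a involves
    - g^-1 a g^-1 twice, and this is what the second term provides
    ([conn_metric], [formula_levi_civita]). Conversely, the difference of two
    torsion-free metric connections is symmetric in its two arguments and
    skew-symmetric in the last argument and the argument of the metric, hence
    zero ([levi_civita_formula]); definiteness of the weak metric is enough.

    The curvature is then a computation: second derivatives cancel by symmetry,
    and the rest is the algebra of the product a.b ([conn_curvature]). The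
    sectional curvature follows by cyclicity of the trace ([nabla_sectional]).

    For a curve u the geodesic equation is u'' = u' u^-1 u' at every point of M.
    It says that u^-1 u' is constant, equal to A, so that u' = u A and
    u = g e^(tA) ([geodesic_gexp]); conversely this curve is smooth in the Frechet
    space of forms and solves the equation ([gexp_geodesic]).

    The analysis behind this rests on three points. First, convergence in the
    C^oo topology is convergence of all partial derivatives of the components
    when the point moves together with the index ([cvg_two_formP]); families
    converging in this sense are stable under sums, products, inverses and
    exponentials of matrices ([smM_mul], [smM_inv], [smM_exp]). Secondly, smooth
    fields are stable under the operations in the formula. Directional
    derivatives that are jointly continuous are multilinear ([dders_add]) and
    symmetric ([dders_sym]) and satisfy a chain rule ([is_dd_mder]), and the
    classes [Ck], whose elements keep the directions as arguments, are stable
    under differentiation. Thirdly, on continuous functions with compact support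
    the iterated integral is linear, bounded and definite
    ([rV_integral_linear], [rV_integral_eq0]), whence the corresponding
    properties of the volume integral.

    For the exponential, everything comes from one remark: Q Y = Z Q implies
    Q e^Y = e^Z Q ([expmx_intertwine]). With block matrices it shows that the
    differences and derivatives of the exponential are blocks of exponentials of
    larger matrices ([Ublock_diff], [derive_expmx]). *)

(** * Families of smooth functions on an open set of R^n *)

Section SmoothFamilies.
Variables (R : realType) (n : nat).
Implicit Types (U : set 'rV[R]_n) (v : 'rV[R]_n).

Definition pd (W : normedModType R) (j : 'I_n) (f : 'rV[R]_n -> W) :=
  fun v => 'D_(delta_mx 0 j) f v.

(** [partials] adds derivatives on the outside of [s]; an induction on the order
    of differentiability of a family needs the innermost one. *)
Lemma partials_rcons (W : normedModType R) s j (f : 'rV[R]_n -> W) :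
  partials (rcons s j) f = partials s (pd j f).
Proof. by elim: s => //= i s ->. Qed.

(** Allows a differentiability proof to discard a remainder of order o(y - x)
    without naming the derivative. *)
Lemma small_diff (V W : normedModType R) (r : V -> W) (x : V) :
  r x = 0 -> (forall e : R, 0 < e -> \forall y \near x, `|r y| <= e * `|y - x|) ->
  differentiable r x /\ 'd r x = (fun=> 0) :> (V -> W).
Proof.
move=> r0 H.
have L0 : linear (fun _ : V => 0 : W) by move=> k u v; rewrite scaler0 addr0.
pose z : {linear V -> W} := HB.pack (fun _ : V => 0 : W) (GRing.isLinear.Build _ _ _ _ _ L0).
have zE : r \o shift x = cst (r x) + z +o_ 0 id.
  apply/eqaddoP => _/posnumP[e].
  have K : \forall h \near (0 : V), `|r (h + x)| <= e%:num * `|h + x - x|.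
    have := near_shift 0 x (fun y => `|r y| <= e%:num * `|y - x|); rewrite subr0 => <-.
    exact: H.
  apply: filterS K => h; rewrite addrK.
  by change (`|r (h + x)| <= e%:num * `|h| -> `|r (h + x) - (r x + 0)| <= e%:num * `|h|);
    rewrite r0 addr0 subr0.
have zc : continuous z by move=> y; exact: cvg_cst.
have ddE : 'd r x = z :> (V -> W) by apply: diff_unique.
split; last exact: ddE.
apply/diff_locallyxP; split; first by rewrite ddE.
by move=> h; rewrite ddE; have := congr1 (fun k => k h) zE; rewrite /=.
Qed.

Lemma near_eq_diff (V W : normedModType R) (f g : V -> W) x :
  (\forall y \near x, f y = g y) -> differentiable f x ->
  differentiable g x /\ 'd g x = 'd f x :> (V -> W).
Proof.
move=> fg df; pose r y := g y - f y.
have [|e e0|dr r0] := @small_diff V W r x.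
- by rewrite /r (nbhs_singleton fg) subrr.
- apply: filterS fg => y fgy.
  by rewrite /r fgy subrr normr0 mulr_ge0// ltW.
have gE : g = f + r by apply/funext => y; rewrite /r [RHS]/GRing.add /= addrC subrK.
move: gE dr r0; move: {fg}(r) => k -> dk k0; split; first exact: differentiableD.
have D : 'd (f + k) x = 'd f x \+ 'd k x :> (V -> W) by exact: diffD.
by rewrite D; apply/funext => y; rewrite /= k0 addr0.
Qed.

Lemma near_eq_differentiable (V W : normedModType R) (f g : V -> W) x :
  (\forall y \near x, f y = g y) -> differentiable f x -> differentiable g x.
Proof. by move=> fg /(near_eq_diff fg) []. Qed.

Lemma partials_eq (W : normedModType R) U (f g : 'rV[R]_n -> W) s :
  open U -> (forall v, U v -> f v = g v) ->
  forall v, U v -> partials s f v = partials s g v.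
Proof.
move=> oU; elim: s => [|j s IH] fg v Uv /=; first exact: fg.
apply: near_eq_derive; have : nbhs v U by exact: open_nbhs_nbhs.
by apply: filterS => w; exact: IH.
Qed.

(** Convergence of the family [f] to [fl] along [F], together with the
    derivatives up to order [N], when the point moves together with the index.
    For continuous limits this is locally uniform convergence, in a form that
    passes through products and quotients by the plain limit rules. [A] collects
    indices for which [f i] is differentiable. *)
Fixpoint smN (I : Type) (F : set_system I) (A : set I) U (N : nat)
    (f : I -> 'rV[R]_n -> R) (fl : 'rV[R]_n -> R) : Prop :=
  [/\ forall i, A i -> forall v, U v -> differentiable (f i) v,
      forall v, U v -> differentiable fl v &
      forall v, U v -> f p.1 p.2 @[p --> filter_prod F (nbhs v)] --> fl v]
  /\ if N is N'.+1 then forall j, smN F A U N' (fun i => pd j (f i)) (pd j fl)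
     else True.

Section Fam.
Variables (I : Type) (F : set_system I) (FF : Filter F) (A : set I) (FA : F A) (U : set 'rV[R]_n).
Hypothesis oU : open U.
Implicit Types (f g : I -> 'rV[R]_n -> R).

Lemma near_prodU v : U v -> \forall p \near filter_prod F (nbhs v), A p.1 /\ U p.2.
Proof.
move=> Uv; exists (A, U) => //=; split => //; exact: open_nbhs_nbhs.
Qed.

Lemma smN_base N f fl : smN F A U N f fl ->
  [/\ forall i, A i -> forall v, U v -> differentiable (f i) v,
      forall v, U v -> differentiable fl v &
      forall v, U v -> f p.1 p.2 @[p --> filter_prod F (nbhs v)] --> fl v].
Proof. by case: N => [|N] []. Qed.

Lemma smN_le N f fl : smN F A U N.+1 f fl -> smN F A U N f fl.
Proof.
elim: N f fl => [|N IH] f fl /= [? H]; split => // j.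
exact: IH (H j).
Qed.

Lemma smN_eq N f g fl gl : (forall i, A i -> forall v, U v -> f i v = g i v) ->
  (forall v, U v -> fl v = gl v) -> smN F A U N f fl -> smN F A U N g gl.
Proof.
move=> + + H; elim: N f g fl gl H => [|N IH] f g fl gl [[d d0 c] H] fg fg0.
all: have base : [/\ forall i, A i -> forall v, U v -> differentiable (g i) v,
      forall v, U v -> differentiable gl v &
      forall v, U v -> g p.1 p.2 @[p --> filter_prod F (nbhs v)] --> gl v].
1,3: split=> [i Ai v Uv|v Uv|v Uv];
  [ apply: near_eq_differentiable (d i Ai v Uv);
    apply: filterS (open_nbhs_nbhs (conj oU Uv)) => w; exact: fg
  | apply: near_eq_differentiable (d0 v Uv);
    apply: filterS (open_nbhs_nbhs (conj oU Uv)) => w; exact: fg0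
  | rewrite -fg0//; apply: cvg_trans (c v Uv); apply: near_eq_cvg;
    by apply: filterS (near_prodU Uv) => -[i w] /= [Ai Uw]; rewrite fg ].
- by split.
- split=> // j; apply: IH (H j) _ _.
  + by move=> i Ai v Uv; exact: (partials_eq [:: j] oU (fg i Ai)).
  + by move=> v Uv; exact: (partials_eq [:: j] oU fg0).
Unshelve. all: by end_near. Qed.

Lemma smN_intro N f fl :
  [/\ forall i, A i -> forall v, U v -> differentiable (f i) v,
      forall v, U v -> differentiable fl v &
      forall v, U v -> f p.1 p.2 @[p --> filter_prod F (nbhs v)] --> fl v] ->
  (forall N', N = N'.+1 ->
    forall j, smN F A U N' (fun i => pd j (f i)) (pd j fl)) ->
  smN F A U N f fl.
Proof. by case: N => [|N] H H'; split => //; exact: H'. Qed.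

Lemma smN_cst N (c : I -> R) (c0 : R) : c @ F --> c0 ->
  smN F A U N (fun i _ => c i) (fun=> c0).
Proof.
elim: N c c0 => [|N IH] c c0 cc; apply: smN_intro => //.
- split; [by move=> i _ v _; exact: differentiable_cst | by move=> v _; exact: differentiable_cst|].
  move=> v Uv; apply: (cvg_comp fst c) cc; exact: cvg_fst.
- split; [by move=> i _ v _; exact: differentiable_cst | by move=> v _; exact: differentiable_cst|].
  move=> v Uv; apply: (cvg_comp fst c) cc; exact: cvg_fst.
- move=> _ [<-] j.
  have -> : (fun i : I => pd j (fun=> c i)) = (fun i (_ : 'rV[R]_n) => 0).
    by apply/funext => i; apply/funext => v; exact: derive_cst.
  have -> : pd j (fun=> c0) = (fun=> 0).
    by apply/funext => v; exact: derive_cst.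
  by apply: IH; exact: cvg_cst.
Unshelve. all: by end_near. Qed.

Lemma smN_const N (c : R) : smN F A U N (fun _ _ => c) (fun=> c).
Proof. by apply: (@smN_cst N (fun=> c)); exact: cvg_cst. Qed.

Lemma smN_add N f fl g gl : smN F A U N f fl -> smN F A U N g gl ->
  smN F A U N (fun i v => f i v + g i v) (fun v => fl v + gl v).
Proof.
elim: N f fl g gl => [|N IH] f fl g gl Hf Hg.
all: have [df dfl cf] := smN_base Hf; have [dg dgl cg] := smN_base Hg.
all: apply: smN_intro => //.
1,2: split;
  [ move=> i Ai v Uv; apply: (@differentiableD _ _ _ (f i) (g i)); [exact: (df i Ai)|exact: (dg i Ai)]
  | by move=> v Uv; apply: (@differentiableD _ _ _ fl gl); [exact: dfl|exact: dgl]
  | by move=> v Uv; apply: cvgD; [exact: cf|exact: cg]].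
move=> _ [<-] j; case: Hf => _ /(_ j) Hf; case: Hg => _ /(_ j) Hg.
apply: smN_eq (IH _ _ _ _ Hf Hg).
- move=> i Ai v Uv; rewrite /pd.
  rewrite -(deriveD (f := f i) (g := g i))//; apply: diff_derivable;
   [exact: (df i Ai)|exact: (dg i Ai)].
- move=> v Uv; rewrite /pd -(deriveD (f := fl) (g := gl))//; apply: diff_derivable;
   [exact: dfl|exact: dgl].
Unshelve. all: by end_near. Qed.

Lemma smN_mul N f fl g gl : smN F A U N f fl -> smN F A U N g gl ->
  smN F A U N (fun i v => f i v * g i v) (fun v => fl v * gl v).
Proof.
elim: N f fl g gl => [|N IH] f fl g gl Hf Hg.
all: have [df dfl cf] := smN_base Hf; have [dg dgl cg] := smN_base Hg.
all: apply: smN_intro => //.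
1,2: split;
  [ move=> i Ai v Uv; apply: (@differentiableM _ _ (f i) (g i)); [exact: (df i Ai)|exact: (dg i Ai)]
  | by move=> v Uv; apply: (@differentiableM _ _ fl gl); [exact: dfl|exact: dgl]
  | by move=> v Uv; apply: cvgM; [exact: cf|exact: cg]].
move=> _ [<-] j; have {}Hf' := smN_le Hf; have {}Hg' := smN_le Hg.
case: Hf => _ /(_ j) Hf; case: Hg => _ /(_ j) Hg.
apply: smN_eq (smN_add (IH _ _ _ _ Hf' Hg) (IH _ _ _ _ Hg' Hf)).
- move=> i Ai v Uv; rewrite /pd.
  rewrite -(deriveM (f := f i) (g := g i))//; apply: diff_derivable;
   [exact: (df i Ai)|exact: (dg i Ai)].
- move=> v Uv; rewrite /pd -(deriveM (f := fl) (g := gl))//; apply: diff_derivable;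
   [exact: dfl|exact: dgl].
Unshelve. all: by end_near. Qed.

Lemma smN_inv N f fl : (forall v, U v -> fl v != 0) ->
  (forall i, A i -> forall v, U v -> f i v != 0) -> smN F A U N f fl ->
  smN F A U N (fun i v => (f i v)^-1) (fun v => (fl v)^-1).
Proof.
move=> nz0 nz; elim: N => [|N IH] Hf; have [df dfl cf] := smN_base Hf.
all: apply: smN_intro => //.
1,2: split;
  [ move=> i Ai v Uv; apply: (@differentiableV _ _ (f i)); [exact: (df i Ai)|exact: (nz i Ai)]
  | by move=> v Uv; apply: (@differentiableV _ _ fl); [exact: dfl|exact: nz0]
  | by move=> v Uv; apply: cvgV; [exact: nz0|exact: cf]].
move=> _ [<-] j; have {IH} IH := IH (smN_le Hf).
case: Hf => _ /(_ j) Hf.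
apply: smN_eq (smN_mul (smN_const N (-1)) (smN_mul (smN_mul IH IH) Hf)).
- move=> i Ai v Uv; rewrite /pd deriveV.
  + by rewrite expr2 invfM mulN1r scaleNr.
  + exact: (nz i Ai).
  + by apply: diff_derivable; exact: (df i Ai).
- move=> v Uv; rewrite /pd deriveV.
  + by rewrite expr2 invfM mulN1r scaleNr.
  + exact: nz0.
  + by apply: diff_derivable; exact: dfl.
Unshelve. all: by end_near. Qed.

Lemma smN_sum N (J : finType) (P : pred J) (f : J -> I -> 'rV[R]_n -> R) fl :
  (forall j, smN F A U N (f j) (fl j)) ->
  smN F A U N (fun i v => \sum_(j | P j) f j i v) (fun v => \sum_(j | P j) fl j v).
Proof.
move=> H; elim: (index_enum J) => [|j s IH].
  apply: smN_eq (smN_const N (0 : R)).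
  - by move=> i _ v _; rewrite big_nil.
  - by move=> v _; rewrite big_nil.
have [Pj|Pj] := boolP (P j).
  apply: smN_eq (smN_add (H j) IH).
  - by move=> i _ v _; rewrite big_cons Pj.
  - by move=> v _; rewrite big_cons Pj.
apply: smN_eq IH.
- by move=> i _ v _; rewrite big_cons (negbTE Pj).
- by move=> v _; rewrite big_cons (negbTE Pj).
Unshelve. all: by end_near. Qed.

Lemma smN_prod N (J : finType) (P : pred J) (f : J -> I -> 'rV[R]_n -> R) fl :
  (forall j, smN F A U N (f j) (fl j)) ->
  smN F A U N (fun i v => \prod_(j | P j) f j i v) (fun v => \prod_(j | P j) fl j v).
Proof.
move=> H; elim: (index_enum J) => [|j s IH].
  apply: smN_eq (smN_const N (1 : R)).
  - by move=> i _ v _; rewrite big_nil.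
  - by move=> v _; rewrite big_nil.
have [Pj|Pj] := boolP (P j).
  apply: smN_eq (smN_mul (H j) IH).
  - by move=> i _ v _; rewrite big_cons Pj.
  - by move=> v _; rewrite big_cons Pj.
apply: smN_eq IH.
- by move=> i _ v _; rewrite big_cons (negbTE Pj).
- by move=> v _; rewrite big_cons (negbTE Pj).
Unshelve. all: by end_near. Qed.

(** Convergence to all orders, defined by recursion on the order, is
    convergence of all iterated partial derivatives. *)
Lemma smN_partials f fl :
  (forall N, smN F A U N f fl) <->
  [/\ forall i, A i -> smooth_on U (f i), smooth_on U fl &
    forall s v, U v -> partials s (f p.1) p.2 @[p --> filter_prod F (nbhs v)] -->
      partials s fl v].
Proof.
split=> [H|[Hf Hf0 c] N].
  have K s : [/\ forall i, A i -> forall v, U v -> differentiable (partials s (f i)) v,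
      forall v, U v -> differentiable (partials s fl) v &
      forall v, U v -> partials s (f p.1) p.2 @[p --> filter_prod F (nbhs v)] -->
        partials s fl v].
    elim/last_ind: s f fl H => [|s j IH] f fl H.
      by have [] := smN_base (H 0%N).
    have [|H1 H2 H3] := IH (fun i => pd j (f i)) (pd j fl).
      by move=> N; have [_ +] := H N.+1; apply.
    split.
    - by move=> i Ai v Uv; rewrite partials_rcons; exact: H1.
    - by move=> v Uv; rewrite partials_rcons; exact: H2.
    - move=> v Uv; rewrite partials_rcons; apply: cvg_trans (H3 v Uv).
      by apply: near_eq_cvg; near=> p; rewrite partials_rcons.
  split.
  - by move=> i Ai s v Uv; have [+ _ _] := K s; apply.
  - by move=> s v Uv; have [_ + _] := K s; apply.
  - by move=> s v Uv; have [_ _ +] := K s; apply.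
elim: N f fl Hf Hf0 c => [|N IH] f fl Hf Hf0 c; apply: smN_intro => //.
- split; [by move=> i Ai v Uv; exact: (Hf i Ai [::])|by move=> v Uv; exact: (Hf0 [::])|].
  exact: (c [::]).
- split; [by move=> i Ai v Uv; exact: (Hf i Ai [::])|by move=> v Uv; exact: (Hf0 [::])|].
  exact: (c [::]).
- move=> _ [<-] j; apply: IH.
  + by move=> i Ai s; rewrite -partials_rcons; exact: Hf.
  + by move=> s; rewrite -partials_rcons; exact: Hf0.
  + move=> s v Uv; rewrite -partials_rcons; apply: cvg_trans (c (rcons s j) v Uv).
    by apply: near_eq_cvg; near=> p; rewrite partials_rcons.
Unshelve. all: by end_near. Qed.

End Fam.
End SmoothFamilies.

(** * Families of smooth matrix-valued functions *)

Section MxFam.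
Variables (R : realType).

Lemma cvg_mxP (T : Type) (F : set_system T) (FF : Filter F) p q
    (X : T -> 'M[R]_(p, q)) (A : 'M[R]_(p, q)) :
  X @ F --> A <-> forall i j, (X x i j @[x --> F] --> A i j).
Proof.
split=> [XA i j|XA].
  apply: (cvg_comp X (fun M : 'M[R]_(p, q) => M i j) XA).
  exact: coord_continuous.
apply/cvgrPdist_le => /= e e0; near=> x.
rewrite /Num.Def.normr/= mx_normrE (bigmax_le _ (ltW e0))//= => i _.
rewrite !mxE/=; move: i; near: x; apply: filter_forall => /= i.
exact: ((cvgrPdist_le _ _).1 (XA i.1 i.2)).
Unshelve. all: by end_near. Qed.

Lemma differentiable_mxP (V : normedModType R) p q (f : V -> 'M[R]_(p, q)) v :
  differentiable f v <-> forall i j, differentiable (fun w => f w i j) v.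
Proof.
split=> [df i j|df].
  apply: (differentiable_comp (f := f) (g := fun M : 'M[R]_(p, q) => M i j)) => //.
  exact: differentiable_coord.
have -> : f = \sum_(i < p) \sum_(j < q) (fun w => f w i j *: delta_mx i j).
  apply/funext => w; rewrite fct_sumE [LHS]matrix_sum_delta; apply: eq_bigr => i _.
  by rewrite fct_sumE.
apply: differentiable_sum => i; apply: differentiable_sum => j.
exact: differentiableZl.
Qed.

Section withn.
Variable n : nat.
Implicit Type U : set 'rV[R]_n.

Lemma partials_mxE U p q (f : 'rV[R]_n -> 'M[R]_(p, q)) :
  open U -> smooth_on U f -> forall s v, U v -> forall i j,
  partials s f v i j = partials s (fun w => f w i j) v.
Proof.
move=> oU sf; elim=> [|k s IH] v Uv i j //=.
rewrite derive_mx; last exact: diff_derivable (sf s v Uv).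
rewrite mxE; apply: near_eq_derive.
have : nbhs v U by exact: open_nbhs_nbhs.
by apply: filterS => w Uw; rewrite IH.
Qed.

(** The iterated derivatives of a matrix-valued function are those of its
    entries, but only where those of lower order are differentiable: both facts
    are carried along in one induction. *)
Lemma smooth_on_mxP U p q (f : 'rV[R]_n -> 'M[R]_(p, q)) : open U ->
  smooth_on U f <-> forall i j, smooth_on U (fun w => f w i j).
Proof.
move=> oU; split=> [sf i j s v Uv|sf].
  have := (differentiable_mxP _ _).1 (sf s v Uv) i j.
  apply: near_eq_differentiable; have : nbhs v U by exact: open_nbhs_nbhs.
  by apply: filterS => w Uw; rewrite (partials_mxE oU sf).
have K s : forall v, U v ->
    differentiable (partials s f) v /\
    forall i j, partials s f v i j = partials s (fun w => f w i j) v.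
  elim: s => [|k s IH] v Uv /=.
    by split=> //; apply/differentiable_mxP => i j; exact: (sf i j [::]).
  have E w : U w -> forall i j,
      'D_(delta_mx 0 k) (partials s f) w i j = 'D_(delta_mx 0 k) (partials s (fun w => f w i j)) w.
    move=> Uw i j; have [d e] := IH w Uw.
    rewrite derive_mx; last exact: diff_derivable.
    rewrite mxE; apply: near_eq_derive.
    have : nbhs w U by exact: open_nbhs_nbhs.
    by apply: filterS => x Ux; have [_ ->] := IH x Ux.
  split; last exact: E.
  apply/(differentiable_mxP _ v) => i j; have := sf i j (k :: s) v Uv.
  apply: near_eq_differentiable; have : nbhs v U by exact: open_nbhs_nbhs.
  by apply: filterS => w Uw; rewrite E.
by move=> s v Uv; have [] := K s v Uv.
Qed.

Section fam.
Variables (I : Type) (F : set_system I) (FF : Filter F) (A : set I) (FA : F A)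
  (U : set 'rV[R]_n).
Hypothesis oU : open U.

Definition smM p q (f : I -> 'rV[R]_n -> 'M[R]_(p, q))
    (fl : 'rV[R]_n -> 'M[R]_(p, q)) :=
  forall N i j, smN F A U N (fun k v => f k v i j) (fun v => fl v i j).

Lemma smM_partials p q (f : I -> 'rV[R]_n -> 'M[R]_(p, q)) fl :
  smM f fl <->
  [/\ forall i, A i -> smooth_on U (f i), smooth_on U fl &
    forall s v, U v -> partials s (f p.1) p.2 @[p --> filter_prod F (nbhs v)] -->
      partials s fl v].
Proof.
split=> [H|[sf sl c] N i j].
  have K i j : forall N, smN F A U N (fun k v => f k v i j) (fun v => fl v i j).
    by move=> N; exact: H.
  have sf k : A k -> smooth_on U (f k).
    move=> Ak; apply/smooth_on_mxP => // i j.
    by have /(smN_partials FF A U _ _)[+ _ _] := K i j; apply.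
  have sl : smooth_on U fl.
    by apply/smooth_on_mxP => // i j; have /(smN_partials FF A U _ _)[_ + _] := K i j.
  split=> // s v Uv; apply/cvg_mxP => i j; rewrite (partials_mxE oU sl)//.
  have /(smN_partials FF A U _ _)[_ _ /(_ s v Uv)] := K i j; apply: cvg_trans.
  apply: near_eq_cvg; apply: filterS (near_prodU FA oU Uv) => -[k w] /= [Ak Uw].
  by rewrite (partials_mxE oU (sf k Ak)).
move: N; apply/(smN_partials FF A U _ _); split.
- by move=> k Ak; exact: ((smooth_on_mxP _ oU).1 (sf k Ak)).
- exact: ((smooth_on_mxP _ oU).1 sl).
- move=> s v Uv; rewrite -(partials_mxE oU sl)//.
  have /cvg_mxP/(_ i j) := c s v Uv; apply: cvg_trans.
  apply: near_eq_cvg; apply: filterS (near_prodU FA oU Uv) => -[k w] /= [Ak Uw].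
  by rewrite (partials_mxE oU (sf k Ak)).
Qed.

Lemma smM_eq p q (f g : I -> 'rV[R]_n -> 'M[R]_(p, q)) fl gl :
  (forall i, A i -> forall v, U v -> f i v = g i v) ->
  (forall v, U v -> fl v = gl v) -> smM f fl -> smM g gl.
Proof.
move=> fg fgl H N i j; apply: (smN_eq FF FA oU _ _ (H N i j)).
- by move=> k Ak v Uv; rewrite fg.
- by move=> v Uv; rewrite fgl.
Qed.

Lemma smM_add p q (f g : I -> 'rV[R]_n -> 'M[R]_(p, q)) fl gl :
  smM f fl -> smM g gl -> smM (fun k v => f k v + g k v) (fun v => fl v + gl v).
Proof.
move=> H K N i j; apply: (smN_eq FF FA oU _ _ (smN_add FF FA oU (H N i j) (K N i j))).
- by move=> k Ak v Uv; rewrite mxE.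
- by move=> v Uv; rewrite mxE.
Qed.

Lemma smM_const p q (c : 'M[R]_(p, q)) : smM (fun _ _ => c) (fun _ => c).
Proof. by move=> N i j; exact: smN_const. Qed.

Lemma smM_scale p q (f : I -> 'rV[R]_n -> 'M[R]_(p, q)) fl (c : I -> R) (c0 : R) :
  c @ F --> c0 -> smM f fl -> smM (fun k v => c k *: f k v) (fun v => c0 *: fl v).
Proof.
move=> cc H N i j; have C : smN F A U N (fun k _ => c k) (fun=> c0) by apply: smN_cst.
apply: (smN_eq FF FA oU _ _ (smN_mul FF FA oU C (H N i j))).
- by move=> k Ak v Uv; rewrite mxE.
- by move=> v Uv; rewrite mxE.
Qed.

Lemma smM_mul p q r (f : I -> 'rV[R]_n -> 'M[R]_(p, q)) fl
    (g : I -> 'rV[R]_n -> 'M[R]_(q, r)) gl :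
  smM f fl -> smM g gl -> smM (fun k v => f k v *m g k v) (fun v => fl v *m gl v).
Proof.
move=> H K N i j.
have S : smN F A U N (fun k v => \sum_(l : 'I_q) f k v i l * g k v l j)
    (fun v => \sum_(l : 'I_q) fl v i l * gl v l j).
  apply: (smN_sum (f := fun l k v => f k v i l * g k v l j)
    (fl := fun l v => fl v i l * gl v l j) FF FA oU xpredT) => l.
  exact: smN_mul.
apply: (smN_eq FF FA oU _ _ S).
- by move=> k Ak v Uv; rewrite mxE.
- by move=> v Uv; rewrite mxE.
Qed.

Lemma smN_det p (f : I -> 'rV[R]_n -> 'M[R]_p) fl N :
  smM f fl -> smN F A U N (fun k v => \det (f k v)) (fun v => \det (fl v)).
Proof.
move=> H; rewrite /determinant; apply: (smN_sum (f := fun (s : 'S_p) k v => (-1) ^+ s * \prod_i f k v i (s i))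
  (fl := fun (s : 'S_p) v => (-1) ^+ s * \prod_i fl v i (s i)) FF FA oU xpredT) => s.
apply: (smN_mul FF FA oU); first exact: smN_const.
by apply: (smN_prod (f := fun i k v => f k v i (s i))
  (fl := fun i v => fl v i (s i)) FF FA oU xpredT) => i; exact: H.
Qed.

Lemma smN_trace p (f : I -> 'rV[R]_n -> 'M[R]_p) fl N :
  smM f fl -> smN F A U N (fun k v => \tr (f k v)) (fun v => \tr (fl v)).
Proof. by move=> H; apply: (smN_sum (f := fun s k v => f k v s s)
  (fl := fun s v => fl v s s) FF FA oU xpredT) => s; exact: H. Qed.

(** By Cramer's rule, from determinants and one reciprocal. *)
Lemma smM_inv p (f : I -> 'rV[R]_n -> 'M[R]_p) fl :
  (forall k, A k -> forall v, U v -> f k v \in unitmx) ->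
  (forall v, U v -> fl v \in unitmx) ->
  smM f fl -> smM (fun k v => invmx (f k v)) (fun v => invmx (fl v)).
Proof.
move=> uf ul H N i j.
have D := smN_det N H.
have Dv : smN F A U N (fun k v => (\det (f k v))^-1) (fun v => (\det (fl v))^-1).
  apply: (smN_inv FF FA oU _ _ D) => [v Uv|k Ak v Uv].
    by have := ul v Uv; rewrite unitmxE unitfE.
  by have := uf k Ak v Uv; rewrite unitmxE unitfE.
have C : smN F A U N (fun k v => cofactor (f k v) j i) (fun v => cofactor (fl v) j i).
  apply: (smN_mul FF FA oU); first exact: smN_const.
  apply: smN_det => N' i' j'; apply: (smN_eq FF FA oU _ _ (H N' (lift j i') (lift i j'))).
  - by move=> k Ak v Uv; rewrite !mxE.
  - by move=> v Uv; rewrite !mxE.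
apply: (smN_eq FF FA oU _ _ (smN_mul FF FA oU Dv C)).
- by move=> k Ak v Uv; rewrite /invmx uf// !mxE.
- by move=> v Uv; rewrite /invmx ul// !mxE.
Qed.

End fam.

Lemma smM_smooth (I : Type) (F : set_system I) (FF : Filter F) (A : set I)
    (FA : F A) U p q (f : 'rV[R]_n -> 'M[R]_(p, q)) :
  open U -> smooth_on U f -> smM F A U (fun=> f) f.
Proof.
move=> oU sf; apply/smM_partials => //; split=> // s v Uv.
apply: (cvg_comp snd (partials s f)); first exact: cvg_snd.
exact: differentiable_continuous (sf s v Uv).
Qed.

End withn.
End MxFam.

(** * Positive definite matrices *)

Section PosDef.
Variable R : realType.

Definition posdef n (A : 'M[R]_n) :=
  forall v : 'rV[R]_n, v != 0 -> 0 < (v *m A *m v^T) 0 0.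

Lemma posdef_congr n (A P : 'M[R]_n) : P \in unitmx -> posdef A ->
  posdef (P *m A *m P^T).
Proof.
move=> uP pA v v0.
have -> : v *m (P *m A *m P^T) *m v^T = (v *m P) *m A *m (v *m P)^T.
  by rewrite trmx_mul !mulmxA.
apply: pA; apply: contra_neq v0 => vP0.
by rewrite -[v](mulmxK uP) vP0 mul0mx.
Qed.

Lemma invmx_congr n (A P : 'M[R]_n) : P \in unitmx -> A \in unitmx ->
  invmx (P *m A *m P^T) = invmx P^T *m invmx A *m invmx P.
Proof.
move=> uP uA; have uT : P^T \in unitmx by rewrite unitmx_tr.
have uL : P *m A *m P^T \in unitmx by rewrite !unitmx_mul uP uA.
apply: (can_inj (mulKmx uL)); rewrite mulmxV// -!mulmxA (mulKVmx uT).
by rewrite (mulKVmx uA) mulmxV.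
Qed.

(** Induction on the size, through the Schur complement of the first entry. The
    factor [L] is what exhibits tr (A^-1 C A^-1 C) as a sum of squares. *)
Lemma cholesky n (A : 'M[R]_n) : A^T = A -> posdef A ->
  exists2 L, L \in unitmx & A = L *m L^T.
Proof.
elim: n A => [|n IH] A sA pA.
  by exists 1%:M; rewrite ?unitmx1// [LHS]flatmx0 [RHS]flatmx0.
change ('M[R]_(1 + n)) in A.
have sAb : A = block_mx (ulsubmx A) (ursubmx A) (ursubmx A)^T (drsubmx A).
  by rewrite trmx_ursub sA submxK.
set b := ursubmx A in sAb; set d := drsubmx A in sAb.
set a := ulsubmx A 0 0.
have aE : ulsubmx A = a%:M by rewrite [LHS]mx11_scalar.
rewrite aE in sAb.
have quad (x : 'rV[R]_1) (w : 'rV[R]_n) :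
    (row_mx x w *m A *m (row_mx x w)^T) 0 0 =
    a * x 0 0 ^+ 2 + 2 * x 0 0 * (w *m b^T) 0 0 + (w *m d *m w^T) 0 0.
  rewrite sAb mul_row_block tr_row_mx mul_row_col !mulmxDl.
  have -> : x *m b *m w^T = x *m (w *m b^T)^T by rewrite trmx_mul trmxK mulmxA.
  rewrite [x]mx11_scalar tr_scalar_mx [w *m b^T]mx11_scalar tr_scalar_mx.
  rewrite -!scalar_mxM !mxE/= !mulr1n; ring.
have a0 : 0 < a.
  have := pA (row_mx 1%:M 0); rewrite quad !mul0mx !mxE mulr0 !addr0 expr1n mulr1.
  apply; apply/eqP => /(congr1 (@lsubmx R 1 1 n)); rewrite row_mxKl => /matrixP/(_ 0 0).
  by rewrite !mxE => /eqP; rewrite oner_eq0.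
have dS : d^T = d by rewrite trmx_drsub sA.
pose S := d - a^-1 *: (b^T *m b).
have sS : S^T = S by rewrite linearB/= linearZ/= trmx_mul trmxK dS.
have pS : posdef S.
  move=> w w0; set y := (w *m b^T) 0 0.
  have -> : (w *m S *m w^T) 0 0 = (row_mx (- y / a)%:M w *m A *m (row_mx (- y / a)%:M w)^T) 0 0.
    rewrite quad mulmxBr mulmxBl -scalemxAr -scalemxAl.
    have -> : w *m (b^T *m b) *m w^T = (w *m b^T) *m (w *m b^T)^T.
      by rewrite trmx_mul trmxK !mulmxA.
    rewrite [w *m b^T]mx11_scalar -/y tr_scalar_mx -scalar_mxM !mxE/= !mulr1n.
    by field; exact: lt0r_neq0.
  apply: pA; apply/eqP => /(congr1 (@rsubmx R 1 1 n)); rewrite row_mxKr linear0 => w00.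
  by rewrite w00 eqxx in w0.
have [L uL SE] := IH S sS pS.
pose al := Num.sqrt a.
have al2 : al * al = a by rewrite -expr2 sqr_sqrtr// ltW.
have al0 : al != 0 by rewrite sqrtr_eq0 -ltNge.
pose L1 : 'M[R]_(1 + n) := block_mx al%:M 0 (al^-1 *: b^T) L.
exists L1.
  have dL1 : \det L1 = al * \det L by rewrite /L1 (det_lblock al%:M) det_scalar1.
  by move: uL; rewrite !unitmxE dL1 unitrM => ->; rewrite unitfE al0.
have -> : L1 *m L1^T = block_mx (al%:M *m al%:M) (al%:M *m (al^-1 *: b))
    ((al^-1 *: b^T) *m al%:M) ((al^-1 *: b^T) *m (al^-1 *: b) + L *m L^T).
  have -> : L1^T = block_mx al%:M (al^-1 *: b) 0 L^T.
    by rewrite [LHS](tr_block_mx (al%:M : 'M[R]_1)) tr_scalar_mx linearZ/= trmxK trmx0.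
  by rewrite [LHS](mulmx_block (al%:M : 'M[R]_1)) !mulmx0 !mul0mx !addr0.
rewrite [LHS]sAb -scalar_mxM al2 mul_scalar_mx scalerA divff// scale1r.
rewrite mul_mx_scalar scalerA divff// scale1r.
by rewrite -SE -scalemxAl -scalemxAr scalerA -invfM al2 [_ + S]addrC subrK.
Qed.

Section PosDefTheory.
Variables (n : nat) (A : 'M[R]_n).
Hypotheses (sA : A^T = A) (pA : posdef A).

Lemma posdef_det_gt0 : 0 < \det A.
Proof.
have [L uL ->] := cholesky sA pA.
rewrite det_mulmx det_tr -expr2 exprn_even_gt0//=.
by rewrite -unitfE -unitmxE.
Qed.

Lemma posdef_unit : A \in unitmx.
Proof. by rewrite unitmxE unitfE gt_eqF// posdef_det_gt0. Qed.

(** For A = L L^T the witness is the symmetric matrix D = L^-1 C L^-T, and the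
    trace is tr (D D^T). *)
Lemma sqnorm_posdef (C : 'M[R]_n) : C^T = C -> exists2 D : 'M[R]_n,
  \tr (invmx A *m C *m (invmx A *m C)) = \sum_i \sum_j D i j ^+ 2 &
  D = 0 -> C = 0.
Proof.
move=> sC; have [L uL AE] := cholesky sA pA.
have uLT : L^T \in unitmx by rewrite unitmx_tr.
have iA : invmx A = (invmx L)^T *m invmx L.
  apply: (can_inj (mulKmx posdef_unit)).
  rewrite mulmxV ?posdef_unit// AE !mulmxA -(mulmxA L) -trmx_mul mulVmx// trmx1.
  by rewrite mulmx1 mulmxV.
pose D := invmx L *m C *m (invmx L)^T; exists D.
  have sD : D^T = D by rewrite !trmx_mul trmxK sC mulmxA.
  rewrite iA -!mulmxA mxtrace_mulC -!mulmxA.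
  transitivity (\tr (D *m D^T)).
    by rewrite sD /D !mulmxA.
  rewrite /mxtrace; apply: eq_bigr => i _; rewrite mxE; apply: eq_bigr => j _.
  by rewrite [D^T _ _]mxE expr2.
move=> /(congr1 (fun X => L *m X *m L^T)); rewrite /D mulmx0 mul0mx.
by rewrite !mulmxA mulmxV// mul1mx -mulmxA -trmx_mul mulmxV// trmx1 mulmx1.
Qed.

Lemma tr_sharp_ge0 (C : 'M[R]_n) : C^T = C ->
  0 <= \tr (invmx A *m C *m (invmx A *m C)).
Proof.
move=> /sqnorm_posdef [D -> _].
by apply: sumr_ge0 => i _; apply: sumr_ge0 => j _; exact: sqr_ge0.
Qed.

Lemma tr_sharp_eq0 (C : 'M[R]_n) : C^T = C ->
  \tr (invmx A *m C *m (invmx A *m C)) = 0 -> C = 0.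
Proof.
move=> /sqnorm_posdef [D -> D0] H; apply: D0; apply/matrixP => i j.
move/eqP: H; rewrite psumr_eq0 => [/allP/(_ i (mem_index_enum _))/=|k _]; last first.
  by apply: sumr_ge0 => l _; exact: sqr_ge0.
rewrite psumr_eq0 => [/allP/(_ j (mem_index_enum _))/=|l _]; last exact: sqr_ge0.
by rewrite sqrf_eq0 => /eqP ->; rewrite mxE.
Qed.
End PosDefTheory.

Lemma cvg_mulmx (T : Type) (F : set_system T) (FF : Filter F) p q r
    (X : T -> 'M[R]_(p, q)) (Y : T -> 'M[R]_(q, r)) (A : 'M[R]_(p, q)) (B : 'M[R]_(q, r)) :
  X @ F --> A -> Y @ F --> B -> (X t *m Y t @[t --> F]) --> A *m B.
Proof.
move=> /cvg_mxP XA /cvg_mxP YB; apply/cvg_mxP => i j.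
rewrite mxE; under eq_fun do rewrite mxE.
apply: cvg_big => [|k _]; first exact: add_continuous.
by apply: cvgM; [exact: XA|exact: YB].
Qed.

Lemma cvg_trmx (T : Type) (F : set_system T) (FF : Filter F) p q
    (X : T -> 'M[R]_(p, q)) (A : 'M[R]_(p, q)) : X @ F --> A -> ((X t)^T @[t --> F]) --> A^T.
Proof.
move=> /cvg_mxP XA; apply/cvg_mxP => i j.
by rewrite mxE; under eq_fun do rewrite mxE; exact: XA.
Qed.

(** Compactness of the unit sphere makes the neighbourhood independent of the
    vector. *)
Lemma posdef_open n (A : 'M[R]_n) : posdef A -> \forall B \near A, posdef B.
Proof.
move=> pA.
pose S := [set v : 'rV[R]_n | `|v| = 1].
have cS : compact S.
  apply: bounded_closed_compact; first by exists 1; split=> // x x1 v /= ->; exact: ltW.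
  have -> : S = (fun v : 'rV[R]_n => `|v|) @^-1` [set 1] by [].
  by apply: closed_comp => [v _|]; [exact: norm_continuous|exact: closed_eq].
have /compact_near_coveringP/(_ _ (nbhs A)
  (fun B v => 0 < (v *m B *m v^T) 0 0) _) := cS.
move=> H.
have {}H : \forall B \near A, forall v : 'rV[R]_n, S v -> 0 < (v *m B *m v^T) 0 0.
  apply: H => v Sv.
  have v0 : v != 0 by rewrite -normr_eq0 Sv oner_eq0.
  have c : (p.1 *m p.2 *m p.1^T) 0 0 @[p --> filter_prod (nbhs v) (nbhs A)] --> (v *m A *m v^T) 0 0.
    apply: (cvg_mxP _ _ _).1.
    apply: cvg_mulmx; last by apply: cvg_trmx; exact: cvg_fst.
    by apply: cvg_mulmx; [exact: cvg_fst|exact: cvg_snd].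
  have /cvgr_gt := c; move=> /(_ _ (pA v v0)).
  by [].
apply: filterS H => B H v v0.
have nv : `|v| != 0 by rewrite normr_eq0.
have : S (`|v|^-1 *: v) by rewrite /S/= normrZ normfV normr_id mulVf.
move=> /H; rewrite -scalemxAl linearZ/= -scalemxAr -scalemxAl scalerA mxE.
by rewrite pmulr_rgt0// -invfM invr_gt0 mulr_gt0// normr_gt0.
Qed.
End PosDef.

(** * Charts and the C^oo topology *)

Lemma cvg_initialP (S : choiceType) (T : topologicalType) (f : S -> T)
    (F : set_system S) (FF : Filter F) (s : S) :
  F --> (s : initial_topology f) <-> f @ F --> f s.
Proof.
split=> [Fs|Ffs].
  by apply: cvg_trans (initial_continuous (f := f) (x := s)); exact: cvg_app.
move=> A /= [_ [[B oB <-] Bfs sBA]].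
rewrite nbhs_filterE; apply: filterS sBA _; apply: Ffs; exact: open_nbhs_nbhs.
Qed.

Lemma cvg_prodP (I : Type) (T : I -> topologicalType)
    (F : set_system (prod_topology T)) (FF : Filter F) (t : prod_topology T) :
  F --> t <-> forall i, f i @[f --> F] --> t i.
Proof.
split=> [/cvg_sup H i|H]; first by have /cvg_initialP := H i.
by apply/cvg_sup => i; apply/cvg_initialP; exact: H.
Qed.

Lemma cvg_uniform_normP (R : realType) (U : choiceType) (W : normedModType R) (K : set U)
    (F : set_system (U -> W)) (FF : Filter F) (f : U -> W) :
  {uniform K, F --> f} <->
  forall e, 0 < e -> \forall g \near F, forall y, K y -> `|f y - g y| < e.
Proof.
split=> [H e e0|H A].
  apply: H; apply/uniform_nbhs; exists [set xy | ball xy.1 e xy.2]; split.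
    exact: (entourage_ball _ (PosNum e0)).
  by move=> g /= gK y Ky; have := gK y Ky; rewrite -ball_normE.
move=> /uniform_nbhs[E [+ sub]]; rewrite -entourage_ballE => -[e /= e0 eE].
apply: filterS sub _; near=> g => /= y Ky; apply: eE => /=.
by rewrite -ball_normE /=; apply: (near (H e e0) g _ y Ky).
Unshelve. all: by end_near. Qed.

Lemma jacobian_inv (R : realType) n (f h : 'rV[R]_n -> 'rV[R]_n) v :
  differentiable f v -> differentiable h (f v) ->
  (\forall w \near v, w = h (f w)) -> 'J f v *m 'J h (f v) = 1%:M.
Proof.
move=> df dh E; have [_ dE] := near_eq_diff (f := id) (g := h \o f) E (ex_diff (is_diff_def := is_diff_id v)).
have e1 := congr1 (fun k => k _) (diff_comp df dh).
have e2 := congr1 (fun k => k _) dE.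
have e3 := congr1 (fun k => k _) (diff_val (is_diff_def := is_diff_id v)).
apply/row_matrixP => i; rewrite !rowE mulmxA !mul_rV_lin1 mulmx1.
exact: (etrans (esym (e1 _)) (etrans (e2 _) (e3 _))).
Qed.

Lemma near_fst (I J : Type) (F : set_system I) (G : set_system J) (FG : Filter G)
    (P : set I) : F P -> \forall p \near filter_prod F G, P p.1.
Proof. by move=> FP; exists (P, setT) => [|[i j] []] //=; split=> //; exact: filterT. Qed.

Lemma near_snd (I J : Type) (F : set_system I) (G : set_system J) (FF : Filter F)
    (P : set J) : G P -> \forall p \near filter_prod F G, P p.2.
Proof. by move=> GP; exists (setT, P) => [|[i j] []] //=; split=> //; exact: filterT. Qed.

Section Manifold.
Variables (R : realType) (n : nat) (M : manifold R n).
Local Notation two_form := (two_form M).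
Implicit Types (c : chart R n M) (a b g : two_form).

Lemma chart_at_atlas (x : M) : atlas M (chart_at x).
Proof. exact: (s2valP (cid2 (atlas_cover x))). Qed.

Lemma chart_at_dom (x : M) : cdom (chart_at x) x.
Proof. exact: (s2valP' (cid2 (atlas_cover x))). Qed.

Lemma cimg_cinv c v : cimg c v -> cdom c (cinv c v) /\ cmap c (cinv c v) = v.
Proof. by move=> [x cx <-]; rewrite cmapK. Qed.

Lemma open_cimg c : open (cimg c).
Proof. exact: cimg_open. Qed.

Lemma nbhs_cimg c v : cimg c v -> nbhs v (cimg c).
Proof. by move=> cv; apply: open_nbhs_nbhs; split => //; exact: open_cimg. Qed.

Lemma overlap_open c c' : open (overlap c c').
Proof.
rewrite openE => v [cv c'v].
have cc : {for v, continuous (cinv c)}.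
  have := cinv_continuous (c := c); rewrite continuous_open_subspace; last exact: cimg_open.
  by apply; rewrite inE.
apply: filterI; first exact: nbhs_cimg.
by apply: cc; apply: open_nbhs_nbhs; split => //; exact: cdom_open.
Qed.

Lemma transitionK c c' v : overlap c c' v ->
  overlap c' c (transition c c' v) /\ transition c' c (transition c c' v) = v.
Proof.
move=> [cv c'v]; have [cx cmx] := cimg_cinv cv.
rewrite /transition /=; split; last by rewrite cmapK.
by split; [exists (cinv c v)|rewrite /preimage/= cmapK].
Qed.

Lemma jacobian_unit c c' v : atlas M c -> atlas M c' -> overlap c c' v ->
  'J (transition c c') v \in unitmx.
Proof.
move=> Mc Mc' ov; have [s1 s2] := atlas_compatible Mc Mc'.
have [ov' vE] := transitionK ov.
have d1 : differentiable (transition c c') v := s1 [::] v ov.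
have d2 : differentiable (transition c' c) (transition c c' v) := s2 [::] _ ov'.
have E : \forall w \near v, w = transition c' c (transition c c' w).
  have : nbhs v (overlap c c') by apply: open_nbhs_nbhs; split => //; exact: overlap_open.
  by apply: filterS => w /transitionK[_ ->].
by have [u _] := mulmx1_unit (jacobian_inv d1 d2 E); exact: u.
Qed.

(** The change of frame from the chart [c] to the chart that identifies the
    tangent space at the point with R^n. *)
Definition frame c v : 'M[R]_n := 'J (transition c (chart_at (cinv c v))) v.

Lemma frame_unit c v : atlas M c -> cimg c v -> frame c v \in unitmx.
Proof.
move=> Mc cv; apply: jacobian_unit => //; first exact: chart_at_atlas.
by split => //; exact: chart_at_dom.
Qed.

Lemma local_formE c a v :
  local_form c a v = frame c v *m a (cinv c v) *m (frame c v)^T.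
Proof. by []. Qed.

Lemma local_formD c a b v :
  local_form c (a + b) v = local_form c a v + local_form c b v.
Proof. by rewrite !local_formE -mulmxDl -mulmxDr. Qed.

Lemma local_formZ c (k : R) a v : local_form c (k *: a) v = k *: local_form c a v.
Proof. by rewrite !local_formE scalemxAl scalemxAr. Qed.

Lemma local_formB c a b v :
  local_form c (a - b) v = local_form c a v - local_form c b v.
Proof. by rewrite -[- b]scaleN1r local_formD local_formZ scaleN1r. Qed.

Lemma local_form_tr c a v : (a (cinv c v))^T = a (cinv c v) ->
  (local_form c a v)^T = local_form c a v.
Proof. by move=> sa; rewrite local_formE !trmx_mul trmxK sa mulmxA. Qed.

Lemma local_form_unit c g v : atlas M c -> cimg c v ->
  g (cinv c v) \in unitmx -> local_form c g v \in unitmx.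
Proof.
by move=> Mc cv ug; rewrite !unitmx_mul ug unitmx_tr frame_unit.
Qed.

Lemma local_fmul_sharp c a g b v : atlas M c -> cimg c v ->
  g (cinv c v) \in unitmx ->
  local_form c (fmul a (sharp g b)) v =
  local_form c a v *m invmx (local_form c g v) *m local_form c b v.
Proof.
move=> Mc cv ug; have u := frame_unit Mc cv; rewrite !local_formE /fmul /sharp.
have uT : (frame c v)^T \in unitmx by rewrite unitmx_tr.
by rewrite invmx_congr// !mulmxA (mulmxK uT) (mulmxKV u).
Qed.

(** Smoothness without the symmetry required in [S2], for products a g^-1 b. *)
Definition Sm : set two_form :=
  [set a | forall c, atlas M c -> smooth_on (cimg c) (local_form c a)].

(** Uniform convergence on compact sets amounts to convergence with a moving
    point, because the limit is continuous: a closed ball in the chart gives one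
    direction and compactness of [K] the other. All limits of forms are computed
    through this criterion. *)
Lemma cvg_two_formP (I : Type) (F : set_system I) (FF : Filter F)
    (X : I -> two_form) a : Sm a ->
  X @ F --> a <->
  forall c s v, atlas M c -> cimg c v ->
    partials s (local_form c (X p.1)) p.2 @[p --> filter_prod F (nbhs v)] -->
    partials s (local_form c a) v.
Proof.
move=> sa.
transitivity (forall i : chart R n M * seq 'I_n, forall K,
  [/\ atlas M i.1, compact K & K `<=` cimg i.1] ->
  {uniform K, (fun j => partials i.2 (local_form i.1 (X j))) @ F -->
     partials i.2 (local_form i.1 a)}).
  split=> [/cvg_initialP/cvg_prodP H i|H].
    by have /fam_cvgP := H i.
  by apply/cvg_initialP/cvg_prodP => i; apply/fam_cvgP; exact: H.
split=> [H c s v Mc cv|H [c s] K [/= Mc cK Kc]].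
  have : nbhs v (cimg c) by exact: nbhs_cimg.
  move=> /nbhs_ballP[e /= e0 ec].
  (* a compact neighbourhood of [v] inside the chart *)
  pose K := [set w : 'rV[R]_n | `|w - v| <= e / 2].
  have cK : compact K.
    apply: bounded_closed_compact.
      exists (`|v| + e / 2); split; [exact: num_real|move=> x x1 w /= Kw].
      by rewrite -[w](subrK v) (le_trans (ler_normD _ _))// addrC (le_trans _ (ltW x1))// lerD2l.
    have -> : K = (fun w : 'rV[R]_n => `|w - v|) @^-1` [set y | y <= e / 2] by [].
    apply: closed_comp => [w _|]; last exact: closed_le.
    apply: continuous_comp; last exact: norm_continuous.
    apply: (@cvgB _ _ _ (nbhs w) _ id (fun=> v) w v); [exact: cvg_id|exact: cvg_cst].
  have Kc : K `<=` cimg c.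
    move=> w Kw; apply: ec; rewrite -ball_normE /= distrC (le_lt_trans Kw)//.
    by rewrite ltr_pdivrMr// ltr_pMr// ltr1n.
  have /(cvg_uniform_normP _) U := H (c, s) K (And3 Mc cK Kc).
  have C := differentiable_continuous (sa c Mc s v cv).
  apply/cvgrPdist_lt => /= d d0.
  have d20 : 0 < d / 2 by rewrite divr_gt0.
  have /cvgrPdist_lt/(_ _ d20) C' := C.
  have U' : \forall j \near F, forall y, K y ->
    `|partials s (local_form c a) y - partials s (local_form c (X j)) y| < d / 2 := U _ d20.
  have KN : nbhs v K.
    have : \forall w \near v, ball v (e / 2) w by apply: nbhsx_ballx; rewrite divr_gt0.
    by apply: filterS => w; rewrite -ball_normE /= distrC => /ltW.
  have CK : \forall w \near v, `|partials s (local_form c a) v -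
      partials s (local_form c a) w| < d / 2 /\ K w by apply: filterI.
  apply: filterS (filterI (near_fst (nbhs_filter v) U') (near_snd FF CK)) => -[j w] /= [Uj [Cw Kw]].
  rewrite -(subrKA (partials s (local_form c a) w)) (le_lt_trans (ler_normD _ _))//.
  by rewrite [d]splitr ltrD//; exact: Uj.
apply/cvg_uniform_normP => e e0.
have e20 : 0 < e / 2 by rewrite divr_gt0.
have /compact_near_coveringP/(_ _ F (fun j y =>
  `|partials s (local_form c a) y - partials s (local_form c (X j)) y| < e) FF) := cK.
apply => v Kv.
have /cvgrPdist_lt/(_ _ e20) H' := H c s v Mc (Kc v Kv).
have /cvgrPdist_lt/(_ _ e20) C := differentiable_continuous (sa c Mc s v (Kc v Kv)).
have [[A B] /= [FA NB] AB] := H'.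
exists ([set w | `|partials s (local_form c a) v - partials s (local_form c a) w| < e / 2] `&` B, A) => /=.
  by split => //; apply: filterI.
move=> [w j] /= [[C1 Bw] Aj].
rewrite -(subrKA (partials s (local_form c a) v)) (le_lt_trans (ler_normD _ _))//.
rewrite [e]splitr ltrD//; first by rewrite distrC.
exact: (AB (j, w)).
Unshelve. all: by end_near. Qed.

End Manifold.

(** * Algebra and convergence of smooth forms *)

Section Forms.
Variables (R : realType) (n : nat) (M : manifold R n).
Local Notation two_form := (two_form M).
Local Notation S2 := (@S2 R n M).
Local Notation Met := (@Met R n M).
Local Notation Sm := (@Sm R n M).
Implicit Types (c : chart R n M) (a b g : two_form).

Let N0 : Filter (nbhs (0 : R)) := nbhs_filter (0 : R).
Let T0 : nbhs (0 : R) setT := filterT.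

(** The form a B with B = g^-1 b. All tensors of the theorem are polynomials in
    this product. *)
Definition gmul a g b : two_form := fmul a (sharp g b).

Lemma two_formP a b : (forall x, a x = b x) -> a = b.
Proof. by move=> ab; apply/funext. Qed.

Lemma S2_Sm a : S2 a -> Sm a.
Proof. by case. Qed.

Lemma Met_S2 g : Met g -> S2 g.
Proof. by case. Qed.

Lemma Met_Sm g : Met g -> Sm g.
Proof. by move=> /Met_S2/S2_Sm. Qed.

Lemma S2_sym a x : S2 a -> (a x)^T = a x.
Proof. by case. Qed.

Lemma Met_posdef g x : Met g -> posdef (g x).
Proof. by move=> [_ H] v; exact: H. Qed.

Lemma Met_unit g x : Met g -> g x \in unitmx.
Proof. by move=> Mg; apply: posdef_unit; [exact/S2_sym/Met_S2|exact: Met_posdef]. Qed.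

Lemma smooth_smM (I : Type) (F : set_system I) (FF : Filter F) (A : set I) a c :
  F A -> Sm a -> atlas M c -> smM F A (cimg c) (fun=> local_form c a) (local_form c a).
Proof. by move=> FA sa Mc; apply: smM_smooth => //; [exact: open_cimg|exact: sa]. Qed.

(** Turns limit rules for matrices of components into limit rules for forms. *)
Lemma cvg_smM (I : Type) (F : set_system I) (FF : Filter F) (A : set I)
    (X : I -> two_form) a : F A -> (forall i, A i -> Sm (X i)) -> Sm a ->
  X @ F --> a <-> forall c, atlas M c ->
    smM F A (cimg c) (fun i => local_form c (X i)) (local_form c a).
Proof.
move=> FA sX sa; split=> [/(cvg_two_formP _ _ sa) H c Mc|H].
  apply/smM_partials => //; first exact: open_cimg.
  split; [by move=> i Ai; exact: sX|exact: sa|].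
  by move=> s v; exact: H.
apply/(cvg_two_formP _ _ sa) => c s v Mc cv.
by have /(smM_partials FF FA (open_cimg (c := c)))[_ _ +] := H c Mc; apply.
Qed.

Lemma cvg_smM1 (I : Type) (F : set_system I) (FF : Filter F) (A : set I)
    (X : I -> two_form) a c : F A -> (forall i, A i -> Sm (X i)) -> Sm a ->
  X @ F --> a -> atlas M c ->
  smM F A (cimg c) (fun i => local_form c (X i)) (local_form c a).
Proof. by move=> FA sX sa Xa Mc; apply: (proj1 (cvg_smM FF FA sX sa)). Qed.

Lemma cvg_smM2 (I : Type) (F : set_system I) (FF : Filter F) (A : set I)
    (X : I -> two_form) a : F A -> (forall i, A i -> Sm (X i)) -> Sm a ->
  (forall c, atlas M c ->
    smM F A (cimg c) (fun i => local_form c (X i)) (local_form c a)) -> X @ F --> a.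
Proof. by move=> FA sX sa H; apply: (proj2 (cvg_smM FF FA sX sa)). Qed.

(** A smooth form is a convergent constant family, so that the closure properties
    of [Sm] are instances of those of [smM]. *)
Lemma smM_Sm (X : two_form) : (forall c, atlas M c ->
    smM (nbhs (0 : R)) setT (cimg c) (fun=> local_form c X) (local_form c X)) -> Sm X.
Proof.
move=> H c Mc.
by have /(smM_partials N0 T0 (open_cimg (c := c)))[_ + _] := H c Mc; apply.
Qed.

Lemma Sm_add a b : Sm a -> Sm b -> Sm (a + b).
Proof.
move=> sa sb; apply: smM_Sm => c Mc.
have H := smM_add N0 T0 (open_cimg (c := c)) (smooth_smM N0 T0 sa Mc)
  (smooth_smM N0 T0 sb Mc).
by apply: (smM_eq N0 T0 (open_cimg (c := c)) _ _ H) => [i _ v _|v _]; rewrite local_formD.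
Qed.

Lemma Sm_scale k a : Sm a -> Sm (k *: a).
Proof.
move=> sa; apply: smM_Sm => c Mc.
have H := smM_scale N0 T0 (open_cimg (c := c)) (@cvg_cst R k R (nbhs (0 : R)) N0 : (fun=> k) @ _ --> k)
  (smooth_smM N0 T0 sa Mc).
by apply: (smM_eq N0 T0 (open_cimg (c := c)) _ _ H) => [i _ v _|v _]; rewrite local_formZ.
Qed.

Lemma Sm_opp a : Sm a -> Sm (- a).
Proof. by rewrite -scaleN1r; exact: Sm_scale. Qed.

Lemma Sm_sub a b : Sm a -> Sm b -> Sm (a - b).
Proof. by move=> sa sb; apply: Sm_add => //; exact: Sm_opp. Qed.

Lemma smM_gmul (I : Type) (F : set_system I) (FF : Filter F) (A : set I) (FA : F A)
    (X G Y : I -> two_form) a g b c : atlas M c ->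
  (forall i, A i -> Met (G i)) -> Met g ->
  smM F A (cimg c) (fun i => local_form c (X i)) (local_form c a) ->
  smM F A (cimg c) (fun i => local_form c (G i)) (local_form c g) ->
  smM F A (cimg c) (fun i => local_form c (Y i)) (local_form c b) ->
  smM F A (cimg c) (fun i => local_form c (gmul (X i) (G i) (Y i)))
    (local_form c (gmul a g b)).
Proof.
move=> Mc mG mg HX HG HY; have oc := open_cimg (c := c).
have Hi : smM F A (cimg c) (fun i v => invmx (local_form c (G i) v))
    (fun v => invmx (local_form c g v)).
  apply: (smM_inv FF FA oc _ _ HG) => [i Ai v cv|v cv].
    by apply: local_form_unit => //; apply: Met_unit; exact: mG.
  by apply: local_form_unit => //; exact: Met_unit.
apply: (smM_eq FF FA oc _ _ (smM_mul FF FA oc (smM_mul FF FA oc HX Hi) HY)).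
- move=> i Ai v cv; rewrite /gmul local_fmul_sharp//.
  by apply: Met_unit; exact: mG.
- by move=> v cv; rewrite /gmul local_fmul_sharp//; exact: Met_unit.
Qed.

Lemma Sm_gmul a g b : Sm a -> Met g -> Sm b -> Sm (gmul a g b).
Proof.
move=> sa mg sb; apply: smM_Sm => c Mc.
apply: (smM_gmul N0 T0) => //; apply: smooth_smM => //; try exact: T0.
exact: Met_Sm.
Qed.

Lemma S2_add a b : S2 a -> S2 b -> S2 (a + b).
Proof.
move=> Sa Sb; split=> [x|]; last by apply: Sm_add; exact: S2_Sm.
by change ((a x + b x)^T = a x + b x); rewrite linearD/= !S2_sym.
Qed.

Lemma S2_scale k a : S2 a -> S2 (k *: a).
Proof.
move=> Sa; split=> [x|]; last by apply: Sm_scale; exact: S2_Sm.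
by change ((k *: a x)^T = k *: a x); rewrite linearZ/= !S2_sym.
Qed.

Lemma S2_opp a : S2 a -> S2 (- a).
Proof. by rewrite -scaleN1r; exact: S2_scale. Qed.

Lemma S2_sub a b : S2 a -> S2 b -> S2 (a - b).
Proof. by move=> sa sb; apply: S2_add => //; exact: S2_opp. Qed.

Lemma S2_0 : S2 0.
Proof.
split=> [x|]; first by rewrite linear0.
apply: smM_Sm => c Mc; apply: (smM_eq N0 T0 (open_cimg (c := c)) _ _ (smM_const _ _ _ 0)).
- by move=> _ _ v _; rewrite local_formE mulmx0 mul0mx.
- by move=> v _; rewrite local_formE mulmx0 mul0mx.
Qed.

Lemma trmx_inv_sym p (A : 'M[R]_p) : A^T = A -> (invmx A)^T = invmx A.
Proof. by move=> sA; rewrite trmx_inv sA. Qed.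

Lemma S2_gmul_sym a g b : S2 a -> Met g -> S2 b -> S2 (gmul a g b + gmul b g a).
Proof.
move=> Sa Mg Sb; split=> [x|]; last first.
  by apply: Sm_add; apply: Sm_gmul => //; exact: S2_Sm.
change ((gmul a g b x + gmul b g a x)^T = gmul a g b x + gmul b g a x).
rewrite /gmul /fmul /sharp linearD/= !trmx_mul (trmx_inv_sym (S2_sym _ (Met_S2 Mg))) !S2_sym//.
by rewrite addrC !mulmxA.
Qed.

Section Cvg.
Variables (I : Type) (F : set_system I) (FF : Filter F).
Implicit Types (X Y G : I -> two_form).

Lemma cvg_formD X Y a b : (\forall i \near F, Sm (X i)) -> (\forall i \near F, Sm (Y i)) ->
  Sm a -> Sm b -> X @ F --> a -> Y @ F --> b -> X i + Y i @[i --> F] --> a + b.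
Proof.
move=> sX sY sa sb Xa Yb; have FA : F ([set i | Sm (X i) /\ Sm (Y i)]) by apply: filterI.
apply: (cvg_smM2 FF FA) => [i [? ?]||c Mc]; [exact: Sm_add|exact: Sm_add|].
have HX := cvg_smM1 FF FA (fun i h => h.1) sa Xa Mc.
have HY := cvg_smM1 FF FA (fun i h => h.2) sb Yb Mc.
by apply: (smM_eq FF FA (open_cimg (c := c)) _ _ (smM_add FF FA (open_cimg (c := c)) HX HY))
  => [i _ v _|v _]; rewrite local_formD.
Qed.

Lemma cvg_formZ X a (k : I -> R) (k0 : R) : (\forall i \near F, Sm (X i)) -> Sm a ->
  k @ F --> k0 -> X @ F --> a -> k i *: X i @[i --> F] --> k0 *: a.
Proof.
move=> sX sa kk Xa; have FA : F [set i | Sm (X i)] := sX.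
apply: (cvg_smM2 FF FA) => [i ?||c Mc]; [exact: Sm_scale|exact: Sm_scale|].
have HX := cvg_smM1 FF FA (fun i h => h) sa Xa Mc.
by apply: (smM_eq FF FA (open_cimg (c := c)) _ _ (smM_scale FF FA (open_cimg (c := c)) kk HX))
  => [i _ v _|v _]; rewrite local_formZ.
Qed.

Lemma cvg_formN X a : (\forall i \near F, Sm (X i)) -> Sm a ->
  X @ F --> a -> - X i @[i --> F] --> - a.
Proof.
move=> sX sa Xa; rewrite -scaleN1r; under eq_fun do rewrite -scaleN1r.
by apply: cvg_formZ => //; exact: cvg_cst.
Qed.

Lemma cvg_formB X Y a b : (\forall i \near F, Sm (X i)) -> (\forall i \near F, Sm (Y i)) ->
  Sm a -> Sm b -> X @ F --> a -> Y @ F --> b -> X i - Y i @[i --> F] --> a - b.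
Proof.
move=> sX sY sa sb Xa Yb; apply: cvg_formD => //.
- by apply: filterS sY => i; exact: Sm_opp.
- exact: Sm_opp.
- exact: cvg_formN.
Qed.

Lemma cvg_gmul X G Y a g b : (\forall i \near F, Sm (X i)) ->
  (\forall i \near F, Met (G i)) -> (\forall i \near F, Sm (Y i)) ->
  Sm a -> Met g -> Sm b -> X @ F --> a -> G @ F --> g -> Y @ F --> b ->
  gmul (X i) (G i) (Y i) @[i --> F] --> gmul a g b.
Proof.
move=> sX mG sY sa mg sb Xa Gg Yb.
have FA : F [set i | [/\ Sm (X i), Met (G i) & Sm (Y i)]].
  by apply: filterS (filterI (filterI sX mG) sY) => i [[]].
apply: (cvg_smM2 FF FA) => [i [? ? ?]||c Mc]; [exact: Sm_gmul|exact: Sm_gmul|].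
apply: smM_gmul => //; first by move=> i [].
- by apply: cvg_smM1 => // i [].
- by apply: cvg_smM1 => // [i []|]; [move=> _ /Met_Sm|exact: Met_Sm].
- by apply: cvg_smM1 => // i [].
Qed.

Lemma cvg_eval X a x : X @ F --> a -> X i x @[i --> F] --> a x.
Proof.
move=> /cvg_initialP/cvg_prodP H; have Mc := chart_at_atlas x.
set c := chart_at x in Mc; have cv : cimg c (cmap c x) by exists x => //; exact: chart_at_dom.
have /fam_cvgP := H (c, [::]); move=> /(_ [set cmap c x]) K.
have {K}/cvg_uniform_normP K : {uniform [set cmap c x], (fun i => local_form c (X i)) @ F -->
    local_form c a}.
  by apply: K; split; [exact: Mc|exact: compact_set1|move=> _ ->].
have {}K : local_form c (X i) (cmap c x) @[i --> F] --> local_form c a (cmap c x).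
  apply/cvgrPdist_lt => e e0.
  have K' : \forall i \near F, forall y, [set cmap c x] y ->
    `|local_form c a y - local_form c (X i) y| < e := K e e0.
  by apply: filterS K' => i; apply.
have u := frame_unit Mc cv; have uT : (frame c (cmap c x))^T \in unitmx by rewrite unitmx_tr.
have E b : b x = invmx (frame c (cmap c x)) *m local_form c b (cmap c x) *m invmx (frame c (cmap c x))^T.
  by rewrite local_formE cmapK; [rewrite !mulmxA mulmxK// (mulVmx u) mul1mx|exact: chart_at_dom].
rewrite E; under eq_fun do rewrite E.
by apply: cvg_mulmx; [apply: cvg_mulmx => //; exact: cvg_cst|exact: cvg_cst].
Qed.
End Cvg.

Lemma cvg_form_unique (I : Type) (F : set_system I) (FF : ProperFilter F)
    (X : I -> two_form) a b : X @ F --> a -> X @ F --> b -> a = b.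
Proof.
move=> Xa Xb; apply: two_formP => x.
have xa : X i x @[i --> F] --> a x by exact: cvg_eval.
have xb : X i x @[i --> F] --> b x by exact: cvg_eval.
exact: (norm_cvg_unique xa xb).
Qed.

Lemma S2_cvg (I : Type) (F : set_system I) (FF : ProperFilter F)
    (X : I -> two_form) a : (\forall i \near F, S2 (X i)) -> Sm a ->
  X @ F --> a -> S2 a.
Proof.
move=> SX sa Xa; split=> // x.
have Xx : X i x @[i --> F] --> a x by exact: cvg_eval.
have Xt : (X i x)^T @[i --> F] --> (a x)^T by exact: cvg_trmx.
apply: (norm_cvg_unique Xt).
apply: cvg_trans Xx; apply: near_eq_cvg.
by apply: filterS SX => i SXi; rewrite S2_sym.
Qed.

Lemma posdef_local c g v : atlas M c -> cimg c v ->
  posdef (local_form c g v) <-> posdef (g (cinv c v)).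
Proof.
move=> Mc cv; have u := frame_unit Mc cv; split; last exact: posdef_congr.
move=> H; have uV : invmx (frame c v) \in unitmx by rewrite unitmx_inv.
have := posdef_congr uV H; rewrite local_formE.
have uT : (frame c v)^T \in unitmx by rewrite unitmx_tr.
by rewrite trmx_inv !mulmxA mulmxK// mulVmx// mul1mx.
Qed.

(** Positivity is open at every point in every chart; compactness of [M] makes it
    hold at all points for the same indices. *)
Lemma Met_open (I : Type) (F : set_system I) (FF : Filter F)
    (X : I -> two_form) g : compact [set: M] -> (\forall i \near F, S2 (X i)) -> Met g ->
  X @ F --> g -> \forall i \near F, Met (X i).
Proof.
move=> cM SX Mg Xg; have /cvg_two_formP-/(_ (Met_Sm Mg)) H := Xg.
have /compact_near_coveringP/(_ _ F (fun i x => posdef (X i x)) FF) K := cM.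
have {K}K : \forall i \near F, [set: M] `<=` (fun x => posdef (X i x)).
  apply: K => x _; have Mc := chart_at_atlas x; set c := chart_at x in Mc.
  have cx : cdom c x := chart_at_dom x.
  have cv : cimg c (cmap c x) by exists x.
  have := H c [::] _ Mc cv => /=.
  have : posdef (local_form c g (cmap c x)).
    by apply/posdef_local => //; rewrite cmapK//; exact: Met_posdef.
  move=> /posdef_open N /(_ _ N)[[A B] /= [FA NB] AB].
  have cc : {for x, continuous (cmap c)}.
    have := cmap_continuous (c := c); rewrite continuous_open_subspace; last exact: cdom_open.
    by apply; rewrite inE.
  exists ((cmap c @^-1` B) `&` cdom c, A) => /=.
    split => //; apply: filterI; first exact: cc.
    by apply: open_nbhs_nbhs; split => //; exact: cdom_open.
  move=> [y i] /= [[By cy] Ai]; have /= := AB (i, cmap c y) (conj Ai By).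
  by move/(posdef_local _ Mc); rewrite cmapK//; apply; exists y.
by apply: filterS (filterI SX K) => i [Si Ki]; split => // x; exact: Ki.
Qed.

End Forms.

(** * Directional derivatives on the space of forms *)

Lemma cvg_within_comp (I : Type) (T U : topologicalType) (F : set_system I)
    (FF : Filter F) (D : set T) (f : T -> U) (Z : I -> T) p :
  f @ within D (nbhs p) --> f p -> Z @ F --> p -> (\forall i \near F, D (Z i)) ->
  f (Z i) @[i --> F] --> f p.
Proof.
move=> fp Zp DZ A /fp fA.
have : F (Z @^-1` [set x | D x -> A (f x)]) by exact: Zp.
by move=> H; apply: filterS (filterI DZ H) => i [Di]; apply.
Qed.

Section Line.
Variables (R : realType) (n : nat) (M : manifold R n) (cM : compact [set: M]).
Local Notation two_form := (two_form M).
Local Notation S2 := (@S2 R n M).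
Local Notation Met := (@Met R n M).
Local Notation Sm := (@Sm R n M).
Implicit Types (a b g h : two_form).

Lemma cvg_line (I : Type) (F : set_system I) (FF : Filter F) (G : I -> two_form)
    g h (t : I -> R) :
  (\forall i \near F, Sm (G i)) -> Sm g -> Sm h -> G @ F --> g -> t @ F --> (0 : R) ->
  G i + t i *: h @[i --> F] --> g.
Proof.
move=> sG sg sh Gg t0.
have -> : g = g + 0 *: h by rewrite scale0r addr0.
apply: cvg_formD => //.
- by near=> i; exact: Sm_scale.
- exact: Sm_scale.
- by apply: cvg_formZ => //; [near=> i|exact: cvg_cst].
Unshelve. all: by end_near. Qed.

Lemma Met_line g h : Met g -> S2 h -> \forall t \near (0 : R), Met (g + t *: h).
Proof.
move=> Mg Sh; apply: (Met_open (X := fun t => g + t *: h) (nbhs_filter (0 : R)) cM _ Mg).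
  by near=> t; apply: S2_add; [exact: Met_S2|exact: S2_scale].
apply: cvg_line => //; [by near=> t; exact: Met_Sm|exact: Met_Sm|exact: S2_Sm|exact: cvg_cst].
Unshelve. all: by end_near. Qed.

Lemma Met_line' g h : Met g -> S2 h -> \forall t \near (0 : R)^', Met (g + t *: h).
Proof. by move=> Mg Sh; apply: nbhs_dnbhs; exact: Met_line. Qed.

Lemma cvg_line' g h : Met g -> S2 h -> g + t *: h @[t --> (0 : R)^'] --> g.
Proof.
move=> Mg Sh; apply: cvg_line => //.
- by near=> t; exact: Met_Sm.
- exact: Met_Sm.
- exact: S2_Sm.
- exact: cvg_cst.
- exact: nbhs_dnbhs.
Unshelve. all: by end_near. Qed.

Definition is_dd (W : preTopologicalLmodType R) (f : two_form -> W) g h (l : W) :=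
  dquot f g h @ (0 : R)^' --> l.

Lemma is_dd_eq (W : preTopologicalLmodType R) (f f' : two_form -> W) g h l :
  Met g -> S2 h -> (forall x, Met x -> f x = f' x) -> is_dd f g h l -> is_dd f' g h l.
Proof.
move=> Mg Sh ff'; apply: cvg_trans; apply: near_eq_cvg.
apply: filterS (Met_line' Mg Sh) => t Mt.
by rewrite /dquot !ff'.
Qed.

Lemma is_dd_dder (f : two_form -> two_form) g h l : is_dd f g h l -> dder f g h = l.
Proof.
move=> fl; apply: xget_unique => // l' fl'.
exact: (cvg_form_unique _ fl' fl).
Qed.

Lemma dderivable_is_dd (W : preTopologicalLmodType R) (f : two_form -> W) g h :
  dderivable f g h -> is_dd f g h (dder f g h).
Proof. by move=> [l fl]; apply: (xgetPex (0 : W)); exists l. Qed.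

Lemma dder_eq (f f' : two_form -> two_form) g h : Met g -> S2 h ->
  (forall x, Met x -> f x = f' x) -> dderivable f g h ->
  dder f' g h = dder f g h.
Proof.
move=> Mg Sh ff' df; apply: is_dd_dder; apply: is_dd_eq ff' _ => //.
exact: dderivable_is_dd.
Qed.

Lemma is_dd_cst (W : preTopologicalLmodType R) (w : W) g h : is_dd (fun=> w) g h 0.
Proof.
apply: cvg_trans (@cvg_cst W 0 R (0 : R)^' _); apply: near_eq_cvg.
by near=> t; rewrite /dquot subrr scaler0.
Unshelve. all: by end_near. Qed.

Section Rules.
Variables (g h : two_form).
Hypotheses (Mg : Met g) (Sh : S2 h).
Implicit Types X Y : two_form -> two_form.

Let neq0 : \forall t \near (0 : R)^', t != 0.
Proof. exact: nbhs_dnbhs_neq. Qed.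

Let ML := Met_line' Mg Sh.

Lemma dquot_Sm X : (forall x, Met x -> Sm (X x)) ->
  \forall t \near (0 : R)^', Sm (dquot X g h t).
Proof.
move=> sX; apply: filterS ML => t Mt; apply: Sm_scale; apply: Sm_sub; exact: sX.
Qed.

Lemma line_Sm X : (forall x, Met x -> Sm (X x)) ->
  \forall t \near (0 : R)^', Sm (X (g + t *: h)).
Proof. by move=> sX; apply: filterS ML => t Mt; exact: sX. Qed.

Lemma is_dd_cvg X l : (forall x, Met x -> Sm (X x)) -> Sm l -> is_dd X g h l ->
  X (g + t *: h) @[t --> (0 : R)^'] --> X g.
Proof.
move=> sX sl Xl.
have H : X g + t *: dquot X g h t @[t --> (0 : R)^'] --> X g + 0 *: l.
  apply: cvg_formD.
  - by near=> t; exact: sX.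
  - by apply: filterS (dquot_Sm sX) => t; exact: Sm_scale.
  - exact: sX.
  - exact: Sm_scale.
  - exact: cvg_cst.
  - by apply: cvg_formZ => //; [exact: dquot_Sm|exact: nbhs_dnbhs].
rewrite scale0r addr0 in H; apply: cvg_trans H; apply: near_eq_cvg.
apply: filterS neq0 => t t0.
by rewrite /dquot scalerA mulfV// scale1r addrC subrK.
Unshelve. all: by end_near. Qed.

Lemma is_dd_add X Y lX lY : (forall x, Met x -> Sm (X x)) -> (forall x, Met x -> Sm (Y x)) ->
  Sm lX -> Sm lY -> is_dd X g h lX -> is_dd Y g h lY ->
  is_dd (fun x => X x + Y x) g h (lX + lY).
Proof.
move=> sX sY slX slY dX dY.
have H : dquot X g h t + dquot Y g h t @[t --> (0 : R)^'] --> lX + lY.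
  by apply: cvg_formD => //; exact: dquot_Sm.
apply: cvg_trans H; apply: near_eq_cvg; near=> t.
by rewrite /dquot -scalerDr opprD addrACA.
Unshelve. all: by end_near. Qed.

Lemma is_dd_scale (f : two_form -> R^o) X (l : R^o) lX :
  (forall x, Met x -> Sm (X x)) -> Sm lX ->
  is_dd f g h l -> is_dd X g h lX ->
  is_dd (fun x => f x *: X x) g h (l *: X g + f g *: lX).
Proof.
move=> sX slX df dX; have cX := is_dd_cvg sX slX dX.
have H : dquot f g h t *: X (g + t *: h) + f g *: dquot X g h t @[t --> (0 : R)^'] -->
    l *: X g + f g *: lX.
  apply: cvg_formD.
  - by apply: filterS (line_Sm sX) => t; exact: Sm_scale.
  - by apply: filterS (dquot_Sm sX) => t; exact: Sm_scale.
  - by apply: Sm_scale; exact: sX.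
  - exact: Sm_scale.
  - by apply: cvg_formZ => //; [exact: line_Sm|exact: sX].
  - by apply: cvg_formZ => //; [exact: dquot_Sm|exact: cvg_cst].
apply: cvg_trans H; apply: near_eq_cvg; near=> t.
rewrite /dquot.
have -> : t^-1 *: (f (g + t *: h) - f g) = t^-1 * (f (g + t *: h) - f g) :> R by [].
move: (f _) (f g) (X _) (X g) => u v A B.
rewrite -(scalerA t^-1) (scalerA v) [v * _]mulrC -scalerA -scalerDr.
by congr (_ *: _); rewrite scalerBl scalerBr addrA subrK.
Unshelve. all: by end_near. Qed.

Lemma gmulE a x b y : gmul a x b y = a y *m (invmx (x y) *m b y).
Proof. by []. Qed.

(** The derivative of the inverse, - g^-1 h g^-1, comes from the identity
    G1^-1 - G0^-1 = - G1^-1 (G1 - G0) G0^-1. *)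
Lemma is_dd_gmul X Y lX lY : (forall x, Met x -> Sm (X x)) -> (forall x, Met x -> Sm (Y x)) ->
  Sm lX -> Sm lY -> is_dd X g h lX -> is_dd Y g h lY ->
  is_dd (fun x => gmul (X x) x (Y x)) g h
    (gmul lX g (Y g) - gmul (gmul (X g) g h) g (Y g) + gmul (X g) g lY).
Proof.
move=> sX sY slX slY dX dY.
have cX := is_dd_cvg sX slX dX; have cY := is_dd_cvg sY slY dY.
have cg := cvg_line' Mg Sh.
have sh := S2_Sm Sh; have sg := Met_Sm Mg; have sXg := sX _ Mg; have sYg := sY _ Mg.
have H : gmul (dquot X g h t) (g + t *: h) (Y (g + t *: h))
    - gmul (gmul (X g) (g + t *: h) h) g (Y (g + t *: h)) + gmul (X g) g (dquot Y g h t)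
    @[t --> (0 : R)^'] --> gmul lX g (Y g) - gmul (gmul (X g) g h) g (Y g) + gmul (X g) g lY.
  have S1 : \forall t \near (0 : R)^', Sm (gmul (dquot X g h t) (g + t *: h) (Y (g + t *: h))).
    apply: filterS (filterI (filterI (dquot_Sm sX) ML) (line_Sm sY)) => t [[? ?] ?].
    exact: Sm_gmul.
  have S2' : \forall t \near (0 : R)^', Sm (gmul (X g) (g + t *: h) h).
    by apply: filterS ML => t ?; exact: Sm_gmul.
  have S3 : \forall t \near (0 : R)^', Sm (gmul (gmul (X g) (g + t *: h) h) g (Y (g + t *: h))).
    by apply: filterS (filterI S2' (line_Sm sY)) => t [? ?]; exact: Sm_gmul.
  have S4 : \forall t \near (0 : R)^', Sm (gmul (X g) g (dquot Y g h t)).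
    by apply: filterS (dquot_Sm sY) => t ?; exact: Sm_gmul.
  apply: cvg_formD => //.
  - by apply: filterS (filterI S1 S3) => t [? ?]; exact: Sm_sub.
  - by apply: Sm_sub; apply: Sm_gmul => //; exact: Sm_gmul.
  - exact: Sm_gmul.
  - apply: cvg_formB => //.
    + exact: Sm_gmul.
    + by apply: Sm_gmul => //; exact: Sm_gmul.
    + by apply: cvg_gmul => //; [exact: dquot_Sm|exact: line_Sm].
    + apply: cvg_gmul => //; try exact: cvg_cst.
      * by near=> t.
      * exact: line_Sm.
      * exact: Sm_gmul.
      * by apply: cvg_gmul => //; try exact: cvg_cst; near=> t.
  - apply: cvg_gmul => //; try exact: cvg_cst; try by near=> t.
    exact: dquot_Sm.
apply: cvg_trans H; apply: near_eq_cvg; apply: filterS (filterI neq0 ML) => t [t0 Mt].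
rewrite /dquot; apply: two_formP => x.
change (gmul (t^-1 *: (X (g + t *: h) - X g)) (g + t *: h) (Y (g + t *: h)) x -
  gmul (gmul (X g) (g + t *: h) h) g (Y (g + t *: h)) x +
  gmul (X g) g (t^-1 *: (Y (g + t *: h) - Y g)) x =
  t^-1 *: (gmul (X (g + t *: h)) (g + t *: h) (Y (g + t *: h)) x - gmul (X g) g (Y g) x)).
rewrite !gmulE.
change ((t^-1 *: (X (g + t *: h)%R x - X g x)) *m (invmx ((g + t *: h) x) *m Y (g + t *: h)%R x) -
  X g x *m (invmx ((g + t *: h) x) *m h x) *m (invmx (g x) *m Y (g + t *: h) x) +
  X g x *m (invmx (g x) *m (t^-1 *: (Y (g + t *: h) x - Y g x))) =
  t^-1 *: (X (g + t *: h) x *m (invmx ((g + t *: h) x) *m Y (g + t *: h) x) -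
    X g x *m (invmx (g x) *m Y g x))).
have uG := Met_unit x Mt; have ug := Met_unit x Mg.
have hE : h x = t^-1 *: ((g + t *: h) x - g x).
  change (h x = t^-1 *: (g x + t *: h x - g x)).
  by rewrite addrC addKr scalerA mulVf// scale1r.
move: (X (g + t *: h) x) (Y (g + t *: h) x) (X g x) (Y g x) => X1 Y1 X0 Y0.
rewrite hE; move: {hE} ((g + t *: h) x) (g x) uG ug => G1 G0 uG ug.
have E : invmx G1 *m (t^-1 *: (G1 - G0)) *m invmx G0 = t^-1 *: (invmx G0 - invmx G1).
  by rewrite -scalemxAr -scalemxAl mulmxBr mulVmx// mulmxBl mul1mx mulmxK.
rewrite !mulmxA -(mulmxA X0) -(mulmxA X0 (_ *m _) (invmx G0)) E.
rewrite -!scalemxAr -!scalemxAl -scalerBr -scalerDr; congr (_ *: _).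
rewrite -!mulmxA !mulmxBl !mulmxBr opprB addrA.
by rewrite !mulmxA addrA !subrK.
Unshelve. all: by end_near. Qed.

End Rules.
End Line.

(** * Mean value arguments in two real variables *)

Section RealLemmas.
Variable R : realType.

Lemma mvt0 (f df : R -> R) (r : R) :
  (forall x : R, `|x| < r -> is_derive x (1 : R) f (df x)) ->
  forall t, `|t| < r -> exists2 c, `|c| <= `|t| & f t - f 0 = df c * t.
Proof.
move=> fd t tr.
have [t0|t0] := leP 0 t.
  have [| |c] := @MVT_segment R f df 0 t t0.
  - move=> x; rewrite in_itv /= => /andP[x0 xt]; apply: fd.
    by rewrite ger0_norm ?ltW// (lt_trans xt)// (le_lt_trans (ler_norm t)).
  - apply: continuous_in_subspaceT => x; rewrite inE /= in_itv /= => /andP[x0 xt].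
    have xr : `|x| < r by rewrite ger0_norm// (le_lt_trans xt)// (le_lt_trans (ler_norm t)).
    by apply: differentiable_continuous; apply/derivable1_diffP; have [] := fd x xr.
  rewrite in_itv /= => /andP[c0 ct]; rewrite subr0 => E; exists c => //.
  by rewrite !ger0_norm.
have [| |c] := @MVT_segment R f df t 0 (ltW t0).
- move=> x; rewrite in_itv /= => /andP[x0 xt]; apply: fd.
  by rewrite ler0_norm ?ltW// (lt_trans _ tr)// ltr0_norm// ltrN2.
- apply: continuous_in_subspaceT => x; rewrite inE /= in_itv /= => /andP[x0 xt].
  have xr : `|x| < r by rewrite ler0_norm// (le_lt_trans _ tr)// (ltr0_norm t0) lerN2.
  by apply: differentiable_continuous; apply/derivable1_diffP; have [] := fd x xr.
rewrite in_itv /= => /andP[c0 ct]; rewrite sub0r mulrN => E; exists c => //.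
  by rewrite (ltr0_norm t0) ler0_norm// lerN2.
by rewrite -[f t - _]opprB E opprK.
Qed.

Lemma near00 (P : R * R -> Prop) : (\forall p \near ((0 : R), (0 : R)), P p) ->
  exists2 r, 0 < r & forall s t, `|s| < r -> `|t| < r -> P (s, t).
Proof.
move=> /nbhs_ballP[r /= r0 rP]; exists r => // s t sr tr; apply: rP.
by split; rewrite -ball_normE /= sub0r normrN.
Qed.

(** F t t - F 0 0 is the sum of F t t - F t 0, which is t times a value of [D]
    near the origin, and of F t 0 - F 0 0. *)
Lemma diag_derive (F D : R -> R -> R) (L : R) :
  (\forall p \near ((0 : R), (0 : R)), is_derive p.2 (1 : R) (F p.1) (D p.1 p.2)) ->
  (D p.1 p.2 @[p --> ((0 : R), (0 : R))] --> D 0 0) ->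
  (t^-1 * (F t 0 - F 0 0) @[t --> (0 : R)^'] --> L) ->
  t^-1 * (F t t - F 0 0) @[t --> (0 : R)^'] --> L + D 0 0.
Proof.
move=> /near00[r r0 rD] cD FL.
have H : t^-1 * (F t t - F t 0) @[t --> (0 : R)^'] --> D 0 0.
  apply/cvgrPdist_lt => e e0; have /cvgrPdist_lt/(_ e e0)/near00[d d0 dD] := cD.
  have m0 : 0 < Num.min r d by rewrite lt_min r0.
  near=> t.
  have t0 : t != 0 by near: t; exact: nbhs_dnbhs_neq.
  have : `|t| < Num.min r d by near: t; exact: dnbhs0_lt.
  rewrite lt_min => /andP[tr td].
  have [c ct ->] := mvt0 (f := F t) (df := D t) (fun x xr => rD t x tr xr) tr.
  by rewrite mulrCA mulVf// mulr1; apply: (dD t c) => //; exact: le_lt_trans td.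
apply: cvg_trans (cvgD FL H); apply: near_eq_cvg; near=> t.
by rewrite /= -mulrDr addrC addrA subrK.
Unshelve. all: by end_near. Qed.

(** Both mixed derivatives are mean values of the same second difference
    F h h - F h 0 - F 0 h + F 0 0. *)
Lemma schwarz (F A B AB BA : R -> R -> R) :
  (\forall p \near ((0 : R), (0 : R)),
    [/\ is_derive p.1 (1 : R) (F ^~ p.2) (A p.1 p.2), is_derive p.2 (1 : R) (A p.1) (AB p.1 p.2),
       is_derive p.2 (1 : R) (F p.1) (B p.1 p.2) & is_derive p.1 (1 : R) (B ^~ p.2) (BA p.1 p.2)]) ->
  (AB p.1 p.2 @[p --> ((0 : R), (0 : R))] --> AB 0 0) ->
  (BA p.1 p.2 @[p --> ((0 : R), (0 : R))] --> BA 0 0) ->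
  AB 0 0 = BA 0 0.
Proof.
move=> /near00[r r0 rD] cAB cBA; apply/eqP; rewrite -subr_eq0 -normr_le0.
apply/ler_addgt0Pl => e e0; rewrite addr0.
have e20 : 0 < e / 2 by rewrite divr_gt0.
have /cvgrPdist_lt/(_ _ e20)/near00[d1 d10 D1] := cAB.
have /cvgrPdist_lt/(_ _ e20)/near00[d2 d20 D2] := cBA.
pose m := Num.min r (Num.min d1 d2).
have m0 : 0 < m by rewrite !lt_min r0 d10.
pose h := m / 2; have h0 : 0 < h by rewrite divr_gt0.
have hm : `|h| < m by rewrite gtr0_norm// ltr_pdivrMr// ltr_pMr// ltr1n.
have mr : m <= r by rewrite ge_min lexx.
have md1 : m <= d1 by rewrite /m minCA ge_min lexx.
have md2 : m <= d2 by rewrite /m minA ge_min lexx orbT.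
have z0 : `|0 : R| < r by rewrite normr0.
have hr := lt_le_trans hm mr.
pose phi s := F s h - F s 0; pose dphi s := A s h - A s 0.
have [|c ch E1] := @mvt0 phi dphi r _ h hr.
  move=> x xr; apply: is_deriveB; first by have [] := rD x h xr hr.
  by have [] := rD x 0 xr z0.
have cr := le_lt_trans ch hr.
have [|d dh E2] := @mvt0 (A c) (AB c) r _ h hr.
  by move=> x xr; have [] := rD c x cr xr.
pose psi t := F h t - F 0 t; pose dpsi t := B h t - B 0 t.
have [|c' ch' E3] := @mvt0 psi dpsi r _ h hr.
  move=> x xr; apply: is_deriveB; first by have [] := rD h x hr xr.
  by have [] := rD 0 x z0 xr.
have cr' := le_lt_trans ch' hr.
have [|d' dh' E4] := @mvt0 (B ^~ c') (BA ^~ c') r _ h hr.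
  by move=> x xr; have [] := rD x c' xr cr'.
have E : AB c d = BA d' c'.
  apply: (mulIf (lt0r_neq0 h0)); apply: (mulIf (lt0r_neq0 h0)).
  rewrite -E2 -/(dphi c) -E1 -E4 -/(dpsi c') -E3 /phi /psi.
  by ring.
rewrite -(subrKA (AB c d)) (le_trans (ler_normD _ _))// [leRHS]splitr; apply: lerD.
  by apply: ltW; apply: (D1 c d); apply: le_lt_trans (lt_le_trans hm md1).
rewrite E distrC; apply: ltW; apply: (D2 d' c'); apply: le_lt_trans (lt_le_trans hm md2) => //.
Qed.
End RealLemmas.

(** * Multilinearity and symmetry of higher directional derivatives *)

Lemma dnbhs0_scale (R : realType) (k : R) : k != 0 ->
  k * t @[t --> (0 : R)^'] --> (0 : R)^'.
Proof.
move=> k0 A; rewrite /dnbhs /within /= => A0.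
have c : k * t @[t --> (0 : R)] --> (0 : R).
  by rewrite -[X in _ --> X](mulr0 k); apply: cvgM; [exact: cvg_cst|exact: cvg_id].
have cA : \forall t \near (0 : R), k * t != 0 -> A (k * t) by exact: (c _ A0).
by apply: filterS cA => t /= H t0; apply: H; rewrite mulf_neq0.
Qed.

Lemma near_dnbhs0_scale (R : realType) (k : R) (P : R -> Prop) : k != 0 ->
  (\forall t \near (0 : R)^', P t) -> \forall t \near (0 : R)^', P (k * t).
Proof. by move=> k0; exact: (dnbhs0_scale k0). Qed.

Section Multilinear.
Variables (R : realType) (n : nat) (M : manifold R n) (cM : compact [set: M]).
Local Notation two_form := (two_form M).
Local Notation S2 := (@S2 R n M).
Local Notation Met := (@Met R n M).
Local Notation Sm := (@Sm R n M).
Implicit Types (a b g h : two_form).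

Lemma cvg_entry (I : Type) (F : set_system I) (FF : Filter F) (X : I -> two_form) a y i j :
  X @ F --> a -> X k y i j @[k --> F] --> a y i j.
Proof.
move=> Xa; have E : X k y @[k --> F] --> a y by exact: cvg_eval.
by have /cvg_mxP/(_ i j) := E.
Qed.

Lemma dquot_cvg_entry (f : two_form -> two_form) z a l y i j : is_dd f z a l ->
  t^-1 * (f (z + t *: a) y i j - f z y i j) @[t --> (0 : R)^'] --> l y i j.
Proof.
move=> fl; have E : dquot f z a t y @[t --> (0 : R)^'] --> l y by exact: cvg_eval.
have /cvg_mxP/(_ i j) := E; apply: cvg_trans; apply: near_eq_cvg; near=> t.
rewrite /dquot.
change ((t^-1 *: (f (z + t *: a) y - f z y)) i j =
  t^-1 * (f (z + t *: a) y i j - f z y i j)).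
by rewrite !mxE.
Unshelve. all: by end_near. Qed.

Lemma is_derive_line (f : two_form -> two_form) z a l (t : R) y i j :
  is_dd f (z + t *: a) a l ->
  is_derive t (1 : R) (fun s => f (z + s *: a) y i j) (l y i j).
Proof.
move=> fl; have C := dquot_cvg_entry (y := y) (i := i) (j := j) fl.
have {}C : h^-1 *: (((fun s => f (z + s *: a) y i j) \o shift t) (h *: (1 : R)) -
    f (z + t *: a) y i j) @[h --> (0 : R)^'] --> l y i j.
  apply: cvg_trans C; apply: near_eq_cvg; near=> h.
  rewrite /= -addrA -scalerDl.
  by have -> : t + h = h *: (1 : R) + t by rewrite addrC; congr (_ + _); rewrite /GRing.scale/= mulr1.
split; first by apply/cvg_ex; eexists; exact: C.
exact: cvg_lim C.
Unshelve. all: by end_near. Qed.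

Lemma dders_cvg (W : preTopologicalLmodType R) (S : set W) (f : two_form -> W)
    (m : nat) (I : Type) (F : set_system I) (FF : Filter F)
    (G : I -> two_form) g (Y : 'I_m -> I -> two_form) (y : 'I_m -> two_form) :
  smooth_map S f -> G @ F --> g -> (forall j, Y j @ F --> y j) ->
  (\forall i \near F, Met (G i)) -> (forall j, \forall i \near F, S2 (Y j i)) ->
  Met g -> (forall j, S2 (y j)) ->
  dders f [seq Y j i | j : 'I_m] (G i) @[i --> F] --> dders f [seq y j | j : 'I_m] g.
Proof.
move=> [_ /(_ m)/subspace_continuousP C] Gg Yy MG SY Mg Sy.
have := C (g, y : prod_topology (fun=> two_form)) (conj Mg Sy).
move=> /cvg_within_comp H.
apply: (H I F FF (fun i => (G i, (fun j => Y j i) : prod_topology (fun=> two_form)))).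
  apply: (cvg_pair (H := nbhs (y : prod_topology (fun=> two_form))) Gg).
  by apply/cvg_prodP => j; exact: Yy.
have SY' : \forall i \near F, forall j, S2 (Y j i) by apply: filter_forall.
by apply: filterS (filterI MG SY') => i [].
Qed.

Lemma seq_nth_ord (T : Type) (x0 : T) (l : seq T) :
  [seq nth x0 l j | j : 'I_(size l)] = l.
Proof.
rewrite /image_mem (map_comp (nth x0 l) val) -[X in map _ X]/(map val (enum 'I_(size l))).
by rewrite val_enum_ord map_nth_iota0// take_size.
Qed.

Lemma dders_cvg_const (W : preTopologicalLmodType R) (S : set W) (f : two_form -> W)
    (I : Type) (F : set_system I) (FF : Filter F) (G : I -> two_form) g l :
  smooth_map S f -> (forall a, a \in l -> S2 a) -> Met g -> G @ F --> g ->
  (\forall i \near F, Met (G i)) ->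
  dders f l (G i) @[i --> F] --> dders f l g.
Proof.
move=> sf Sl Mg Gg MG.
have SY j : S2 (nth 0 l (j : 'I_(size l))) by apply: Sl; apply: mem_nth.
have := dders_cvg FF (Y := fun (j : 'I_(size l)) _ => nth 0 l j)
  (y := fun j : 'I_(size l) => nth 0 l j) sf Gg _ MG _ Mg SY.
rewrite seq_nth_ord; apply; first by move=> j; exact: cvg_cst.
by move=> j; near=> i; exact: SY.
Unshelve. all: by end_near. Qed.

Lemma Met_line2 x a a' : Met x -> S2 a -> S2 a' ->
  (\forall p \near ((0 : R), (0 : R)), Met (x + p.1 *: a + p.2 *: a')) /\
  x + p.1 *: a + p.2 *: a' @[p --> ((0 : R), (0 : R))] --> x.
Proof.
move=> Mx Sa Sa'.
have C : x + p.1 *: a + p.2 *: a' @[p --> ((0 : R), (0 : R))] --> x.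
  apply: cvg_line => //.
  - near=> p; apply: Sm_add; [exact: Met_Sm|apply: Sm_scale; exact: S2_Sm].
  - exact: Met_Sm.
  - exact: S2_Sm.
  - apply: cvg_line => //; [by near=> p; exact: Met_Sm|exact: Met_Sm|exact: S2_Sm|exact: cvg_cst|].
    exact: cvg_fst.
  - exact: cvg_snd.
split => //; apply: (Met_open _ cM _ Mx C).
near=> p; apply: S2_add; last exact: S2_scale.
by apply: S2_add; [exact: Met_S2|exact: S2_scale].
Unshelve. all: by end_near. Qed.

Section SmoothField.
Variables (b : two_form -> two_form) (sb : smooth_map S2 b).

Definition S2_dirs (l : seq two_form) := forall a, a \in l -> S2 a.

Lemma S2_dirs_cons a l : S2_dirs (a :: l) <-> S2 a /\ S2_dirs l.
Proof.
split=> [H|[Sa Sl] x]; last by rewrite inE => /orP[/eqP ->|/Sl].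
by split=> [|x xl]; apply: H; rewrite inE ?eqxx// xl orbT.
Qed.

Lemma dders_S2 l x : S2_dirs l -> Met x -> S2 (dders b l x).
Proof. by move=> Sl Mx; have [H _] := sb; have [] := H l x Sl Mx. Qed.

Lemma dders_is_dd l x a : S2_dirs l -> Met x -> S2 a ->
  is_dd (dders b l) x a (dders b (a :: l) x).
Proof.
move=> Sl Mx Sa; have [H _] := sb; have [_ /(_ a Sa)] := H l x Sl Mx.
exact: dderivable_is_dd.
Qed.

(** Directional derivatives need not be additive in the direction; joint
    continuity makes them so, by [diag_derive] on the plane through [x] spanned by
    [a] and [a']. *)
Lemma dders_add0 l x a a' : S2_dirs l -> Met x -> S2 a -> S2 a' ->
  dders b ((a + a') :: l) x = dders b (a :: l) x + dders b (a' :: l) x.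
Proof.
move=> Sl Mx Sa Sa'; apply: two_formP => y; apply/matrixP => i j.
have [ML CL] := Met_line2 Mx Sa Sa'.
pose F (s t : R) := dders b l (x + s *: a + t *: a') y i j.
pose D (s t : R) := dders b (a' :: l) (x + s *: a + t *: a') y i j.
have F00 : F 0 0 = dders b l x y i j by rewrite /F !scale0r !addr0.
have D00 : D 0 0 = dders b (a' :: l) x y i j by rewrite /D !scale0r !addr0.
have H1 : \forall p \near ((0 : R), (0 : R)), is_derive p.2 (1 : R) (F p.1) (D p.1 p.2).
  by apply: filterS ML => p Mp; apply: is_derive_line; exact: dders_is_dd.
have H2 : D p.1 p.2 @[p --> ((0 : R), (0 : R))] --> D 0 0.
  rewrite D00; apply: (cvg_entry (X := fun p => dders b (a' :: l) (x + p.1 *: a + p.2 *: a')) (nbhs_filter ((0 : R), (0 : R)))).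
  have Sl' : S2_dirs (a' :: l) by apply/S2_dirs_cons.
  exact: (dders_cvg_const _ sb Sl' Mx CL ML).
have H3 : t^-1 * (F t 0 - F 0 0) @[t --> (0 : R)^'] --> dders b (a :: l) x y i j.
  rewrite F00; apply: cvg_trans (dquot_cvg_entry (y := y) (i := i) (j := j) (dders_is_dd Sl Mx Sa)).
  by apply: near_eq_cvg; near=> t; rewrite /F scale0r addr0.
have H := diag_derive H1 H2 H3; rewrite D00 in H.
have H4 := dquot_cvg_entry (y := y) (i := i) (j := j) (dders_is_dd Sl Mx (S2_add Sa Sa')).
have {}H4 : t^-1 * (F t t - F 0 0) @[t --> (0 : R)^'] --> dders b ((a + a') :: l) x y i j.
  rewrite F00; apply: cvg_trans H4; apply: near_eq_cvg; near=> t.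
  by rewrite /F scalerDr addrA.
rewrite (norm_cvg_unique H4 H).
by change (dders b (a :: l) x y i j + dders b (a' :: l) x y i j =
  (dders b (a :: l) x y + dders b (a' :: l) x y) i j); rewrite mxE.
Unshelve. all: by end_near. Qed.

Lemma dders_sym x a a' : Met x -> S2 a -> S2 a' ->
  dders b [:: a; a'] x = dders b [:: a'; a] x.
Proof.
move=> Mx Sa Sa'; apply: two_formP => y; apply/matrixP => i j.
have [ML CL] := Met_line2 Mx Sa Sa'.
have S0 : S2_dirs [::] by move=> ?; rewrite in_nil.
have Sa1 : S2_dirs [:: a] by apply/S2_dirs_cons.
have Sa1' : S2_dirs [:: a'] by apply/S2_dirs_cons.
pose F l (s t : R) := dders b l (x + s *: a + t *: a') y i j.
have F00 l : F l 0 0 = dders b l x y i j by rewrite /F !scale0r !addr0.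
suff H : F [:: a'; a] 0 0 = F [:: a; a'] 0 0.
  exact: (etrans (esym (F00 _)) (etrans (esym H) (F00 _))).
apply: (@schwarz _ (F [::]) (F [:: a]) (F [:: a']) (F [:: a'; a]) (F [:: a; a'])).
- apply: filterS ML => p Mp.
  have E (s t : R) : x + s *: a + t *: a' = x + t *: a' + s *: a by rewrite addrAC.
  split.
  + rewrite /F; under eq_fun do rewrite E; rewrite E.
    by apply: is_derive_line; apply: dders_is_dd => //; rewrite -E.
  + by apply: is_derive_line; exact: dders_is_dd.
  + by apply: is_derive_line; exact: dders_is_dd.
  + rewrite /F; under eq_fun do rewrite E; rewrite E.
    by apply: is_derive_line; apply: dders_is_dd => //; rewrite -E.
- rewrite F00; apply: (cvg_entry (X := fun p => dders b [:: a'; a] (x + p.1 *: a + p.2 *: a')) (nbhs_filter ((0 : R), (0 : R)))).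
  have Sl' : S2_dirs [:: a'; a] by apply/S2_dirs_cons.
  exact: (dders_cvg_const _ sb Sl' Mx CL ML).
- rewrite F00; apply: (cvg_entry (X := fun p => dders b [:: a; a'] (x + p.1 *: a + p.2 *: a')) (nbhs_filter ((0 : R), (0 : R)))).
  have Sl' : S2_dirs [:: a; a'] by apply/S2_dirs_cons.
  exact: (dders_cvg_const _ sb Sl' Mx CL ML).
Qed.

Lemma dders_scale0 l x (k : R) a : S2_dirs l -> Met x -> S2 a ->
  dders b ((k *: a) :: l) x = k *: dders b (a :: l) x.
Proof.
move=> Sl Mx Sa; rewrite /=; apply: is_dd_dder.
have [->|k0] := eqVneq k 0.
  rewrite !scale0r; apply: cvg_trans (@cvg_cst two_form 0 R (0 : R)^' _).
  by apply: near_eq_cvg; near=> t; rewrite /dquot scaler0 addr0 subrr scaler0.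
have D := dders_is_dd Sl Mx Sa.
have kt := dnbhs0_scale k0.
have {}D : dquot (dders b l) x a (k * t) @[t --> (0 : R)^'] --> dder (dders b l) x a.
  exact: (cvg_comp _ _ kt D).
have SD : Sm (dder (dders b l) x a) by apply: S2_Sm; apply: (@dders_S2 (a :: l)) => //; apply/S2_dirs_cons.
have SQ : \forall t \near (0 : R)^', Sm (dquot (dders b l) x a (k * t)).
  have H : \forall t \near (0 : R)^', Sm (dquot (dders b l) x a t).
    by apply: (dquot_Sm cM) => // z Mz; apply: S2_Sm; exact: dders_S2.
  exact: (near_dnbhs0_scale (P := fun t => Sm (dquot (dders b l) x a t)) k0 H).
have Z : k *: dquot (dders b l) x a (k * t) @[t --> (0 : R)^'] --> k *: dder (dders b l) x a.
  by apply: cvg_formZ => //; exact: cvg_cst.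
apply: cvg_trans Z; apply: near_eq_cvg; near=> t.
by rewrite /dquot scalerA invfM mulrA mulfV// mul1r scalerA [t * k]mulrC.
Unshelve. all: by end_near. Qed.

Lemma S2_dirs_cat l1 l2 : S2_dirs (l1 ++ l2) <-> S2_dirs l1 /\ S2_dirs l2.
Proof.
elim: l1 => [|a l1 IH] /=; first by split=> [H|[]].
by rewrite !S2_dirs_cons IH; split=> [[? []]|[[]]].
Qed.

(** The case of an empty [l1] is differentiated along the directions in [l1]. *)
Lemma dders_add l1 l2 x a a' : S2_dirs l1 -> S2_dirs l2 -> Met x -> S2 a -> S2 a' ->
  dders b (l1 ++ (a + a') :: l2) x = dders b (l1 ++ a :: l2) x + dders b (l1 ++ a' :: l2) x.
Proof.
elim: l1 x => [|c l1 IH] x Sl1 Sl2 Mx Sa Sa'; first exact: dders_add0.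
move/S2_dirs_cons: Sl1 => [Sc Sl1] /=; apply: is_dd_dder.
have SA : S2_dirs (l1 ++ a :: l2) by apply/S2_dirs_cat; split => //; apply/S2_dirs_cons.
have SA' : S2_dirs (l1 ++ a' :: l2) by apply/S2_dirs_cat; split => //; apply/S2_dirs_cons.
have H : is_dd (fun y => dders b (l1 ++ a :: l2) y + dders b (l1 ++ a' :: l2) y) x c
    (dders b (c :: l1 ++ a :: l2) x + dders b (c :: l1 ++ a' :: l2) x).
  have SS l : S2_dirs l -> forall y, Met y -> Sm (dders b l y).
    by move=> Sl y My; apply: S2_Sm; exact: dders_S2.
  apply: (is_dd_add cM) => //; try exact: SS; try exact: dders_is_dd.
  - by apply: SS => //; apply/S2_dirs_cons.
  - by apply: SS => //; apply/S2_dirs_cons.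
by apply: (is_dd_eq cM) H => // y My; rewrite IH.
Qed.

Lemma dders_scale l1 l2 x (k : R) a : S2_dirs l1 -> S2_dirs l2 -> Met x -> S2 a ->
  dders b (l1 ++ (k *: a) :: l2) x = k *: dders b (l1 ++ a :: l2) x.
Proof.
elim: l1 x => [|c l1 IH] x Sl1 Sl2 Mx Sa; first exact: dders_scale0.
move/S2_dirs_cons: Sl1 => [Sc Sl1] /=; apply: is_dd_dder.
have SA : S2_dirs (l1 ++ a :: l2) by apply/S2_dirs_cat; split => //; apply/S2_dirs_cons.
have SS l : S2_dirs l -> forall y, Met y -> Sm (dders b l y).
  by move=> Sl y My; apply: S2_Sm; exact: dders_S2.
have H := @is_dd_scale _ _ _ cM x c Mx Sc (fun=> k) (dders b (l1 ++ a :: l2)) 0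
  (dders b (c :: l1 ++ a :: l2) x) (SS _ SA).
have K0 : is_dd (fun=> k : R^o) x c 0 by exact: is_dd_cst.
have S1 : Sm (dders b (c :: l1 ++ a :: l2) x) by apply: SS => //; apply/S2_dirs_cons.
have {}H := H S1 K0 (dders_is_dd SA Mx Sc).
rewrite scale0r add0r in H; apply: (is_dd_eq cM) H => // y My.
by rewrite IH.
Qed.
End SmoothField.

End Multilinear.

(** * The chain rule for higher directional derivatives *)

Section Chain.
Variables (R : realType) (n : nat) (M : manifold R n) (cM : compact [set: M]).
Local Notation two_form := (two_form M).
Local Notation S2 := (@S2 R n M).
Local Notation Met := (@Met R n M).
Local Notation Sm := (@Sm R n M).
Implicit Types (a g h : two_form).

Lemma Sm_0 : Sm 0.
Proof. by apply: S2_Sm; exact: S2_0. Qed.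

Lemma cvg_form_sum (I : Type) (F : set_system I) (FF : Filter F) (J : Type) (r : seq J)
    (X : J -> I -> two_form) (x : J -> two_form) :
  (forall j, \forall i \near F, Sm (X j i)) -> (forall j, Sm (x j)) ->
  (forall j, X j @ F --> x j) ->
  \sum_(j <- r) X j i @[i --> F] --> \sum_(j <- r) x j.
Proof.
move=> sX sx Xx.
suff [] : (\sum_(j <- r) X j i @[i --> F] --> \sum_(j <- r) x j) /\
   (\forall i \near F, Sm (\sum_(j <- r) X j i)) /\ Sm (\sum_(j <- r) x j) by [].
elim: r => [|j r [IH1 [IH2 IH3]]].
  rewrite big_nil; under eq_fun do rewrite big_nil; split; first exact: cvg_cst.
  by split; [near=> i; rewrite big_nil; exact: Sm_0|exact: Sm_0].
rewrite big_cons; under eq_fun do rewrite big_cons; split; first exact: cvg_formD.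
split; last exact: Sm_add.
by apply: filterS (filterI (sX j) IH2) => i [? ?]; rewrite big_cons; exact: Sm_add.
Unshelve. all: by end_near. Qed.

Lemma S2_sum (J : Type) (r : seq J) (x : J -> two_form) :
  (forall j, S2 (x j)) -> S2 (\sum_(j <- r) x j).
Proof. by move=> H; elim/big_ind: _ => //; [exact: S2_0|exact: S2_add]. Qed.

Definition set_dir m (d : 'I_m -> two_form) (j : 'I_m) (v : two_form) :=
  fun i => if i == j then v else d i.

Lemma set_dir_split m (d : 'I_m -> two_form) (j : 'I_m) : (forall i, S2 (d i)) ->
  exists l1, exists l2, [/\ S2_dirs l1, S2_dirs l2 &
    forall v, [seq set_dir d j v i | i : 'I_m] = l1 ++ v :: l2].
Proof.
move=> Sd; have := mem_enum 'I_m j; rewrite inE => /splitPr E.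
have := enum_uniq 'I_m; move: E; rewrite /image_mem.
move: (enum 'I_m) => e E; case: E => p1 p2; rewrite cat_uniq /= negb_or.
move=> /and3P[_ /andP[j1 _] /andP[j2 _]].
exists (map d p1), (map d p2); split.
- by move=> a /mapP[i _ ->].
- by move=> a /mapP[i _ ->].
- move=> v; rewrite map_cat /=.
  have -> : set_dir d j v j = v by rewrite /set_dir eqxx.
  congr (_ ++ _ :: _).
  + apply/eq_in_map => i ip; rewrite /set_dir; case: eqP => // ij.
    by rewrite -ij ip in j1.
  + apply/eq_in_map => i ip; rewrite /set_dir; case: eqP => // ij.
    by rewrite -ij ip in j2.
Qed.

Section Field.
Variables (b : two_form -> two_form) (sb : smooth_map S2 b).

(** Directions are indexed rather than listed, so that a single one can be
    replaced. *)
Definition mder m (d : 'I_m -> two_form) x := dders b [seq d i | i : 'I_m] x.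

Lemma mder_S2 m (d : 'I_m -> two_form) x : (forall i, S2 (d i)) -> Met x -> S2 (mder d x).
Proof. by move=> Sd Mx; apply: (dders_S2 sb) => // a /mapP[i _ ->]. Qed.

Lemma mder_sub m (d : 'I_m -> two_form) j u v x : (forall i, S2 (d i)) ->
  S2 u -> S2 v -> Met x ->
  mder (set_dir d j u) x - mder (set_dir d j v) x = mder (set_dir d j (u - v)) x.
Proof.
move=> Sd Su Sv Mx; have [l1 [l2 [S1 S2' E]]] := set_dir_split j Sd.
rewrite /mder !E; apply/eqP; rewrite subr_eq -(dders_add cM sb)//; last exact: S2_sub.
by rewrite subrK.
Qed.

Lemma mder_scale m (d : 'I_m -> two_form) j (k : R) v x : (forall i, S2 (d i)) ->
  S2 v -> Met x -> k *: mder (set_dir d j v) x = mder (set_dir d j (k *: v)) x.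
Proof.
move=> Sd Sv Mx; have [l1 [l2 [S1 S2' E]]] := set_dir_split j Sd.
by rewrite /mder !E (dders_scale cM sb).
Qed.

Lemma mder_ext m (d d' : 'I_m -> two_form) x : (forall i, d i = d' i) ->
  mder d x = mder d' x.
Proof. by move=> dd'; rewrite (_ : d = d')//; apply/funext. Qed.

(** The directions are changed one at a time, from the first to the last. *)
Lemma mder_telescope m (Y0 Yt : 'I_m -> two_form) x :
  (forall i, S2 (Y0 i)) -> (forall i, S2 (Yt i)) -> Met x ->
  mder Yt x - mder Y0 x = \sum_(j < m)
    mder (set_dir (fun i => if (i < j)%N then Yt i else Y0 i) j (Yt j - Y0 j)) x.
Proof.
move=> S0 St Mx.
pose Z (j : nat) := fun i : 'I_m => if (i < j)%N then Yt i else Y0 i.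
have SZ j i : S2 (Z j i) by rewrite /Z; case: ifP.
transitivity (\sum_(0 <= j < m) (mder (Z j.+1) x - mder (Z j) x)).
  rewrite telescope_sumr//; congr (_ - _); apply: mder_ext => i.
  by rewrite /Z ltn_ord.
rewrite big_mkord; apply: eq_bigr => j _; rewrite -mder_sub//; last exact: SZ.
congr (_ - _); apply: mder_ext => i; rewrite /set_dir /Z.
  rewrite ltnS leq_eqVlt; case: (eqVneq i j) => [->|ij]; first by rewrite eqxx.
  by rewrite (negbTE (ij : (i != j :> nat))).
by case: (eqVneq i j) => [->|ij]; rewrite ?ltnn.
Qed.

(** A derivative of [b] in directions that depend on the base point: moving the
    base point adds the direction [h], and moving the directions gives, by
    multilinearity, one difference quotient at a time. *)
Lemma is_dd_mder m (Y : 'I_m -> two_form -> two_form) (Y' : 'I_m -> two_form) g h :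
  Met g -> S2 h -> (forall i x, Met x -> S2 (Y i x)) -> (forall i, S2 (Y' i)) ->
  (forall i, is_dd (Y i) g h (Y' i)) ->
  is_dd (fun x => mder (Y ^~ x) x) g h
    (dders b (h :: [seq Y i g | i : 'I_m]) g + \sum_(j < m) mder (set_dir (Y ^~ g) j (Y' j)) g).
Proof.
move=> Mg Sh SY SY' dY.
have ML := Met_line' cM Mg Sh.
have SmY i x : Met x -> Sm (Y i x) by move=> Mx; apply: S2_Sm; exact: SY.
have cY i : Y i (g + t *: h) @[t --> (0 : R)^'] --> Y i g.
  by apply: (is_dd_cvg cM Mg Sh (SmY i) _ (dY i)); exact: S2_Sm.
have Sl : S2_dirs [seq Y i g | i : 'I_m] by move=> a /mapP[i _ ->]; exact: SY.
have SQ i : \forall t \near (0 : R)^', S2 (dquot (Y i) g h t).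
  by apply: filterS ML => t Mt; apply: S2_scale; apply: S2_sub; exact: SY.
have H : dquot (dders b [seq Y i g | i : 'I_m]) g h t + \sum_(j < m)
    mder (set_dir (fun i => if (i < j)%N then Y i (g + t *: h) else Y i g) j
      (dquot (Y j) g h t)) (g + t *: h) @[t --> (0 : R)^'] -->
    dders b (h :: [seq Y i g | i : 'I_m]) g + \sum_(j < m) mder (set_dir (Y ^~ g) j (Y' j)) g.
  have SZ (j : 'I_m) : \forall t \near (0 : R)^', forall i,
      S2 (set_dir (fun i => if (i < j)%N then Y i (g + t *: h) else Y i g) j (dquot (Y j) g h t) i).
    apply: filterS (filterI ML (SQ j)) => t [Mt Qt] i; rewrite /set_dir.
    by case: eqP => // _; case: ifP => _; exact: SY.
  have SM (j : 'I_m) : \forall t \near (0 : R)^', Sm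
    (mder (set_dir (fun i => if (i < j)%N then Y i (g + t *: h) else Y i g) j
      (dquot (Y j) g h t)) (g + t *: h)).
    by apply: filterS (filterI ML (SZ j)) => t [Mt Zt]; apply: S2_Sm; exact: mder_S2.
  have Sg j : S2 (mder (set_dir (Y ^~ g) j (Y' j)) g).
    by apply: mder_S2 => // i; rewrite /set_dir; case: eqP => // _; exact: SY.
  apply: cvg_formD.
  - apply: (dquot_Sm cM Mg Sh) => x Mx; apply: S2_Sm; exact: (dders_S2 sb).
  - have SM' : \forall t \near (0 : R)^', forall j : 'I_m, Sm
      (mder (set_dir (fun i => if (i < j)%N then Y i (g + t *: h) else Y i g) j
        (dquot (Y j) g h t)) (g + t *: h)) by exact: filter_forall.
    apply: filterS SM' => t St; elim/big_ind: _ => //; [exact: Sm_0|exact: Sm_add].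
  - by apply: S2_Sm; apply: (dders_S2 sb) => //; apply/S2_dirs_cons.
  - by apply: S2_Sm; exact: S2_sum.
  - exact: (dders_is_dd sb).
  - apply: cvg_form_sum => // [j|j]; first exact: S2_Sm.
    apply: (dders_cvg _ (Y := fun i t => set_dir (fun i => if (i < j)%N then Y i (g + t *: h) else Y i g) j
      (dquot (Y j) g h t) i) sb) => //.
    + exact: (cvg_line' Mg Sh).
    + move=> i; rewrite /set_dir; case: eqP => _; first exact: dY.
      by case: (i < j)%N; [exact: cY|exact: cvg_cst].
    + by move=> i; apply: filterS (SZ j) => t; apply.
    + by move=> i; rewrite /set_dir; case: eqP => // _; exact: SY.
apply: cvg_trans H; apply: near_eq_cvg.
have SQ' : \forall t \near (0 : R)^', forall i, S2 (dquot (Y i) g h t) by exact: filter_forall.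
apply: filterS (filterI (filterI ML SQ') (nbhs_dnbhs_neq (0 : R))) => t [[Mt Qt] t0].
have E : mder (fun i => Y i (g + t *: h)) (g + t *: h) - mder (fun i => Y i g) (g + t *: h) =
  t *: \sum_(j < m) mder (set_dir (fun i => if (i < j)%N then Y i (g + t *: h) else Y i g) j
      (dquot (Y j) g h t)) (g + t *: h).
  rewrite mder_telescope; [|by move=> i; exact: SY|by move=> i; exact: SY|by []].
  rewrite scaler_sumr; apply: eq_bigr => j _; rewrite mder_scale//.
    by rewrite /dquot scalerA mulfV// scale1r.
  by move=> i; case: ifP => _; exact: SY.
rewrite /dquot -[dders b _ (g + t *: h)]/(mder (fun i => Y i g) (g + t *: h)).
rewrite -[dders b _ g]/(mder (fun i => Y i g) g).
apply: (scalerI t0); rewrite scalerDr -E !scalerA mulfV// !scale1r.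
by rewrite addrC addrA subrK.
Qed.
End Field.
End Chain.

(** * Finite order of differentiability, with the directions as parameters *)

Section Ck.
Variables (R : realType) (n : nat) (M : manifold R n) (cM : compact [set: M]).
Local Notation two_form := (two_form M).
Local Notation S2 := (@S2 R n M).
Local Notation Met := (@Met R n M).
Local Notation Sm := (@Sm R n M).
Implicit Types (a g h : two_form).

Section Dirs.
Variable k : nat.
Local Notation jet_base := (two_form * prod_topology (fun _ : 'I_k => two_form))%type.

Implicit Type p : jet_base.

Definition jet_dom : set jet_base := [set p | Met p.1 /\ forall i, S2 (p.2 i)].

(** Maps of a base point and [k] directions that can be differentiated [N] times in
    the base point along these directions, with jointly continuous results. Since
    the directions are arguments, derivatives are maps of the same kind, and rules
    of calculus become inductions on [N]. *)
Fixpoint Ck (W : preTopologicalLmodType R) (S : set W) (N : nat)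
    (X : jet_base -> W) : Prop :=
  ((forall p, jet_dom p -> S (X p)) /\
   forall p, jet_dom p -> X @ within jet_dom (nbhs p) --> X p) /\
  if N is N'.+1 then forall j, exists2 X', Ck S N' X' &
    forall p, jet_dom p -> is_dd (fun g => X (g, p.2)) p.1 (p.2 j) (X' p)
  else True.

Lemma Ck_base (W : preTopologicalLmodType R) (S : set W) N X : Ck S N X ->
  (forall p, jet_dom p -> S (X p)) /\ forall p, jet_dom p -> X @ within jet_dom (nbhs p) --> X p.
Proof. by case: N => [|N] []. Qed.

Lemma Ck_intro (W : preTopologicalLmodType R) (S : set W) N (X : jet_base -> W) :
  (forall p, jet_dom p -> S (X p)) -> (forall p, jet_dom p -> X @ within jet_dom (nbhs p) --> X p) ->
  (forall N', N = N'.+1 -> forall j, exists2 X', Ck S N' X' &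
    forall p, jet_dom p -> is_dd (fun g => X (g, p.2)) p.1 (p.2 j) (X' p)) ->
  Ck S N X.
Proof. by case: N => [|N] SX cX dX; split => //; exact: dX. Qed.

Lemma Ck_le (W : preTopologicalLmodType R) (S : set W) N X : Ck S N.+1 X -> Ck S N X.
Proof.
elim: N X => [|N IH] X [B H]; first by split.
by split => // j; have [X' /IH CX' dX'] := H j; exists X'.
Qed.

Lemma jet_dom_line p x : jet_dom p -> Met x -> jet_dom (x, p.2).
Proof. by move=> [_ ?] Mx; split. Qed.

Lemma within_jet_dom p : \forall q \near within jet_dom (nbhs p), jet_dom q.
Proof. exact: withinT. Qed.

Lemma cvg_jet1 p : q.1 @[q --> within jet_dom (nbhs p)] --> p.1.
Proof. by apply: cvg_within_filter; exact: cvg_fst. Qed.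

Lemma cvg_jet2 p j : q.2 j @[q --> within jet_dom (nbhs p)] --> p.2 j.
Proof.
have H : q.2 @[q --> within jet_dom (nbhs p)] --> p.2.
  by apply: cvg_within_filter; exact: cvg_snd.
by have /cvg_prodP/(_ j) := H.
Qed.

Lemma near_jet_dom (P : set jet_base) p : (forall q, jet_dom q -> P q) ->
  \forall q \near within jet_dom (nbhs p), P q.
Proof. by move=> H; apply: filterS (within_jet_dom p). Qed.

Lemma Ck_const (W : preTopologicalLmodType R) (S : set W) N (w : W) :
  S 0 -> S w -> Ck S N (fun=> w).
Proof.
move=> S0; elim: N w => [|N IH] w Sw; apply: Ck_intro => //.
- by move=> p _; exact: cvg_cst.
- by move=> p _; exact: cvg_cst.
- by move=> _ [<-] j; exists (fun=> 0) => [|p _]; [exact: IH|exact: is_dd_cst].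
Qed.

Lemma Ck_dir N j : Ck S2 N (fun p => p.2 j).
Proof.
apply: Ck_intro; first by move=> p [_]; apply.
  by move=> p _; exact: cvg_jet2.
move=> N' _ j'; exists (fun=> 0); first by apply: Ck_const; exact: S2_0.
by move=> p _; exact: is_dd_cst.
Qed.

Lemma Ck_sub (W : preTopologicalLmodType R) (S S' : set W) N X : S `<=` S' ->
  Ck S N X -> Ck S' N X.
Proof.
move=> SS'; elim: N X => [|N IH] X [[H1 H2] H3]; split => //.
- by split => // p /H1/SS'.
- by split => // p /H1/SS'.
- by move=> j; have [X' /IH CX' dX'] := H3 j; exists X'.
Qed.

(** Difference quotients of maps into [S2] are symmetric, and so are their limits. *)
Lemma Ck_S2 N X : Ck Sm N X -> (forall p, jet_dom p -> S2 (X p)) -> Ck S2 N X.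
Proof.
elim: N X => [|N IH] X [[H1 H2] H3] SX; split => // j.
have [X' CX' dX'] := H3 j; exists X' => //; apply: IH => // p Dp.
apply: (S2_cvg _ _ _ (dX' p Dp)).
- have [Mp Sp] := Dp.
  apply: filterS (Met_line' cM Mp (Sp j)) => t Mt.
  by apply: S2_scale; apply: S2_sub; apply: SX => //; exact: jet_dom_line.
- by have [S' _] := Ck_base CX'; exact: S'.
Qed.

Lemma Ck_Sm_line N X p x : Ck Sm N X -> jet_dom p -> Met x -> Sm (X (x, p.2)).
Proof. by move=> /Ck_base[H _] Dp Mx; apply: H; exact: jet_dom_line. Qed.

Lemma Ck_add N X Y : Ck Sm N X -> Ck Sm N Y -> Ck Sm N (fun p => X p + Y p).
Proof.
elim: N X Y => [|N IH] X Y CX CY; have [sX cX] := Ck_base CX; have [sY cY] := Ck_base CY.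
all: apply: Ck_intro => //; first by move=> p Dp; apply: Sm_add; [exact: sX|exact: sY].
1,2: by move=> p Dp; apply: cvg_formD; [by apply: near_jet_dom|by apply: near_jet_dom|exact: sX|exact: sY|exact: cX|exact: cY].
move=> _ [<-] j; have [_ /(_ j)[X' CX' dX]] := CX; have [_ /(_ j)[Y' CY' dY]] := CY.
exists (fun p => X' p + Y' p); first exact: IH.
move=> p Dp; have [Mp Sp] := Dp.
apply: (is_dd_add cM Mp (Sp j)) (dX p Dp) (dY p Dp).
- by move=> x Mx; exact: Ck_Sm_line CX Dp Mx.
- by move=> x Mx; exact: Ck_Sm_line CY Dp Mx.
- by have [S' _] := Ck_base CX'; exact: S'.
- by have [S' _] := Ck_base CY'; exact: S'.
Qed.

Lemma Ck_scale N (f : jet_base -> R^o) X : Ck setT N f -> Ck Sm N X ->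
  Ck Sm N (fun p => f p *: X p).
Proof.
elim: N f X => [|N IH] f X Cf CX; have [_ cf] := Ck_base Cf; have [sX cX] := Ck_base CX.
all: apply: Ck_intro => //; first by move=> p Dp; apply: Sm_scale; exact: sX.
1,2: by move=> p Dp; apply: cvg_formZ; [by apply: near_jet_dom|exact: sX|exact: cf|exact: cX].
move=> _ [<-] j; have [_ /(_ j)[X' CX' dX]] := CX; have [_ /(_ j)[f' Cf' df]] := Cf.
exists (fun p => f' p *: X p + f p *: X' p).
  by apply: Ck_add; apply: IH => //; exact: Ck_le.
move=> p Dp; have [Mp Sp] := Dp.
have := @is_dd_scale _ _ _ cM p.1 (p.2 j) Mp (Sp j) (fun g => f (g, p.2)) (fun g => X (g, p.2))
  (f' p) (X' p) _ _ (df p Dp) (dX p Dp).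
case: p {dX df Mp Sp} Dp => p1 p2 /= Dp; apply.
- by move=> x Mx; exact: Ck_Sm_line CX Dp Mx.
- by have [S' _] := Ck_base CX'; exact: S'.
Qed.

Lemma Ck_scalec N (c : R) X : Ck Sm N X -> Ck Sm N (fun p => c *: X p).
Proof. by move=> CX; apply: Ck_scale => //; exact: Ck_const. Qed.

Lemma Ck_opp N X : Ck Sm N X -> Ck Sm N (fun p => - X p).
Proof.
move=> /(Ck_scalec (-1)) H; rewrite (_ : (fun p => - X p) = (fun p => (-1) *: X p))//.
by apply/funext => p; rewrite scaleN1r.
Qed.

Lemma Ck_gmul N X Y : Ck Sm N X -> Ck Sm N Y -> Ck Sm N (fun p => gmul (X p) p.1 (Y p)).
Proof.
elim: N X Y => [|N IH] X Y CX CY; have [sX cX] := Ck_base CX; have [sY cY] := Ck_base CY.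
all: apply: Ck_intro => //;
  first by move=> p Dp; apply: Sm_gmul; [exact: sX|exact: (proj1 Dp)|exact: sY].
1,2: by move=> p Dp; apply: cvg_gmul; [by apply: near_jet_dom|by apply: near_jet_dom => q []|by apply: near_jet_dom
  |exact: sX|exact: (proj1 Dp)|exact: sY|exact: cX|exact: cvg_jet1|exact: cY].
move=> _ [<-] j; have [_ /(_ j)[X' CX' dX]] := CX; have [_ /(_ j)[Y' CY' dY]] := CY.
exists (fun p => gmul (X' p) p.1 (Y p) - gmul (gmul (X p) p.1 (p.2 j)) p.1 (Y p)
    + gmul (X p) p.1 (Y' p)).
  have CX1 := Ck_le CX; have CY1 := Ck_le CY.
  apply: Ck_add; last exact: IH.
  apply: Ck_add; first exact: IH.
  apply: Ck_opp; apply: (IH) => //; apply: (IH) => //.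
  by apply: Ck_sub (Ck_dir N j) => a; exact: S2_Sm.
move=> p Dp; have [Mp Sp] := Dp.
have := @is_dd_gmul _ _ _ cM p.1 (p.2 j) Mp (Sp j) (fun g => X (g, p.2)) (fun g => Y (g, p.2))
  (X' p) (Y' p) _ _ _ _ (dX p Dp) (dY p Dp).
case: p {dX dY Mp Sp} Dp => p1 p2 /= Dp; apply.
- by move=> x Mx; exact: Ck_Sm_line CX Dp Mx.
- by move=> x Mx; exact: Ck_Sm_line CY Dp Mx.
- by have [S' _] := Ck_base CX'; exact: S'.
- by have [S' _] := Ck_base CY'; exact: S'.
Qed.

Lemma Ck_sum N (J : Type) (r : seq J) (X : J -> jet_base -> two_form) :
  (forall j, Ck Sm N (X j)) -> Ck Sm N (fun p => \sum_(j <- r) X j p).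
Proof.
move=> CX; elim: r => [|j r IH].
  rewrite (_ : (fun p => _) = (fun=> 0)); last by apply/funext => p; rewrite big_nil.
  by apply: Ck_const; exact: Sm_0.
rewrite (_ : (fun p => _) = (fun p => X j p + \sum_(j <- r) X j p)).
  exact: Ck_add.
by apply/funext => p; rewrite big_cons.
Qed.

Lemma enum_unlift m (T : Type) (x : T) (f : 'I_m -> T) :
  [seq oapp f x (unlift ord0 i) | i : 'I_m.+1] = x :: [seq f i | i : 'I_m].
Proof.
rewrite /image_mem enum_ordSl /= unlift_none /= -map_comp; congr (_ :: _).
by apply: eq_map => i /=; rewrite liftK.
Qed.

(** By [is_dd_mder] the derivative is a sum of terms of the same form, with one
    more direction or with one direction differentiated. *)
Lemma Ck_mder b : smooth_field b -> forall N m (Y : 'I_m -> jet_base -> two_form),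
  (forall i, Ck S2 N (Y i)) ->
  Ck S2 N (fun p => mder b (Y ^~ p) p.1).
Proof.
move=> sb; elim=> [|N IH] m Y CY.
all: have SY i p : jet_dom p -> S2 (Y i p) by have [H _] := Ck_base (CY i); exact: H.
all: have cY i p : jet_dom p -> Y i @ within jet_dom (nbhs p) --> Y i p
  by have [_ H] := Ck_base (CY i); exact: H.
all: have SD p : jet_dom p -> S2 (mder b (Y ^~ p) p.1)
  by move=> Dp; apply: (mder_S2 sb) => [i|]; [exact: SY|exact: (proj1 Dp)].
all: apply: Ck_intro => //.
1,2: by move=> p Dp; apply: (dders_cvg _ sb);
  [exact: cvg_jet1|by move=> i; exact: cY|by apply: near_jet_dom => q []|
   by move=> i; apply: near_jet_dom => q Dq; exact: SY|exact: (proj1 Dp)|by move=> i; exact: SY].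
move=> _ [<-] j.
have /choice[Y' HY'] : forall i, exists Y'i, Ck S2 N Y'i /\
    forall p, jet_dom p -> is_dd (fun g => Y i (g, p.2)) p.1 (p.2 j) (Y'i p).
  by move=> i; have [_ /(_ j)[Y'i H1 H2]] := CY i; exists Y'i.
pose Y2 (i : 'I_m.+1) := oapp Y (fun p : jet_base => p.2 j) (unlift ord0 i).
exists (fun p => mder b (Y2 ^~ p) p.1 +
   \sum_(l < m) mder b (set_dir (Y ^~ p) l (Y' l p)) p.1).
  apply: Ck_S2; last first.
    move=> p Dp; apply: S2_add.
      apply: (mder_S2 sb); last exact: (proj1 Dp).
      rewrite /Y2 => i; case: unlift => [i'|] /=; first exact: SY.
      exact: (proj2 Dp).
    apply: S2_sum => l; apply: (mder_S2 sb); last exact: (proj1 Dp).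
    move=> i; rewrite /set_dir; case: eqP => _; last exact: SY.
    by have [CY'l _] := HY' l; have [+ _] := Ck_base CY'l; apply.
  have sub : S2 `<=` Sm by move=> a; exact: S2_Sm.
  apply: Ck_add.
    apply: (Ck_sub sub); apply: IH => i; rewrite /Y2.
    by case: unlift => [i'|] /=; [exact: Ck_le|exact: Ck_dir].
  apply: Ck_sum => l; apply: (Ck_sub sub).
  apply: (IH _ (fun i p => set_dir (Y ^~ p) l (Y' l p) i)) => i; rewrite /set_dir.
  by case: eqP => _; [have [] := HY' l|exact: Ck_le].
move=> p Dp; have [Mp Sp] := Dp.
have := @is_dd_mder _ _ _ cM _ sb m (fun i g => Y i (g, p.2)) (fun i => Y' i p) p.1 (p.2 j) Mp (Sp j).
rewrite /mder -enum_unlift.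
case: p Mp Sp Dp => p1 p2 /= Mp Sp Dp.
rewrite (_ : [seq oapp _ _ _ | i : 'I_m.+1] = [seq Y2 i (p1, p2) | i : 'I_m.+1]); last first.
  by apply: eq_map => i; rewrite /Y2; case: unlift.
apply.
- by move=> i x Mx; apply: SY; exact: (jet_dom_line Dp).
- by move=> i; have [CY'i _] := HY' i; have [+ _] := Ck_base CY'i; apply.
- by move=> i; have [_ +] := HY' i; move=> /(_ _ Dp).
Qed.

Lemma seq_tnth (T : Type) (d : 'I_k -> T) (s : seq 'I_k) :
  [seq d i | i <- s] = [seq d (tnth (in_tuple s) l) | l : 'I_(size s)].
Proof. by rewrite /image_mem [RHS](map_comp d (tnth (in_tuple s))) map_tnth_enum. Qed.

Lemma Ck_ders_dir (f : two_form -> R^o) : smooth_function f -> forall N (s : seq 'I_k),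
  Ck setT N (fun p => dders f [seq p.2 i | i <- s] p.1).
Proof.
move=> sf; elim=> [|N IH] s.
all: have c p : jet_dom p -> dders f [seq q.2 i | i <- s] q.1 @[q --> within jet_dom (nbhs p)] -->
    dders f [seq p.2 i | i <- s] p.1
  by move=> Dp; rewrite seq_tnth; under eq_fun do rewrite seq_tnth;
  apply: (dders_cvg _ (Y := fun l q => q.2 (tnth (in_tuple s) l)) sf);
  [exact: cvg_jet1|by move=> l; exact: cvg_jet2|by apply: near_jet_dom => q []|
   by move=> l; apply: near_jet_dom => q []|exact: (proj1 Dp)|by move=> l; exact: (proj2 Dp)].
all: apply: Ck_intro => //.
move=> _ [<-] j; exists (fun p => dders f [seq p.2 i | i <- j :: s] p.1); first exact: IH.
move=> p [Mp Sp] /=; have [H _] := sf.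
have Sl : forall a, a \in [seq p.2 i | i <- s] -> S2 a by move=> a /mapP[i _ ->].
have [_ /(_ (p.2 j) (Sp j))] := H _ p.1 Sl Mp.
exact: dderivable_is_dd.
Qed.

Lemma Ck_ders (f : two_form -> two_form) N s X : Ck S2 (N + size s) X ->
  (forall p, jet_dom p -> f p.1 = X p) ->
  exists2 X', Ck S2 N X' & forall p, jet_dom p -> dders f [seq p.2 i | i <- s] p.1 = X' p.
Proof.
elim: s N X => [|j s IH] N X; first by rewrite addn0 => CX fX; exists X.
rewrite /= addnS => CX fX; have [X1 [_ /(_ j)[X' CX' dX'] E1]] := IH N.+1 X CX fX.
exists X' => // p Dp; have [Mp Sp] := Dp; apply: is_dd_dder.
apply: (is_dd_eq cM Mp (Sp j) _ (dX' p Dp)) => x Mx.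
by rewrite -(E1 (x, p.2))//; exact: jet_dom_line.
Qed.

Lemma smooth_Ck N b : smooth_field b -> Ck S2 N (fun p => b p.1).
Proof.
move=> sb; have F0 : forall i : 'I_0, Ck S2 N (fun p : jet_base => 0 : two_form) by case.
have := Ck_mder sb F0; rewrite /mder /image_mem.
by rewrite (_ : enum 'I_0 = [::])//; apply: size0nil; rewrite size_enum_ord.
Qed.
End Dirs.

(** Iterated derivatives of [f] are read off from the maps p |-> f p.1, with the
    required directions as parameters. *)
Lemma Ck_smooth (f : two_form -> two_form) :
  (forall k N, Ck Sm N (fun p : two_form * prod_topology (fun _ : 'I_k => two_form) => f p.1)) ->
  (forall x, Met x -> S2 (f x)) -> smooth_field f.
Proof.
move=> Cf Sf; have {}Cf k N : Ck S2 N (fun p : two_form * prod_topology (fun _ : 'I_k => two_form) => f p.1).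
  by apply: Ck_S2 => // p [Mp _]; exact: Sf.
split=> [s g Ss Mg|k].
  have K a : S2 a -> S2 (dders f s g) /\ dderivable (dders f s) g a.
    (* index 0 is the new direction, the other indices enumerate [s] *)
    move=> Sa; pose d (i : 'I_(size s).+1) := nth 0 (a :: s) i.
    pose s' := [seq lift ord0 i | i : 'I_(size s)] : seq 'I_(size s).+1.
    have sE : [seq d i | i <- s'] = s.
      rewrite /s' /image_mem -map_comp -[RHS](seq_nth_ord 0 s) /image_mem.
      by apply: eq_map => i; rewrite /d /= /bump.
    have Dd x : Met x -> jet_dom (x, d : prod_topology (fun=> two_form)).
      move=> Mx; split=> // i; rewrite /d /=; have := ltn_ord i.
      case: (nat_of_ord i) => //= j; rewrite ltnS => js; apply: Ss; exact: mem_nth.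
    have [X' [[SX' _] /(_ ord0)[X2 _ dX2]] E] := Ck_ders (s := s') (Cf _ (1 + size s')%N) (fun _ _ => erefl).
    have E' x : Met x -> dders f s x = X' (x, d).
      by move=> Mx; rewrite -(E (x, d)) ?sE//; exact: Dd.
    split; first by rewrite E'//; apply: SX'; exact: Dd.
    exists (X2 (g, d)); apply: (is_dd_eq cM Mg Sa _ (dX2 (g, d) (Dd g Mg))) => x Mx.
    by rewrite E'.
  split; first by have [] := K 0 (S2_0 _).
  by move=> a /K[].
have [X' [[_ cX'] _] E] := Ck_ders (s := enum 'I_k) (Cf k (0 + size (enum 'I_k))%N) (fun _ _ => erefl).
apply/subspace_continuousP => p Dp.
have := cX' p Dp; rewrite -(E p Dp); apply: cvg_trans; apply: near_eq_cvg.
by apply: filterS (within_jet_dom p) => q Dq; rewrite -(E q Dq).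
Qed.

End Ck.

(** * The connection and its curvature *)

(** Here ba, ab, ca and cb are the first derivatives d_a b, d_b a, d_a c and
    d_b c, the matrices cba and cab are the derivatives of c along ba and ab, and
    G is the second derivative of c along a and b, the same in both orders. *)
Lemma curvature_algebra (R : realType) n (Gi G a b c ba ab ca cb cba cab : 'M[R]_n) :
  let m x y := x *m (Gi *m y) in
  ((G + cba) - 2^-1 *: ((m ba c - m (m b a) c + m b ca) + (m ca b - m (m c a) b + m c ba)))
    - 2^-1 *: (m a (cb - 2^-1 *: (m b c + m c b)) + m (cb - 2^-1 *: (m b c + m c b)) a) -
  (((G + cab) - 2^-1 *: ((m ab c - m (m a b) c + m a cb) + (m cb a - m (m c b) a + m c ab)))
    - 2^-1 *: (m b (ca - 2^-1 *: (m a c + m c a)) + m (ca - 2^-1 *: (m a c + m c a)) b)) -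
  ((cba - cab) - 2^-1 *: (m (ba - ab) c + m c (ba - ab))) =
  - 4^-1 *: (m (m a b) c - m (m b a) c - (m (m c a) b - m (m c b) a)).
Proof.
move=> m.
have mBl x y z : m (x - y) z = m x z - m y z by rewrite /m mulmxBl.
have mBr x y z : m z (x - y) = m z x - m z y by rewrite /m !mulmxBr.
have mDl x y z : m (x + y) z = m x z + m y z by rewrite /m mulmxDl.
have mDr x y z : m z (x + y) = m z x + m z y by rewrite /m !mulmxDr.
have mZl (k : R) x z : m (k *: x) z = k *: m x z by rewrite /m -scalemxAl.
have mZr (k : R) x z : m z (k *: x) = k *: m z x by rewrite /m -!scalemxAr.
have mA x y z : m x (m y z) = m (m x y) z by rewrite /m !mulmxA.
rewrite !(mBl, mBr, mZl, mZr) !(mDl, mDr) !mA.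
move: m {mBl mBr mDl mDr mZl mZr mA} => m.
apply/matrixP => i j; rewrite !mxE.
lra.
Qed.

Section Connection.
Variables (R : realType) (n : nat) (M : manifold R n) (cM : compact [set: M]).
Local Notation two_form := (two_form M).
Local Notation S2 := (@S2 R n M).
Local Notation Met := (@Met R n M).
Local Notation Sm := (@Sm R n M).
Local Notation vfield := (vfield M).
Implicit Types (g h : two_form) (a b c : vfield).

Lemma field_S2 a g : smooth_field a -> Met g -> S2 (a g).
Proof. by move=> sa Mg; apply: (dders_S2 sa (l := [::])). Qed.

Lemma field_is_dd a g h : smooth_field a -> Met g -> S2 h -> is_dd a g h (dder a g h).
Proof. by move=> sa Mg Sh; apply: (dders_is_dd sa (l := [::])). Qed.

Lemma dder_S2 a g h : smooth_field a -> Met g -> S2 h -> S2 (dder a g h).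
Proof.
by move=> sa Mg Sh; apply: (dders_S2 sa (l := [:: h])) => //; apply/S2_dirs_cons; split.
Qed.

Lemma dder_add a g h h' : smooth_field a -> Met g -> S2 h -> S2 h' ->
  dder a g (h + h') = dder a g h + dder a g h'.
Proof. by move=> sa Mg Sh Sh'; apply: (dders_add0 cM sa (l := [::])). Qed.

Lemma dder_scale a g (k : R) h : smooth_field a -> Met g -> S2 h ->
  dder a g (k *: h) = k *: dder a g h.
Proof. by move=> sa Mg Sh; apply: (dders_scale0 cM sa (l := [::])). Qed.

Lemma dder_sub a g h h' : smooth_field a -> Met g -> S2 h -> S2 h' ->
  dder a g (h - h') = dder a g h - dder a g h'.
Proof.
move=> sa Mg Sh Sh'; rewrite dder_add//; last exact: S2_opp.
by rewrite -scaleN1r dder_scale// scaleN1r.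
Qed.

Lemma smooth_field_eq a b : smooth_field a -> (forall g, Met g -> a g = b g) ->
  smooth_field b.
Proof.
move=> sa ab; apply: (Ck_smooth cM) => [k N|x Mx]; last by rewrite -ab//; exact: field_S2.
have CA := Ck_sub (fun x => @S2_Sm _ _ M x) (smooth_Ck cM k N sa).
have E (p : two_form * prod_topology (fun _ : 'I_k => two_form)) : jet_dom p -> a p.1 = b p.1.
  by move=> [Mp _]; exact: ab.
case: N CA => [|N] [[H1 H2] H3].
all: split; first (split; first by move=> p Dp; rewrite -E//; exact: H1).
- move=> p Dp; have := H2 p Dp; rewrite E//; apply: cvg_trans; apply: near_eq_cvg.
  by apply: near_jet_dom => q Dq; rewrite E.
- by [].
- move=> p Dp; have := H2 p Dp; rewrite E//; apply: cvg_trans; apply: near_eq_cvg.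
  by apply: near_jet_dom => q Dq; rewrite E.
- move=> j; have [X' CX' dX'] := H3 j; exists X' => // p Dp; have [Mp Sp] := Dp.
  by apply: (is_dd_eq cM Mp (Sp j) _ (dX' p Dp)) => x Mx; exact: ab.
Qed.

Lemma smooth_field_cst (w : two_form) : S2 w -> smooth_field (cst w : vfield).
Proof.
move=> Sw; apply: (Ck_smooth cM) => // k N; apply: Ck_const; [exact: Sm_0|exact: S2_Sm].
Qed.

Lemma field_Ck a k N : smooth_field a -> Ck Sm N
  (fun p : two_form * prod_topology (fun _ : 'I_k => two_form) => a p.1).
Proof. by move=> sa; apply: Ck_sub (smooth_Ck cM k N sa) => x; exact: S2_Sm. Qed.

Lemma smooth_field_add a b : smooth_field a -> smooth_field b ->
  smooth_field (fun g => a g + b g).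
Proof.
move=> sa sb; apply: (Ck_smooth cM) => [k N|x Mx]; first by apply: (Ck_add cM); exact: field_Ck.
by apply: S2_add; exact: field_S2.
Qed.

Lemma function_Ck (f : two_form -> R^o) k N : smooth_function f -> Ck setT N
  (fun p : two_form * prod_topology (fun _ : 'I_k => two_form) => f p.1).
Proof. by move=> sf; exact: (Ck_ders_dir sf N [::]). Qed.

Lemma smooth_field_scale (f : two_form -> R^o) a : smooth_function f -> smooth_field a ->
  smooth_field (fun g => f g *: a g).
Proof.
move=> sf sa; apply: (Ck_smooth cM) => [k N|x Mx].
  by apply: (Ck_scale cM); [exact: function_Ck|exact: field_Ck].
by apply: S2_scale; exact: field_S2.
Qed.

Lemma map_ord1 (T : Type) (x : T) : [seq x | _ : 'I_1] = [:: x].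
Proof. by rewrite /image_mem enum_ordSl (size0nil (size_enum_ord 0)). Qed.

Lemma dder_Ck a b k N : smooth_field a -> smooth_field b -> Ck Sm N
  (fun p : two_form * prod_topology (fun _ : 'I_k => two_form) => dder b p.1 (a p.1)).
Proof.
move=> sa sb; have := Ck_mder cM sb (Y := fun (_ : 'I_1) p => a p.1)
  (fun=> smooth_Ck cM k N sa).
rewrite /mder (_ : (fun p => _) = (fun p => dder b p.1 (a p.1))).
  by apply: Ck_sub => x; exact: S2_Sm.
by apply/funext => p; rewrite map_ord1.
Qed.

Definition conn a b : vfield := fun g =>
  dder b g (a g) - 2^-1 *: (gmul (a g) g (b g) + gmul (b g) g (a g)).

Lemma conn_S2 a b g : smooth_field a -> smooth_field b -> Met g -> S2 (conn a b g).
Proof.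
move=> sa sb Mg; apply: S2_sub; first by apply: dder_S2 => //; exact: field_S2.
by apply: S2_scale; apply: S2_gmul_sym => //; exact: field_S2.
Qed.

Lemma smooth_conn a b : smooth_field a -> smooth_field b -> smooth_field (conn a b).
Proof.
move=> sa sb; apply: (Ck_smooth cM) => [k N|x Mx]; last exact: conn_S2.
apply: (Ck_add cM); first exact: dder_Ck.
apply: (Ck_opp cM); apply: (Ck_scalec cM); apply: (Ck_add cM).
  by apply: (Ck_gmul cM (X := fun p => a p.1) (Y := fun p => b p.1)); exact: field_Ck.
by apply: (Ck_gmul cM (X := fun p => b p.1) (Y := fun p => a p.1)); exact: field_Ck.
Qed.

Lemma smooth_bracket a b : smooth_field a -> smooth_field b -> smooth_field (bracket a b).
Proof.
move=> sa sb; apply: (Ck_smooth cM) => [k N|x Mx].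
  by apply: (Ck_add cM); [exact: dder_Ck|apply: (Ck_opp cM); exact: dder_Ck].
by apply: S2_sub; apply: dder_S2 => //; exact: field_S2.
Qed.

Section Mulg.
Implicit Types u v w : two_form.
Lemma gmulDl u v g w : gmul (u + v) g w = gmul u g w + gmul v g w.
Proof. by apply: two_formP => y; exact: mulmxDl. Qed.
Lemma gmulDr u v g w : gmul w g (u + v) = gmul w g u + gmul w g v.
Proof.
apply: two_formP => y.
change (w y *m (invmx (g y) *m (u y + v y)) = w y *m (invmx (g y) *m u y) + w y *m (invmx (g y) *m v y)).
by rewrite !mulmxDr.
Qed.
Lemma gmulZl (k : R) u g w : gmul (k *: u) g w = k *: gmul u g w.
Proof. by apply: two_formP => y; apply/esym; exact: scalemxAl. Qed.
Lemma gmulZr (k : R) u g w : gmul w g (k *: u) = k *: gmul w g u.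
Proof.
apply: two_formP => y.
change (w y *m (invmx (g y) *m (k *: u y)) = k *: (w y *m (invmx (g y) *m u y))).
by rewrite -!scalemxAr.
Qed.
Lemma gmulNl u g w : gmul (- u) g w = - gmul u g w.
Proof. by rewrite -scaleN1r gmulZl scaleN1r. Qed.
Lemma gmulNr u g w : gmul w g (- u) = - gmul w g u.
Proof. by rewrite -scaleN1r gmulZr scaleN1r. Qed.
Lemma gmulA u v g w : gmul u g (gmul v g w) = gmul (gmul u g v) g w.
Proof. by apply: two_formP => y; rewrite !gmulE !mulmxA. Qed.
End Mulg.

Lemma conn_addl a a' b g : smooth_field a -> smooth_field a' -> smooth_field b -> Met g ->
  conn (fun h => a h + a' h) b g = conn a b g + conn a' b g.
Proof.
move=> sa sa' sb Mg; rewrite /conn dder_add//; [|exact: field_S2|exact: field_S2].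
rewrite gmulDl gmulDr [in RHS]addrACA -opprD -scalerDr; congr (_ - _ *: _).
by rewrite addrACA.
Qed.

Lemma conn_scalel (f : two_form -> R^o) a b g : smooth_field a -> smooth_field b -> Met g ->
  conn (fun h => f h *: a h) b g = f g *: conn a b g.
Proof.
move=> sa sb Mg; rewrite /conn dder_scale//; last exact: field_S2.
by rewrite gmulZl gmulZr -scalerDr scalerBr !scalerA [f g * _]mulrC.
Qed.

Lemma conn_addr a b b' g : smooth_field a -> smooth_field b -> smooth_field b' -> Met g ->
  conn a (fun h => b h + b' h) g = conn a b g + conn a b' g.
Proof.
move=> sa sb sb' Mg; rewrite /conn.
have Sa := field_S2 sa Mg.
have -> : dder (fun h => b h + b' h) g (a g) = dder b g (a g) + dder b' g (a g).
  apply: is_dd_dder; apply: (is_dd_add cM Mg Sa) (field_is_dd sb Mg Sa) (field_is_dd sb' Mg Sa).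
  - by move=> x Mx; apply: S2_Sm; exact: field_S2.
  - by move=> x Mx; apply: S2_Sm; exact: field_S2.
  - by apply: S2_Sm; exact: dder_S2.
  - by apply: S2_Sm; exact: dder_S2.
rewrite gmulDl gmulDr [in RHS]addrACA -opprD -scalerDr; congr (_ - _ *: _).
by rewrite addrACA.
Qed.

Lemma function_is_dd (f : two_form -> R^o) g h : smooth_function f -> Met g -> S2 h ->
  is_dd f g h (dder f g h).
Proof.
move=> [H _] Mg Sh; have H0 (x : two_form) : x \in [::] -> S2 x by rewrite in_nil.
have [_ /(_ h Sh)] := H [::] g H0 Mg.
exact: dderivable_is_dd.
Qed.

Lemma conn_leibniz (f : two_form -> R^o) a b g :
  smooth_function f -> smooth_field a -> smooth_field b -> Met g ->
  conn a (fun h => f h *: b h) g = dder f g (a g) *: b g + f g *: conn a b g.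
Proof.
move=> sf sa sb Mg; rewrite /conn; have Sa := field_S2 sa Mg.
have -> : dder (fun h => f h *: b h) g (a g) = dder f g (a g) *: b g + f g *: dder b g (a g).
  apply: is_dd_dder; apply: (is_dd_scale cM Mg Sa) (function_is_dd sf Mg Sa) (field_is_dd sb Mg Sa).
  - by move=> x Mx; apply: S2_Sm; exact: field_S2.
  - by apply: S2_Sm; exact: dder_S2.
by rewrite gmulZl gmulZr -scalerDr scalerBr -addrA !scalerA [f g * _]mulrC.
Qed.

Lemma conn_torsion a b g : conn a b g - conn b a g = bracket a b g.
Proof. by rewrite /conn /bracket [X in 2^-1 *: X]addrC opprB addrA subrK. Qed.

Lemma conn_is_dd b c g h : smooth_field b -> smooth_field c -> Met g -> S2 h ->
  is_dd (conn b c) g h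
   ((dders c [:: h; b g] g + dder c g (dder b g h)) - 2^-1 *:
    ((gmul (dder b g h) g (c g) - gmul (gmul (b g) g h) g (c g) + gmul (b g) g (dder c g h)) +
     (gmul (dder c g h) g (b g) - gmul (gmul (c g) g h) g (b g) + gmul (c g) g (dder b g h)))).
Proof.
move=> sb sc Mg Sh.
have Sb := field_S2 sb Mg; have Sc := field_S2 sc Mg.
have Sbh := dder_S2 sb Mg Sh; have Sch := dder_S2 sc Mg Sh.
have H1 : is_dd (fun x => dder c x (b x)) g h (dders c [:: h; b g] g + dder c g (dder b g h)).
  have := @is_dd_mder _ _ _ cM c sc 1 (fun _ x => b x) (fun=> dder b g h) g h Mg Sh
    (fun _ x Mx => field_S2 sb Mx) (fun=> Sbh) (fun=> field_is_dd sb Mg Sh).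
  rewrite big_ord1 /mder map_ord1.
  rewrite (_ : [seq set_dir _ _ _ i | i : 'I_1] = [:: dder b g h]); last first.
    by rewrite -(map_ord1 (dder b g h)); apply: eq_map => i; rewrite /set_dir ord1.
  by apply: (is_dd_eq cM Mg Sh) => x Mx; rewrite map_ord1.
have SmF d : smooth_field d -> forall x, Met x -> Sm (d x).
  by move=> sd x Mx; apply: S2_Sm; exact: field_S2.
have H2 d e : smooth_field d -> smooth_field e -> is_dd (fun x => gmul (d x) x (e x)) g h
    (gmul (dder d g h) g (e g) - gmul (gmul (d g) g h) g (e g) + gmul (d g) g (dder e g h)).
  move=> sd se; apply: (is_dd_gmul cM Mg Sh (SmF _ sd) (SmF _ se)).
  - by apply: S2_Sm; exact: dder_S2.
  - by apply: S2_Sm; exact: dder_S2.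
  - exact: field_is_dd.
  - exact: field_is_dd.
have S3 d e : smooth_field d -> smooth_field e ->
    Sm (gmul (dder d g h) g (e g) - gmul (gmul (d g) g h) g (e g) + gmul (d g) g (dder e g h)).
  move=> sd se; have [? ?] := (SmF _ sd _ Mg, SmF _ se _ Mg).
  have [? ?] := (S2_Sm (dder_S2 sd Mg Sh), S2_Sm (dder_S2 se Mg Sh)).
  apply: Sm_add; [apply: Sm_sub|]; apply: Sm_gmul => //; apply: Sm_gmul => //; exact: S2_Sm.
have S4 d e : smooth_field d -> smooth_field e -> forall x, Met x -> Sm (gmul (d x) x (e x)).
  by move=> sd se x Mx; apply: Sm_gmul => //; exact: SmF.
have H3 := is_dd_add cM Mg Sh (S4 _ _ sb sc) (S4 _ _ sc sb) (S3 _ _ sb sc) (S3 _ _ sc sb)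
  (H2 _ _ sb sc) (H2 _ _ sc sb).
have S5 x : Met x -> Sm (gmul (b x) x (c x) + gmul (c x) x (b x)).
  by move=> Mx; apply: Sm_add; exact: S4.
have K0 : is_dd (fun=> - 2^-1 : R^o) g h 0 by exact: is_dd_cst.
have H4 := is_dd_scale cM Mg Sh S5 (Sm_add (S3 _ _ sb sc) (S3 _ _ sc sb)) K0 H3.
rewrite scale0r add0r in H4.
have S6 : Sm (dders c [:: h; b g] g + dder c g (dder b g h)).
  apply: Sm_add; apply: S2_Sm; last exact: dder_S2.
  by apply: (dders_S2 sc) => //; apply/S2_dirs_cons; split => //; apply/S2_dirs_cons.
have H5 := is_dd_add cM Mg Sh (fun x Mx => S2_Sm (dder_S2 sc Mx (field_S2 sb Mx)))
  (fun x Mx => Sm_scale (- 2^-1) (S5 x Mx)) S6 (Sm_scale (- 2^-1) (Sm_add (S3 _ _ sb sc) (S3 _ _ sc sb))) H1 H4.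
rewrite -[- (2^-1 *: _)]scaleNr; apply: (is_dd_eq cM Mg Sh) H5 => x Mx.
by rewrite scaleNr.
Qed.

Lemma curvature_algebra_form (g G a b c ba ab ca cb cba cab : two_form) :
  ((G + cba) - 2^-1 *: ((gmul ba g c - gmul (gmul b g a) g c + gmul b g ca) +
      (gmul ca g b - gmul (gmul c g a) g b + gmul c g ba)))
    - 2^-1 *: (gmul a g (cb - 2^-1 *: (gmul b g c + gmul c g b)) +
               gmul (cb - 2^-1 *: (gmul b g c + gmul c g b)) g a) -
  (((G + cab) - 2^-1 *: ((gmul ab g c - gmul (gmul a g b) g c + gmul a g cb) +
      (gmul cb g a - gmul (gmul c g b) g a + gmul c g ab)))
    - 2^-1 *: (gmul b g (ca - 2^-1 *: (gmul a g c + gmul c g a)) +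
               gmul (ca - 2^-1 *: (gmul a g c + gmul c g a)) g b)) -
  ((cba - cab) - 2^-1 *: (gmul (ba - ab) g c + gmul c g (ba - ab))) =
  - 4^-1 *: (gmul (gmul a g b) g c - gmul (gmul b g a) g c -
             (gmul (gmul c g a) g b - gmul (gmul c g b) g a)).
Proof. by apply: two_formP => y; exact: curvature_algebra. Qed.

(** The second derivatives of [c] cancel by [dders_sym]. *)
Lemma conn_curvature a b c g : smooth_field a -> smooth_field b -> smooth_field c -> Met g ->
  curvature conn a b c g =
    - 4^-1 *: fmul g (comm (comm (sharp g (a g)) (sharp g (b g))) (sharp g (c g))).
Proof.
move=> sa sb sc Mg; have Sa := field_S2 sa Mg; have Sb := field_S2 sb Mg; have Sc := field_S2 sc Mg.
have E1 := is_dd_dder (conn_is_dd sb sc Mg Sa).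
have E2 := is_dd_dder (conn_is_dd sa sc Mg Sb).
have -> : curvature conn a b c g =
    dder (conn b c) g (a g) - 2^-1 *: (gmul (a g) g (conn b c g) + gmul (conn b c g) g (a g)) -
    (dder (conn a c) g (b g) - 2^-1 *: (gmul (b g) g (conn a c g) + gmul (conn a c g) g (b g))) -
    (dder c g (bracket a b g) - 2^-1 *: (gmul (bracket a b g) g (c g) + gmul (c g) g (bracket a b g))).
  by [].
rewrite E1 E2 {E1 E2} (dders_sym cM sc Mg Sb Sa) /conn /bracket dder_sub//;
  [|exact: dder_S2|exact: dder_S2].
have gA (u : two_form) (E : endo M) : fmul g (fun x => sharp g u x *m E x) = fmul u E.
  apply: two_formP => y; rewrite /fmul /sharp mulmxA (mulKVmx (Met_unit y Mg))//.
have -> : fmul g (comm (comm (sharp g (a g)) (sharp g (b g))) (sharp g (c g))) =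
    gmul (gmul (a g) g (b g)) g (c g) - gmul (gmul (b g) g (a g)) g (c g) -
    (gmul (gmul (c g) g (a g)) g (b g) - gmul (gmul (c g) g (b g)) g (a g)).
  apply: two_formP => y.
  change (g y *m ((sharp g (a g) y *m sharp g (b g) y - sharp g (b g) y *m sharp g (a g) y)
      *m sharp g (c g) y - sharp g (c g) y *m
      (sharp g (a g) y *m sharp g (b g) y - sharp g (b g) y *m sharp g (a g) y)) =
    gmul (gmul (a g) g (b g)) g (c g) y - gmul (gmul (b g) g (a g)) g (c g) y -
    (gmul (gmul (c g) g (a g)) g (b g) y - gmul (gmul (c g) g (b g)) g (a g) y)).
  rewrite !gmulE /sharp !(mulmxBl, mulmxBr) !mulmxA !(mulmxV (Met_unit y Mg)) !mul1mx.
  by [].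
exact: curvature_algebra_form.
Qed.
End Connection.

(** * Iterated integrals of continuous functions supported in a box *)

Section Integral.
Variables (R : realType) (B : R).
Hypothesis B0 : 0 < B.
Local Notation mu := (@lebesgue_measure R).

Definition bump1 (F : R -> R) := continuous F /\ forall x, F x != 0 -> `|x| <= B.

Let D : set R := `[- B, B]%classic.

Lemma bump1_restrict F : bump1 F -> F = F \_ D.
Proof.
move=> [_ sF]; apply/funext => x; rewrite patchE; case: ifPn => //.
apply: contraNeq => /sF; rewrite ler_norml => xB.
by rewrite inE /D /= in_itv.
Qed.

Lemma bump1_integral F : bump1 F -> \int[mu]_(x in [set: R]) F x = \int[mu]_(x in D) F x.
Proof. by move=> bF; rewrite [RHS]Rintegral_mkcond -bump1_restrict. Qed.

Lemma bump1_integrableD F : bump1 F -> mu.-integrable D (EFin \o F).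
Proof.
move=> [cF _]; apply: continuous_compact_integrable; first exact: segment_compact.
exact: continuous_subspaceT.
Qed.

Lemma bump1_integrable F : bump1 F -> mu.-integrable [set: R] (EFin \o F).
Proof.
move=> bF; have := bump1_integrableD bF => /integrable_mkcond => /(_ (measurable_itv _)).
by rewrite restrict_EFin -bump1_restrict.
Qed.

Lemma bump1_bound F (e : R) : bump1 F -> (forall x, `|F x| <= e) ->
  `|\int[mu]_(x in [set: R]) F x| <= e * (2 * B).
Proof.
move=> bF Fe; rewrite bump1_integral//.
have iD := bump1_integrableD bF.
have mD : @measurable _ (measurableTypeR R) D by exact: measurable_itv.
apply: (le_trans (le_normr_Rintegral mD iD)).
have -> : e * (2 * B) = \int[mu]_(x in D) e.
  rewrite Rintegral_cst//; congr (_ * _); rewrite /D.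
  by have /= -> := lebesgue_measure_itv `[- B, B]; rewrite lte_fin gtrN//= opprK -mulr2n mulr_natl.
apply: le_Rintegral => //.
- exact: (integrable_norm iD).
- by apply: continuous_compact_integrable; [exact: segment_compact|exact: continuous_subspaceT (@cst_continuous _ _ _)].
Qed.

Lemma bump1_eq0 F : bump1 F -> (forall x, 0 <= F x) ->
  \int[mu]_(x in [set: R]) F x = 0 -> forall x, F x = 0.
Proof.
move=> bF F0 IF x0; apply/eqP; apply/negPn/negP => Fx0.
have Fp : 0 < F x0 by rewrite lt_neqAle eq_sym Fx0 F0.
have F2 : 0 < F x0 / 2 by rewrite divr_gt0.
have [cF _] := bF.
have /cvgrPdist_lt/(_ _ F2) := cF x0; move=> /nbhs_ballP[d /= d0 dF].
pose J : set R := `[x0 - d / 2, x0 + d / 2]%classic.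
have mJ : @measurable _ (measurableTypeR R) J by exact: measurable_itv.
have cJ : continuous (fun _ : R => F x0 / 2) by exact: cst_continuous.
have iJ : mu.-integrable J (EFin \o fun _ : R => F x0 / 2).
  by apply: continuous_compact_integrable; [exact: segment_compact|exact: continuous_subspaceT].
have : \int[mu]_(x in J) (F x0 / 2) <= \int[mu]_(x in [set: R]) F x.
  rewrite Rintegral_mkcond; apply: le_Rintegral => //.
  - by move/(integrable_mkcond _ mJ): iJ; rewrite restrict_EFin.
  - exact: bump1_integrable.
  - move=> x _; rewrite patchE; case: ifPn => // /[!inE] xJ.
    have : ball x0 d x.
      move: xJ; rewrite /J /= in_itv /= => /andP[x1 x2].
      rewrite -ball_normE /= ltr_norml.
      have d2 : d / 2 < d by rewrite ltr_pdivrMr// ltr_pMr// ltr1n.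
      apply/andP; split; [rewrite ltrNl opprB ltrBlDr|rewrite ltrBlDr -ltrBlDl].
        by rewrite (le_lt_trans x2)// addrC ltrD2r.
      by rewrite (lt_le_trans _ x1)// ltrD2l ltrN2.
    move=> /dF /=; rewrite ltr_norml => /andP[_].
    by rewrite ltrBlDr -ltrBlDl {1}[F x0]splitr addrK => /ltW.
rewrite IF Rintegral_cst// /J.
have /= -> := lebesgue_measure_itv `[x0 - d / 2, x0 + d / 2]; rewrite lte_fin ltrD2l.
have d20 : 0 < d / 2 by rewrite divr_gt0.
rewrite gtrN//=; have -> : x0 + d / 2 - (x0 - d / 2) = d by lra.
by apply/negP; rewrite -ltNge mulr_gt0.
Qed.

(** A box of fixed size, instead of an unspecified compact support, bounds every
    partial integral. *)
Definition bump m (f : 'rV[R]_m -> R) :=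
  continuous f /\ forall v, f v != 0 -> forall i, `|v 0 i| <= B.

Definition slice m (f : 'rV[R]_m.+1 -> R) (x : R) : 'rV[R]_m -> R :=
  fun v => f (row_mx (x%:M : 'rV[R]_1) v : 'rV[R]_m.+1).

Lemma row_mx_continuous m : continuous (fun p : R * 'rV[R]_m => row_mx (p.1%:M : 'rV[R]_1) p.2).
Proof.
move=> p; apply/cvg_mxP => i j; rewrite mxE; under eq_fun do rewrite mxE.
case: (fintype.split j) => k.
  rewrite mxE; under eq_fun do rewrite mxE.
  by rewrite !ord1 /= mulr1n; under eq_fun do rewrite mulr1n; exact: cvg_fst.
rewrite [i]ord1.
apply: (cvg_comp snd (fun M : 'rV[R]_m => M 0 k)); first exact: cvg_snd.
exact: coord_continuous.
Qed.

Lemma slice2_continuous m (f : 'rV[R]_m.+1 -> R) : continuous f ->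
  continuous (fun p : R * 'rV[R]_m => slice f p.1 p.2).
Proof.
move=> cf p; apply: (cvg_comp (fun p : R * 'rV[R]_m => row_mx (p.1%:M : 'rV[R]_1) p.2) f).
  exact: row_mx_continuous.
exact: cf.
Qed.

Lemma slice_bump m (f : 'rV[R]_m.+1 -> R) x : bump f -> bump (slice f x).
Proof.
move=> [cf sf]; split=> [v|v fv i].
  apply: (cvg_comp (fun v => (x, v)) (fun p : R * 'rV[R]_m => slice f p.1 p.2)
    (G := nbhs (x, v))).
    have c1 : (fun _ : 'rV[R]_m => x) @ nbhs v --> x by exact: cvg_cst.
    exact: (cvg_pair c1 (@cvg_id _ (nbhs v))).
  exact: (@slice2_continuous m f cf (x, v)).
have := sf _ fv (rshift 1 i).
by rewrite (row_mxEr (x%:M : 'rV[R]_1)).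
Qed.

Lemma slice_support m (f : 'rV[R]_m.+1 -> R) x v : bump f -> slice f x v != 0 -> `|x| <= B.
Proof.
move=> [_ sf] fv; have := sf _ fv (@lshift 1 m ord0).
by rewrite (row_mxEl (x%:M : 'rV[R]_1)) mxE /= mulr1n.
Qed.

Lemma bump_add m (f h : 'rV[R]_m -> R) : bump f -> bump h -> bump (fun v => f v + h v).
Proof.
move=> [cf sf] [ch sh]; split=> [v|v]; first exact: (cvgD (cf v) (ch v)).
have [->|/sf//] := eqVneq (f v) 0.
by rewrite add0r; exact: sh.
Qed.

Lemma bump_scale m (k : R) (f : 'rV[R]_m -> R) : bump f -> bump (fun v => k * f v).
Proof.
move=> [cf sf]; split=> [v|v]; first exact: (cvgM (@cvg_cst R k _ (nbhs v) _) (cf v)).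
by rewrite mulf_eq0 negb_or => /andP[_ /sf].
Qed.

Lemma compact_box m : compact [set v : 'rV[R]_m | forall i, `|v 0 i| <= B].
Proof.
have := @rV_compact R m (fun=> `[- B, B]%classic) (fun=> segment_compact (a := - B) (b := B)).
congr compact; apply/seteqP; split=> v /= H i; have := H i; rewrite in_itv /= ler_norml//.
Qed.

(** Uniform continuity, from compactness of the box. *)
Lemma slice_uniform m (f : 'rV[R]_m.+1 -> R) (x0 e : R) : bump f -> 0 < e ->
  \forall x \near x0, forall v, `|slice f x0 v - slice f x v| <= e.
Proof.
move=> bf e0; have [cf sf] := bf.
have /compact_near_coveringP/(_ _ (nbhs x0)
  (fun x v => `|slice f x0 v - slice f x v| < e)) := @compact_box m.
move=> K; have {K}K : \forall x \near x0, [set v : 'rV[R]_m | forall i, `|v 0 i| <= B] `<=`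
    (fun v => `|slice f x0 v - slice f x v| < e).
  apply: K => v _.
  have e2 : 0 < e / 2 by rewrite divr_gt0.
  have c : slice f p.1 p.2 @[p --> (x0, v)] --> slice f x0 v := @slice2_continuous m f cf (x0, v).
  have /cvgrPdist_lt/(_ _ e2)[[P Q] /= [Px Qv] PQ] := c.
  exists (Q, P) => //= -[w x] /= [Qw Px'].
  have H1 := PQ (x, w) (conj Px' Qw).
  have H2 := PQ (x0, w) (conj (nbhs_singleton Px) Qw).
  rewrite /= in H1 H2.
  rewrite -(subrKA (slice f x0 v)) (le_lt_trans (ler_normD _ _))// [e]splitr ltrD//.
  by rewrite distrC.
apply: filterS K => x K v.
have [Kv|Kv] := pselect (forall i, `|v 0 i| <= B); first by apply: ltW; exact: K.
have Z y : slice f y v = 0.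
  apply/eqP; apply/negPn/negP => fv; apply: Kv.
  by have [_ ] := slice_bump y bf; apply.
by rewrite !Z subrr normr0 ltW.
Qed.

Lemma rV_integral0 m : rV_integral (fun _ : 'rV[R]_m => 0) = 0.
Proof.
elim: m => //= m IH; under eq_Rintegral do rewrite IH.
by rewrite Rintegral_cst// mul0r.
Qed.

Lemma rV_integralS m (f : 'rV[R]_m.+1 -> R) :
  rV_integral f = \int[mu]_(x in [set: R]) rV_integral (slice f x).
Proof. by []. Qed.

(** The bound in dimension m makes the integral of a slice continuous in the
    first coordinate, hence integrable, and linearity and the bound in dimension
    m + 1 need this integrability; so all are proved together. *)
Lemma rV_integral_linear m :
  [/\ forall f h : 'rV[R]_m -> R, bump f -> bump h ->
        rV_integral (fun v => f v + h v) = rV_integral f + rV_integral h,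
      forall (k : R) (f : 'rV[R]_m -> R), bump f ->
        rV_integral (fun v => k * f v) = k * rV_integral f &
      forall (f : 'rV[R]_m -> R) (e : R), bump f -> (forall v, `|f v| <= e) ->
        `|rV_integral f| <= e * (2 * B) ^+ m] /\
  forall f : 'rV[R]_m.+1 -> R, bump f -> bump1 (fun x => rV_integral (slice f x)).
Proof.
have step k : [/\ forall f h : 'rV[R]_k -> R, bump f -> bump h ->
        rV_integral (fun v => f v + h v) = rV_integral f + rV_integral h,
      forall (c : R) (f : 'rV[R]_k -> R), bump f ->
        rV_integral (fun v => c * f v) = c * rV_integral f &
      forall (f : 'rV[R]_k -> R) (e : R), bump f -> (forall v, `|f v| <= e) ->
        `|rV_integral f| <= e * (2 * B) ^+ k] ->
  forall f : 'rV[R]_k.+1 -> R, bump f -> bump1 (fun x => rV_integral (slice f x)).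
  move=> [IHa IHs IHb] f bf; split; last first.
    move=> x; have [//|xB] := leP `|x| B.
    rewrite (_ : slice f x = (fun=> 0)) ?rV_integral0 ?eqxx//.
    apply/funext => v; apply/eqP; apply/negPn/negP => /(slice_support bf).
    by rewrite leNgt xB.
  move=> x0; apply/cvgrPdist_le => e e0.
  have d0 : 0 < e / (2 * B) ^+ k by rewrite divr_gt0// exprn_gt0// mulr_gt0.
  apply: filterS (slice_uniform x0 bf d0) => x H.
  have bs y : bump (slice f y) by exact: slice_bump.
  have E : rV_integral (slice f x0) - rV_integral (slice f x) =
      rV_integral (fun v => slice f x0 v + (-1) * slice f x v).
    by rewrite (IHa _ _ (bs x0) (bump_scale (-1) (bs x))) (IHs _ _ (bs x)) mulN1r.
  rewrite E; have := IHb _ (e / (2 * B) ^+ k) (bump_add (bs x0) (bump_scale (-1) (bs x))).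
  rewrite divfK; last by rewrite gt_eqF// exprn_gt0// mulr_gt0.
  by apply=> v; rewrite mulN1r.
suff H k : [/\ forall f h : 'rV[R]_k -> R, bump f -> bump h ->
        rV_integral (fun v => f v + h v) = rV_integral f + rV_integral h,
      forall (c : R) (f : 'rV[R]_k -> R), bump f ->
        rV_integral (fun v => c * f v) = c * rV_integral f &
      forall (f : 'rV[R]_k -> R) (e : R), bump f -> (forall v, `|f v| <= e) ->
        `|rV_integral f| <= e * (2 * B) ^+ k] by split; [exact: H|exact/step/H].
elim: k => [|k IH]; first by split=> //= f e _ fe; rewrite expr0 mulr1.
have {}step := step k IH; have [IHa IHs IHb] := IH; split.
- move=> f h bf bh; rewrite !rV_integralS.
  rewrite -RintegralD//; [|exact/bump1_integrable/step|exact/bump1_integrable/step].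
  apply: eq_Rintegral => x _; rewrite -IHa//; exact: slice_bump.
- move=> c f bf; rewrite !rV_integralS -RintegralZl//; last exact/bump1_integrable/step.
  apply: eq_Rintegral => x _; rewrite -IHs//; exact: slice_bump.
- move=> f e bf fe; rewrite rV_integralS exprSr mulrA.
  apply: bump1_bound; first exact: step.
  by move=> x; apply: IHb; [exact: slice_bump|move=> v; exact: fe].
Qed.

Lemma rV_integral_ge0 m (f : 'rV[R]_m -> R) : (forall v, 0 <= f v) -> 0 <= rV_integral f.
Proof.
elim: m f => [|m IH] f f0 /=; first exact: f0.
by apply: Rintegral_ge0 => x _; apply: IH => v; exact: f0.
Qed.

Lemma rV_integral_eq0 m (f : 'rV[R]_m -> R) : bump f -> (forall v, 0 <= f v) ->
  rV_integral f = 0 -> forall v, f v = 0.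
Proof.
elim: m f => [|m IH] f bf f0.
  by move=> /= H v; rewrite (_ : v = 0)//; apply/matrixP => i [].
rewrite rV_integralS => H v.
have H0 := bump1_eq0 ((rV_integral_linear m).2 f bf) (fun x => rV_integral_ge0 (fun v => f0 _)) H.
have vE : v = row_mx ((v 0 0)%:M : 'rV[R]_1) (rsubmx (v : 'rV[R]_(1 + m))).
  by rewrite -[LHS](@hsubmxK _ 1 1 m) [lsubmx _]mx11_scalar mxE lshift0.
by rewrite vE; apply: (IH _ (slice_bump (v 0 0) bf) (fun w => f0 _) (H0 _)).
Qed.

End Integral.

(** * The volume integral and the weak metric *)

Section Volume.
Variables (R : realType) (n : nat) (M : manifold R n) (cM : compact [set: M])
  (O : orientation M) (P : partition_of_unity O) (g0 : two_form M) (g0M : Met g0).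
Local Notation two_form := (two_form M).
Local Notation S2 := (@S2 R n M).
Local Notation Met := (@Met R n M).
Local Notation Sm := (@Sm R n M).

Definition chart_cont (f : M -> R) := forall c v, atlas M c -> cimg c v ->
  f (cinv c w) @[w --> v] --> f (cinv c v).

Definition weight (i : 'I_(pou_card P)) v : R :=
  pou_fun P i (cinv (pou_chart P i) v) * Num.sqrt (\det (local_form (pou_chart P i) g0 v)).

Definition integrand (i : 'I_(pou_card P)) (f : M -> R) : 'rV[R]_n -> R :=
  (fun v => weight i v * f (cinv (pou_chart P i) v)) \_ (cimg (pou_chart P i)).

Lemma vol_integralE f : vol_integral P g0 f = \sum_i rV_integral (integrand i f).
Proof.
apply: eq_bigr => i _; congr rV_integral; apply/funext => v.
by rewrite /integrand !patchE; case: ifP => // _; rewrite /weight mulrAC.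
Qed.

Section Piece.
Variable i : 'I_(pou_card P).
Let c := pou_chart P i.

Let Mc : atlas M c.
Proof. by apply: oatlas_atlas; exact: pou_oatlas. Qed.

Lemma cinv_cvg (c' : chart R n M) v : cimg c' v -> cinv c' w @[w --> v] --> cinv c' v.
Proof.
move=> cv; have := cinv_continuous (c := c').
rewrite continuous_open_subspace; last exact: open_cimg.
by apply; rewrite inE.
Qed.

Lemma det_local_cvg v : cimg c v ->
  \det (local_form c g0 w) @[w --> v] --> \det (local_form c g0 v).
Proof.
move=> cv.
have T0 : nbhs (0 : R) setT by exact: filterT.
have H := smN_det (nbhs_filter (0 : R)) T0 (open_cimg (c := c)) 0
  (smooth_smM (nbhs_filter (0 : R)) T0 (Met_Sm g0M) Mc).
have [_ /(_ v cv) d _] := smN_base H.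
exact: differentiable_continuous d.
Qed.

Lemma weight_cvg v : cimg c v -> weight i w @[w --> v] --> weight i v.
Proof.
move=> cv.
have p1 : pou_fun P i (cinv c w) @[w --> v] --> pou_fun P i (cinv c v).
  apply: (cvg_comp (cinv c) (pou_fun P i) (cinv_cvg cv)); exact: pou_continuous.
have p2 : Num.sqrt (\det (local_form c g0 w)) @[w --> v] --> Num.sqrt (\det (local_form c g0 v)).
  apply: (cvg_comp (fun w => \det (local_form c g0 w)) Num.sqrt (det_local_cvg cv)).
  exact: sqrt_continuous.
exact: (cvgM p1 p2).
Qed.

(** [M] is compact, hence so is the support of a partition function, and its image
    in the chart. *)
Lemma pou_compact : exists2 K : set 'rV[R]_n, compact K /\ K `<=` cimg c &
  forall v, cimg c v -> weight i v != 0 -> K v.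
Proof.
pose C := closure [set x | pou_fun P i x != 0].
have cC : compact C.
  by apply: subclosed_compact cM _ => //; exact: closed_closure.
exists (cmap c @` C).
  split; last by move=> _ [x Cx <-]; exists x => //; exact: (pou_support Cx).
  apply: continuous_compact => //; apply: continuous_subspaceW (cmap_continuous (c := c)).
  exact: pou_support.
move=> v cv; rewrite mulf_eq0 negb_or => /andP[p0 _].
have [_ vE] := cimg_cinv cv; exists (cinv c v) => //.
exact: subset_closure.
Qed.

Lemma weight_ge0 v : 0 <= weight i v.
Proof. by apply: mulr_ge0; [exact: pou_ge0|exact: sqrtr_ge0]. Qed.

Lemma integrandE f v : cimg c v -> integrand i f v = weight i v * f (cinv c v).
Proof. by move=> cv; rewrite /integrand patchE mem_set. Qed.

Lemma integrand_neq0 f v : integrand i f v != 0 -> cimg c v /\ weight i v != 0.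
Proof.
rewrite /integrand patchE; case: ifPn; last by rewrite eqxx.
by rewrite inE mulf_eq0 negb_or => cv /andP[].
Qed.

Lemma integrand_cvg f v : chart_cont f -> integrand i f w @[w --> v] --> integrand i f v.
Proof.
move=> cf; have [K [cK Kc] KP] := pou_compact.
have [cv|ncv] := pselect (cimg c v).
  rewrite integrandE//.
  have H : weight i w * f (cinv c w) @[w --> v] --> weight i v * f (cinv c v).
    exact: (cvgM (weight_cvg cv) (cf _ _ Mc cv)).
  apply: cvg_trans H; apply: (@near_eq_cvg _ _ (nbhs v) (nbhs_filter v)).
  have : nbhs v (cimg c) by exact: nbhs_cimg.
  by apply: filterS => w cw; rewrite integrandE.
have Z w : ~ K w -> integrand i f w = 0.
  move=> nK; apply/eqP; apply/negPn/negP => /integrand_neq0[cw /(KP w cw)]; exact: nK.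
have nKv : ~ K v by move=> /Kc.
rewrite Z//; apply: cvg_trans (@cvg_cst R 0 _ (nbhs v) _); apply: (@near_eq_cvg _ _ (nbhs v) (nbhs_filter v)).
have : nbhs v (~` K).
  apply: open_nbhs_nbhs; split => //; apply: closed_openC.
  exact: (compact_closed (@norm_hausdorff _ 'rV[R]_n) cK).
by apply: filterS => w /Z ->.
Qed.

Lemma integrand_bump : exists2 B, 0 < B & forall f, chart_cont f -> bump B (integrand i f).
Proof.
have [K [cK Kc] KP] := pou_compact.
have [B [_ KB]] := compact_bounded cK.
pose B' := `|B| + 1.
have B'0 : 0 < B' by rewrite ltr_pwDr.
exists B' => // f cf; split; last first.
  move=> v /integrand_neq0[cv /(KP v cv) Kv] j.
  apply: le_trans (KB B' _ v Kv); last by rewrite /B' (le_lt_trans (ler_norm B))// ltrDl.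
  rewrite [leRHS]/Num.Def.normr/= mx_normrE.
  exact: (le_bigmax _ (fun ij : 'I_1 * 'I_n => `|v ij.1 ij.2|) (0, j)).
move=> v; exact: integrand_cvg.
Qed.

Lemma integrand_add f h : integrand i (fun x => f x + h x) =
  (fun v => integrand i f v + integrand i h v).
Proof.
apply/funext => v; rewrite /integrand !patchE; case: ifP => _; last by rewrite addr0.
by rewrite mulrDr.
Qed.

Lemma integrand_scale k f : integrand i (fun x => k * f x) = (fun v => k * integrand i f v).
Proof.
apply/funext => v; rewrite /integrand !patchE; case: ifP => _; last by rewrite mulr0.
by rewrite mulrCA.
Qed.

Lemma integrand_cvg0 (I : Type) (F : set_system I) (FF : Filter F) (f : I -> M -> R) (e : R) :
  (forall v, cimg c v -> f p.1 (cinv c p.2) @[p --> filter_prod F (nbhs v)] --> (0 : R)) ->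
  0 < e -> \forall k \near F, forall v, `|integrand i (f k) v| <= e.
Proof.
move=> f0 e0; have [K [cK Kc] KP] := pou_compact.
have /compact_near_coveringP/(_ _ F (fun k v => `|integrand i (f k) v| < e) FF) H := cK.
have {H}H : \forall k \near F, K `<=` (fun v => `|integrand i (f k) v| < e).
  apply: H => v /Kc cv.
  have W : weight i p.2 @[p --> filter_prod F (nbhs v)] --> weight i v.
    by apply: (cvg_comp snd (weight i)); [exact: cvg_snd|exact: weight_cvg].
  have W0 : weight i p.2 * f p.1 (cinv c p.2) @[p --> filter_prod F (nbhs v)] --> (0 : R).
    by rewrite -(mulr0 (weight i v)); exact: (cvgM W (f0 v cv)).
  have /cvgrPdist_lt/(_ e e0)[[A V] /= [FA NV] AV] := W0.
  exists (V `&` cimg c, A) => /=.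
    by split => //; apply: filterI => //; exact: nbhs_cimg.
  by move=> [w k] /= [[Vw cw] Ak]; rewrite integrandE//; have := AV (k, w) (conj Ak Vw); rewrite /= sub0r normrN.
apply: filterS H => k H v.
have [Kv|Kv] := pselect (K v); first by apply: ltW; exact: H.
suff -> : integrand i (f k) v = 0 by rewrite normr0 ltW.
by apply/eqP; apply/negPn/negP => /integrand_neq0[cv /(KP v cv)]; exact: Kv.
Qed.

Lemma integrand_eq0 f : chart_cont f -> (forall x, 0 <= f x) ->
  rV_integral (integrand i f) = 0 -> forall x, pou_fun P i x != 0 -> f x = 0.
Proof.
move=> cf f0 H x px; have [B B0 bf] := integrand_bump.
have cx : cdom c x by apply: pou_support; apply: subset_closure.
have cv : cimg c (cmap c x) by exists x.
have := rV_integral_eq0 B0 (bf f cf) _ H (cmap c x); rewrite integrandE// cmapK//.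
have -> : weight i (cmap c x) * f x = 0 <-> f x = 0.
  split=> [/eqP|->]; last by rewrite mulr0.
  rewrite mulf_eq0 => /orP[|/eqP//]; rewrite mulf_eq0 cmapK// (negbTE px)/= sqrtr_eq0.
  rewrite leNgt posdef_det_gt0//; last by apply/posdef_local => //; exact: Met_posdef.
  by apply: local_form_tr; apply: S2_sym; exact: Met_S2.
apply => v; rewrite /integrand patchE; case: ifP => // _.
by apply: mulr_ge0 => //; exact: weight_ge0.
Qed.
End Piece.

Local Notation vol := (vol_integral P g0).

Lemma vol_add f h : chart_cont f -> chart_cont h -> vol (fun x => f x + h x) = vol f + vol h.
Proof.
move=> cf ch; rewrite !vol_integralE -big_split; apply: eq_bigr => i _.
have [B B0 bb] := integrand_bump i; have [[add _ _] _] := rV_integral_linear B0 n.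
by rewrite integrand_add add//; exact: bb.
Qed.

Lemma vol_scale k f : chart_cont f -> vol (fun x => k * f x) = k * vol f.
Proof.
move=> cf; rewrite !vol_integralE mulr_sumr; apply: eq_bigr => i _.
have [B B0 bb] := integrand_bump i; have [[_ sc _] _] := rV_integral_linear B0 n.
by rewrite integrand_scale sc//; exact: bb.
Qed.

Lemma chart_cont_add f h : chart_cont f -> chart_cont h -> chart_cont (fun x => f x + h x).
Proof. by move=> cf ch c v Mc cv; exact: (cvgD (cf _ _ Mc cv) (ch _ _ Mc cv)). Qed.

Lemma chart_cont_scale k f : chart_cont f -> chart_cont (fun x => k * f x).
Proof. by move=> cf c v Mc cv; exact: (cvgM (@cvg_cst R k _ (nbhs v) _) (cf _ _ Mc cv)). Qed.

Lemma vol_cvg0 (I : Type) (F : set_system I) (FF : Filter F) (f : I -> M -> R) :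
  (\forall k \near F, chart_cont (f k)) ->
  (forall c v, atlas M c -> cimg c v ->
     f p.1 (cinv c p.2) @[p --> filter_prod F (nbhs v)] --> (0 : R)) ->
  vol (f k) @[k --> F] --> (0 : R).
Proof.
move=> cf f0; under eq_fun do rewrite vol_integralE.
suff : \sum_i rV_integral (integrand i (f k)) @[k --> F] --> \sum_(i < pou_card P) (0 : R).
  by rewrite big1.
apply: cvg_big => [|i _]; first exact: add_continuous.
have [B B0 bb] := integrand_bump i; have [[_ _ bd] _] := rV_integral_linear B0 n.
have m0 : 0 < (2 * B) ^+ n by rewrite exprn_gt0// mulr_gt0.
apply/cvgr0Pnorm_le => e e0.
have e1 : 0 < e / (2 * B) ^+ n by rewrite divr_gt0.
have Mc : atlas M (pou_chart P i) by apply: oatlas_atlas; exact: pou_oatlas.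
apply: filterS (filterI cf (integrand_cvg0 FF (fun v cv => f0 _ v Mc cv) e1)) => k [ck H].
by have := bd _ _ (bb _ ck) H; rewrite divfK// gt_eqF.
Qed.

(** Limits pass under the integral because the weights are compactly supported, so
    that convergence with a moving point is uniform there. *)
Lemma vol_cvg (I : Type) (F : set_system I) (FF : Filter F) (f : I -> M -> R) fl :
  (\forall k \near F, chart_cont (f k)) -> chart_cont fl ->
  (forall c v, atlas M c -> cimg c v ->
     f p.1 (cinv c p.2) @[p --> filter_prod F (nbhs v)] --> fl (cinv c v)) ->
  vol (f k) @[k --> F] --> vol fl.
Proof.
move=> cf cl ffl.
have cl' : chart_cont (fun x => (-1) * fl x) by exact: chart_cont_scale.
have H : vol (fun x => f k x + (-1) * fl x) @[k --> F] --> (0 : R).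
  apply: vol_cvg0; first by apply: filterS cf => k ck; exact: chart_cont_add.
  move=> c v Mc cv.
  have H2 : (-1) * fl (cinv c p.2) @[p --> filter_prod F (nbhs v)] --> (-1) * fl (cinv c v).
    apply: (cvg_comp snd (fun w => (-1) * fl (cinv c w))); first exact: cvg_snd.
    exact: cl'.
  have H3 := cvgD (ffl c v Mc cv) H2; rewrite mulN1r addrN in H3; exact: H3.
have H4 : vol (fun x => f k x + (-1) * fl x) + vol fl @[k --> F] --> vol fl.
  have H5 := cvgD H (@cvg_cst R (vol fl) I F FF); rewrite add0r in H5; exact: H5.
apply: cvg_trans H4; apply: (@near_eq_cvg _ _ F FF); apply: filterS cf => k ck /=.
by rewrite vol_add// vol_scale// mulN1r subrK.
Qed.

(** At each point some partition function is positive, and so is the density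
    sqrt (det g0). *)
Lemma vol_eq0 f : chart_cont f -> (forall x, 0 <= f x) -> vol f = 0 -> forall x, f x = 0.
Proof.
move=> cf f0; rewrite vol_integralE => /eqP; rewrite psumr_eq0 => [/allP H x|i _]; last first.
  apply: rV_integral_ge0 => v; rewrite /integrand patchE; case: ifP => // _.
  by apply: mulr_ge0 => //; exact: weight_ge0.
have [i pi] : exists i, pou_fun P i x != 0.
  apply/existsP; rewrite -[X in is_true X]negbK negb_exists; apply/negP => /forallP N.
  have := pou_sum P x; rewrite big1; first by move/eqP; rewrite eq_sym oner_eq0.
  by move=> i _; have := N i; rewrite negbK => /eqP.
by apply: (integrand_eq0 cf f0 _ pi); apply/eqP; apply: H; exact: mem_index_enum.
Qed.

Definition gtr (g Y : two_form) : M -> R := fun x => \tr (sharp g Y x).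
(** The weak metric is the value at a g^-1 b of this functional, which is linear in
    [Y]. *)
Definition trint (g Y : two_form) : R := vol (gtr g Y).

Lemma gtr_local c g Y v : atlas M c -> cimg c v -> g (cinv c v) \in unitmx ->
  gtr g Y (cinv c v) = \tr (invmx (local_form c g v) *m local_form c Y v).
Proof.
move=> Mc cv ug; have u := frame_unit Mc cv; rewrite !local_formE /gtr /sharp.
move: (frame c v) (g _) (Y _) u ug => Q G Z u ug.
have uT : Q^T \in unitmx by rewrite unitmx_tr.
by rewrite invmx_congr// !mulmxA (mulmxKV u) [RHS]mxtrace_mulC !mulmxA (mulmxV uT) mul1mx.
Qed.

Lemma gtr_cvg (I : Type) (F : set_system I) (FF : Filter F) (G Y : I -> two_form) g y c v :
  atlas M c -> cimg c v ->
  (\forall k \near F, Met (G k)) -> Met g -> (\forall k \near F, Sm (Y k)) -> Sm y ->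
  G @ F --> g -> Y @ F --> y ->
  gtr (G p.1) (Y p.1) (cinv c p.2) @[p --> filter_prod F (nbhs v)] --> gtr g y (cinv c v).
Proof.
move=> Mc cv MG Mg SY Sy Gg Yy.
have FA : F [set k | Met (G k) /\ Sm (Y k)] by apply: filterI.
have oc := open_cimg (c := c).
have HG := cvg_smM1 FF FA (fun k h => Met_Sm h.1) (Met_Sm Mg) Gg Mc.
have HY := cvg_smM1 FF FA (fun k h => h.2) Sy Yy Mc.
have U1 k : Met (G k) /\ Sm (Y k) -> forall w, cimg c w -> local_form c (G k) w \in unitmx.
  by move=> [Mk _] w cw; apply: local_form_unit => //; exact: Met_unit.
have U2 w : cimg c w -> local_form c g w \in unitmx.
  by move=> cw; apply: local_form_unit => //; exact: Met_unit.
have HI := smM_inv FF FA oc U1 U2 HG.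
have HT := smN_trace FF FA oc 0 (smM_mul FF FA oc HI HY).
have [_ _ /(_ v cv)] := smN_base HT.
rewrite (gtr_local _ Mc cv (Met_unit _ Mg)); apply: cvg_trans; apply: near_eq_cvg.
apply: filterS (near_prodU FA oc cv) => -[k w] /= [[Mk _] cw].
by rewrite gtr_local//; exact: Met_unit.
Qed.

Lemma gtr_chart_cont g Y : Met g -> Sm Y -> chart_cont (gtr g Y).
Proof.
move=> Mg SY c v Mc cv.
have H := @gtr_cvg R (nbhs (0 : R)) (nbhs_filter (0 : R)) (fun=> g) (fun=> Y) g Y c v Mc cv.
have {}H : gtr g Y (cinv c p.2) @[p --> filter_prod (nbhs (0 : R)) (nbhs v)] --> gtr g Y (cinv c v).
  by apply: H => //; try exact: cvg_cst; exact: filterE.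
apply: (cvg_comp (fun w => ((0 : R), w)) (fun p : R * 'rV[R]_n => gtr g Y (cinv c p.2)) _ H).
have c1 : (fun _ : 'rV[R]_n => (0 : R)) @ nbhs v --> (0 : R) by exact: cvg_cst.
exact: (cvg_pair c1 (@cvg_id _ (nbhs v))).
Qed.

Lemma trint_cvg (I : Type) (F : set_system I) (FF : Filter F) (G Y : I -> two_form) g y :
  (\forall k \near F, Met (G k)) -> Met g -> (\forall k \near F, Sm (Y k)) -> Sm y ->
  G @ F --> g -> Y @ F --> y -> trint (G k) (Y k) @[k --> F] --> trint g y.
Proof.
move=> MG Mg SY Sy Gg Yy; apply: vol_cvg.
- by apply: filterS (filterI MG SY) => k [? ?]; exact: gtr_chart_cont.
- exact: gtr_chart_cont.
- by move=> c v Mc cv; exact: gtr_cvg.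
Qed.

Lemma gtrD g Y Z x : gtr g (Y + Z) x = gtr g Y x + gtr g Z x.
Proof.
by rewrite /gtr /sharp -mxtraceD -mulmxDr.
Qed.

Lemma gtrZ g (k : R) Y x : gtr g (k *: Y) x = k * gtr g Y x.
Proof. by rewrite /gtr /sharp -mxtraceZ scalemxAr. Qed.

Lemma trintD g Y Z : Met g -> Sm Y -> Sm Z -> trint g (Y + Z) = trint g Y + trint g Z.
Proof.
move=> Mg SY SZ; rewrite /trint -vol_add; [|exact: gtr_chart_cont|exact: gtr_chart_cont].
by congr vol_integral; apply/funext => x; rewrite gtrD.
Qed.

Local Notation ip := (weak_metric P g0).

Lemma ipE g a b : ip g a b = trint g (gmul a g b).
Proof.
by congr vol_integral; apply/funext => x; rewrite /gtr /sharp gmulE !mulmxA.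
Qed.

Lemma ipC g a b : ip g a b = ip g b a.
Proof. by congr vol_integral; apply/funext => x; rewrite mxtrace_mulC. Qed.

Lemma ipDl g a a' b : Met g -> Sm a -> Sm a' -> Sm b ->
  ip g (a + a') b = ip g a b + ip g a' b.
Proof.
by move=> Mg Sa Sa' Sb; rewrite !ipE gmulDl trintD//; exact: Sm_gmul.
Qed.

Lemma ip_eq0 g a : Met g -> S2 a -> ip g a a = 0 -> a = 0.
Proof.
move=> Mg Sa H; apply: two_formP => x.
have sg : (g x)^T = g x by apply: S2_sym; exact: Met_S2.
have T y : gtr g (gmul a g a) y = \tr (invmx (g y) *m a y *m (invmx (g y) *m a y)).
  by rewrite /gtr /sharp gmulE !mulmxA.
apply: (tr_sharp_eq0 sg (Met_posdef x Mg) (S2_sym x Sa)); rewrite -T.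
apply: (vol_eq0 (f := gtr g (gmul a g a))).
- by apply: gtr_chart_cont => //; apply: Sm_gmul => //; exact: S2_Sm.
- move=> y; rewrite T; apply: tr_sharp_ge0; [|exact: Met_posdef|exact: S2_sym].
  by apply: S2_sym; exact: Met_S2.
- by rewrite -[LHS]ipE.
Qed.
End Volume.

(** * Uniqueness and curvature of the Levi-Civita connection *)

Section LC.
Variables (R : realType) (n : nat) (M : manifold R n) (cM : compact [set: M])
  (O : orientation M) (P : partition_of_unity O) (g0 : two_form M) (g0M : Met g0).
Local Notation two_form := (two_form M).
Local Notation S2 := (@S2 R n M).
Local Notation Met := (@Met R n M).
Local Notation Sm := (@Sm R n M).
Local Notation ip := (weak_metric P g0).
Local Notation trint := (trint P g0).
Implicit Types a b c : vfield M.

Lemma trace_resolvent (G G' Z : 'M[R]_n) : G \in unitmx -> G' \in unitmx ->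
  \tr (invmx G' *m Z) - \tr (invmx G *m Z) =
  - \tr (invmx G' *m ((G' - G) *m (invmx G *m Z))).
Proof.
move=> uG uG'; rewrite mulmxA mulmxBr (mulVmx uG') mulmxBl mul1mx -(mulmxA _ G).
by rewrite (mulKVmx uG) linearB/= opprB.
Qed.

Lemma gtr_sub_metric (g a Y : two_form) (t : R) x : Met g -> Met (g + t *: a) ->
  gtr (g + t *: a) Y x - gtr g Y x = - (t * gtr (g + t *: a) (gmul a g Y) x).
Proof.
move=> Mg Mt; rewrite -gtrZ -gmulZl /gtr /sharp gmulE.
have -> : (t *: a) x = (g + t *: a) x - g x.
  by change (t *: a x = g x + t *: a x - g x); rewrite addrC addKr.
by apply: trace_resolvent; exact: Met_unit.
Qed.

(** The derivatives of the two inverses contribute - tr (ABC) - tr (ACB); by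
    cyclicity of the trace this is the contribution of the terms -(AB + BA)/2 and
    -(AC + CA)/2 of the connection. *)
Lemma conn_metric a b c g : smooth_field a -> smooth_field b -> smooth_field c -> Met g ->
  dquot (fun h => ip h (b h) (c h) : R^o) g (a g) @ (0 : R)^' -->
    (ip g (conn a b g) (c g) + ip g (b g) (conn a c g) : R^o).
Proof.
move=> sa sb sc Mg; have Sa := field_S2 sa Mg; have Sb := field_S2 sb Mg; have Sc := field_S2 sc Mg.
have SmF d : smooth_field d -> forall x, Met x -> Sm (d x).
  by move=> sd x Mx; apply: S2_Sm; exact: field_S2.
pose Y h := gmul (b h) h (c h).
have SY x : Met x -> Sm (Y x) by move=> Mx; apply: Sm_gmul => //; exact: SmF.
pose Y' := gmul (dder b g (a g)) g (c g) - gmul (gmul (b g) g (a g)) g (c g) + gmul (b g) g (dder c g (a g)).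
have Sba := S2_Sm (dder_S2 sb Mg Sa); have Sca := S2_Sm (dder_S2 sc Mg Sa).
have dY : is_dd Y g (a g) Y'.
  by apply: (is_dd_gmul cM Mg Sa (SmF _ sb) (SmF _ sc)) => //; exact: field_is_dd.
have sag := S2_Sm Sa; have sbg := S2_Sm Sb; have scg := S2_Sm Sc.
have SY' : Sm Y'.
  by apply: Sm_add; [apply: Sm_sub|]; apply: Sm_gmul => //; exact: Sm_gmul.
have SaY : Sm (gmul (a g) g (Y g)) by apply: Sm_gmul => //; exact: SY.
have ML := Met_line' cM Mg Sa.
have SQ := dquot_Sm cM Mg Sa SY.
have H : trint (g + t *: a g) (dquot Y g (a g) t - gmul (a g) g (Y g)) @[t --> (0 : R)^'] -->
    trint g (Y' - gmul (a g) g (Y g)).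
  apply: (trint_cvg cM g0M) => //.
  - by apply: filterS SQ => t ?; exact: Sm_sub.
  - exact: Sm_sub.
  - exact: cvg_line'.
  - by apply: cvg_formB => //; [exact: filterE|exact: cvg_cst].
have -> : ip g (conn a b g) (c g) + ip g (b g) (conn a c g) = trint g (Y' - gmul (a g) g (Y g)).
  rewrite !ipE -(trintD cM P g0M Mg); last 2 first.
  - by apply: Sm_gmul => //; apply: S2_Sm; exact: conn_S2.
  - by apply: Sm_gmul => //; apply: S2_Sm; exact: conn_S2.
  congr vol_integral; apply/funext => x.
  rewrite /Y' /Y /conn !(gmulDl, gmulDr, gmulNl, gmulNr, gmulZl, gmulZr, gmulA).
  have TN u : gtr g (- u) x = - gtr g u x by rewrite -scaleN1r gtrZ mulN1r.
  rewrite !(gtrD, TN, gtrZ).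
  have E : gtr g (gmul (gmul (b g) g (c g)) g (a g)) x = gtr g (gmul (gmul (a g) g (b g)) g (c g)) x.
    by rewrite /gtr /sharp !gmulE !mulmxA -(mulmxA _ (invmx (g x)) (a g x)) mxtrace_mulC !mulmxA.
  by rewrite E; lra.
apply: cvg_trans H; apply: near_eq_cvg.
apply: filterS (filterI (filterI ML SQ) (nbhs_dnbhs_neq (0 : R))) => t [[Mt Qt] t0].
rewrite /dquot !ipE -/(Y _) -/(Y g); set g' := g + t *: a g.
have SYt := SY _ Mt; have SYg := SY _ Mg.
have vB (f h : M -> R) : chart_cont f -> chart_cont h ->
    vol_integral P g0 f - vol_integral P g0 h = vol_integral P g0 (fun x => f x + (-1) * h x).
  move=> cf ch; rewrite (vol_add cM P g0M cf); last exact: chart_cont_scale.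
  by rewrite (vol_scale cM P g0M _ ch) mulN1r.
have c1 : chart_cont (gtr g' (Y g')) by exact: gtr_chart_cont.
have c2 : chart_cont (gtr g (Y g)) by exact: gtr_chart_cont.
have -> : t^-1 *: (trint g' (Y g') - trint g (Y g)) = t^-1 * (trint g' (Y g') - trint g (Y g)) :> R by [].
rewrite /trint vB// -(vol_scale cM P g0M); last by apply: chart_cont_add => //; exact: chart_cont_scale.
congr vol_integral; apply/funext => x.
have TN u : gtr g' (- u) x = - gtr g' u x by rewrite -scaleN1r gtrZ mulN1r.
rewrite gtrD TN gtrZ gtrD TN.
have K := gtr_sub_metric (Y g) x Mg Mt; rewrite -/g' in K.
move: (gtr g' (Y g') x) (gtr g' (Y g) x) (gtr g (Y g) x) (gtr g' (gmul (a g) g (Y g)) x) K => u v w z K.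
have -> : w = v + t * z by lra.
by field.
Qed.

Lemma formula_levi_civita (nabla : vfield M -> vfield M -> vfield M) :
  (forall a b, smooth_field a -> smooth_field b -> forall g, Met g ->
    nabla a b g = conn a b g) -> levi_civita ip nabla.
Proof.
move=> E; split.
- move=> a b sa sb; apply: (smooth_field_eq cM (smooth_conn cM sa sb)) => g Mg.
  by rewrite E.
- move=> a a' b g sa sa' sb Mg; rewrite !E//; [exact: conn_addl|exact: smooth_field_add].
- move=> f a b g sf sa sb Mg; rewrite !E//; [exact: conn_scalel|exact: smooth_field_scale].
- move=> a b b' g sa sb sb' Mg; rewrite !E//; [exact: conn_addr|exact: smooth_field_add].
- move=> f a b g sf sa sb Mg; rewrite !E//; [exact: conn_leibniz|exact: smooth_field_scale].
- by move=> a b g sa sb Mg; rewrite !E// conn_torsion.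
- by move=> a b c g sa sb sc Mg; rewrite !E//; exact: conn_metric.
Qed.

(** The difference D of the two connections satisfies D(x, y) = D(y, x) since
    both are torsion-free and (D(x, y), z) = - (D(x, z), y) since both are metric.
    Alternating these symmetries on three fields gives (D(a, b), w) = 0, and w may
    be the constant field with value D(a, b). No linear form has to be represented
    by a vector, which a weak metric would not allow. *)
Lemma levi_civita_formula (nabla : vfield M -> vfield M -> vfield M) :
  levi_civita ip nabla ->
  forall a b, smooth_field a -> smooth_field b -> forall g, Met g ->
    nabla a b g = conn a b g.
Proof.
move=> LC a b sa sb g Mg; apply/eqP; rewrite -subr_eq0; apply/eqP.
pose D x y := nabla x y g - conn x y g.
have SD x y : smooth_field x -> smooth_field y -> S2 (D x y).
  move=> sx sy; apply: S2_sub; last exact: conn_S2.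
  by apply: (field_S2 _ Mg); exact: (lc_smooth LC).
have Dsym x y : smooth_field x -> smooth_field y -> D x y = D y x.
  move=> sx sy; apply/eqP; rewrite -subr_eq0.
  have -> : D x y - D y x = (nabla x y g - nabla y x g) - (conn x y g - conn y x g).
    by rewrite /D !opprB [LHS]addrACA [RHS]addrACA; congr (_ + _); exact: addrC.
  by rewrite (lc_torsion LC)// conn_torsion subrr.
have Dmet x y z : smooth_field x -> smooth_field y -> smooth_field z ->
    ip g (D x y) (z g) = - ip g (D x z) (y g).
  move=> sx sy sz.
  have E := norm_cvg_unique (lc_metric LC sx sy sz Mg) (conn_metric sx sy sz Mg).
  have N u w : smooth_field u -> smooth_field w -> forall v, Sm v ->
      ip g (nabla u w g) v = ip g (D u w) v + ip g (conn u w g) v.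
    move=> su sw v Sv; rewrite -(ipDl cM P g0M Mg) ?subrK//; apply: S2_Sm; [exact: SD|exact: conn_S2].
  have Sv u : smooth_field u -> Sm (u g) by move=> su; apply: S2_Sm; exact: field_S2.
  move: E; rewrite (ipC _ _ _ (y g) (nabla x z g)) (ipC _ _ _ (y g) (conn x z g)).
  rewrite !N//; [|exact: Sv|exact: Sv].
  by move=> /(_ _) E; lra.
pose w : vfield M := cst (D a b).
have sw : smooth_field w by apply: (smooth_field_cst cM); exact: SD.
rewrite -/(D a b).
have W : ip g (D a b) (w g) = - ip g (D a b) (w g).
  rewrite {1}Dsym// Dmet// {1}(Dsym b w)// Dmet// opprK {1}(Dsym w a)// Dmet//.
have {}W : ip g (D a b) (D a b) = 0.
  by have := W; rewrite /w /cst /=; move: (ip g _ _) => r; lra.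
exact: (ip_eq0 cM g0M Mg (SD _ _ sa sb) W).
Qed.

(** The formula is applied to the field nabla_b c as well: its derivative at [g]
    only depends on its values on [Met]. *)
Lemma nabla_curvature (nabla : vfield M -> vfield M -> vfield M) : levi_civita ip nabla ->
  forall a b c, smooth_field a -> smooth_field b -> smooth_field c -> forall g, Met g ->
  curvature nabla a b c g =
    - 4^-1 *: fmul g (comm (comm (sharp g (a g)) (sharp g (b g))) (sharp g (c g))).
Proof.
move=> LC a b c sa sb sc g Mg; have E := levi_civita_formula LC.
rewrite -(conn_curvature cM sa sb sc Mg) /curvature.
have K x y : smooth_field x -> smooth_field y ->
    nabla x (nabla y c) g = conn x (conn y c) g.
  move=> sx sy; have sn := lc_smooth LC sy sc.
  have E1 := E _ _ sx sn g Mg; have E2 := E _ _ sy sc g Mg.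
  have E3 : dder (conn y c) g (x g) = dder (nabla y c) g (x g).
    apply: (dder_eq cM Mg (field_S2 sx Mg)) => [h Mh|]; first by rewrite E.
    by exists (dder (nabla y c) g (x g)); apply: field_is_dd => //; exact: field_S2.
  rewrite E1.
  change (dder (nabla y c) g (x g) - 2^-1 *: (gmul (x g) g (nabla y c g) + gmul (nabla y c g) g (x g)) =
    dder (conn y c) g (x g) - 2^-1 *: (gmul (x g) g (conn y c g) + gmul (conn y c g) g (x g))).
  by rewrite E2 E3.
by rewrite !K// (E _ _ (smooth_bracket cM sa sb) sc g Mg).
Qed.

(** For W = [A, B], cyclicity gives tr ([W, B] A) = tr (W [B, A]) = - tr (W^2). *)
Lemma nabla_sectional (nabla : vfield M -> vfield M -> vfield M) : levi_civita ip nabla ->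
  forall a b, smooth_field a -> smooth_field b -> forall g, Met g ->
  sectional_curvature ip nabla a b g =
    4^-1 * vol_integral P g0 (fun x => \tr (comm (sharp g (a g)) (sharp g (b g)) x ^+ 2)).
Proof.
move=> LC a b sa sb g Mg.
have Sa := S2_Sm (field_S2 sa Mg); have Sb := S2_Sm (field_S2 sb Mg).
rewrite /sectional_curvature (nabla_curvature LC sa sb sb Mg).
pose w := gmul (a g) g (b g) - gmul (b g) g (a g).
have sw : Sm w by apply: Sm_sub; exact: Sm_gmul.
have wE x : sharp g w x = comm (sharp g (a g)) (sharp g (b g)) x.
  rewrite /sharp /w /comm.
  change (invmx (g x) *m (gmul (a g) g (b g) x - gmul (b g) g (a g) x) =
    invmx (g x) *m a g x *m (invmx (g x) *m b g x) - invmx (g x) *m b g x *m (invmx (g x) *m a g x)).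
  by rewrite !gmulE mulmxBr !mulmxA.
have T x : \tr (comm (sharp g (a g)) (sharp g (b g)) x ^+ 2) = gtr g (gmul w g w) x.
  rewrite -wE expr2 /gtr /sharp gmulE.
  change (\tr ((invmx (g x) *m w x) *m (invmx (g x) *m w x)) =
    \tr (invmx (g x) *m (w x *m (invmx (g x) *m w x)))).
  by rewrite !mulmxA.
have cT : chart_cont (fun x => \tr (comm (sharp g (a g)) (sharp g (b g)) x ^+ 2)).
  have -> : (fun x => \tr (comm (sharp g (a g)) (sharp g (b g)) x ^+ 2)) = gtr g (gmul w g w).
    by apply/funext.
  by apply: gtr_chart_cont => //; exact: Sm_gmul.
rewrite -(vol_scale cM P g0M _ cT); congr vol_integral; apply/funext => x.
have -> : sharp g (- 4^-1 *: fmul g (comm (comm (sharp g (a g)) (sharp g (b g))) (sharp g (b g)))) x =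
   - 4^-1 *: comm (comm (sharp g (a g)) (sharp g (b g))) (sharp g (b g)) x.
  rewrite /sharp.
  change (invmx (g x) *m (- 4^-1 *: (g x *m comm (comm (sharp g (a g)) (sharp g (b g))) (sharp g (b g)) x)) =
    - 4^-1 *: comm (comm (sharp g (a g)) (sharp g (b g))) (sharp g (b g)) x).
  by rewrite -scalemxAr mulKmx//; exact: Met_unit.
rewrite -scalemxAl mxtraceZ /comm; move: (sharp g (a g) x) (sharp g (b g) x) => A B.
rewrite expr2; change (- 4^-1 * \tr (((A *m B - B *m A) *m B - B *m (A *m B - B *m A)) *m A) =
  4^-1 * \tr ((A *m B - B *m A) *m (A *m B - B *m A))).
have TB (X Y : 'M[R]_n) : \tr (X - Y) = \tr X - \tr Y by exact: linearB.
rewrite !(mulmxBl, mulmxBr) !TB !mulmxA.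
have E1 : \tr (B *m A *m B *m A) = \tr (A *m B *m A *m B) by rewrite mxtrace_mulC !mulmxA.
have E2 : \tr (B *m B *m A *m A) = \tr (A *m B *m B *m A) by rewrite mxtrace_mulC !mulmxA.
have E3 : \tr (B *m A *m A *m B) = \tr (A *m B *m B *m A).
  by rewrite -(mulmxA (B *m A) A B) mxtrace_mulC !mulmxA.
rewrite !(E1, E2, E3); lra.
Qed.
End LC.

(** * The matrix exponential *)

Section Exp.
Variable R : realType.

Lemma mx_entry_le p q (A : 'M[R]_(p, q)) i j : `|A i j| <= `|A|.
Proof.
rewrite [leRHS]/Num.Def.normr/= mx_normrE.
exact: (le_bigmax _ (fun ij : 'I_p * 'I_q => `|A ij.1 ij.2|) (i, j)).
Qed.

Lemma mx_norm_le p q (A : 'M[R]_(p, q)) (e : R) : 0 <= e ->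
  (forall i j, `|A i j| <= e) -> `|A| <= e.
Proof.
move=> e0 H; rewrite /Num.Def.normr/= mx_normrE (bigmax_le _ e0)// => -[i j] _ /=.
Qed.

Lemma mx_norm_mul p q r (A : 'M[R]_(p, q)) (B : 'M[R]_(q, r)) :
  `|A *m B| <= q%:R * `|A| * `|B|.
Proof.
apply: mx_norm_le => [|i j]; first by rewrite !mulr_ge0.
rewrite mxE (le_trans (ler_norm_sum _ _ _))//.
apply: (@le_trans _ _ (\sum_(k < q) `|A| * `|B|)).
  by apply: ler_sum => k _; rewrite normrM ler_pM// mx_entry_le.
by rewrite sumr_const card_ord -mulrA mulr_natl.
Qed.

Lemma mx_pow_norm p (A : 'M[R]_p) k : `|A ^+ k| <= (p%:R * `|A|) ^+ k.
Proof.
elim: k => [|k IH].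
  rewrite !expr0; apply: mx_norm_le => // i j.
  change (`|(1%:M : 'M[R]_p) i j| <= 1); rewrite mxE.
  by case: eqP => _; rewrite ?normr1 ?normr0.
rewrite !exprS; change (`|A *m A ^+ k| <= p%:R * `|A| * (p%:R * `|A|) ^+ k).
by rewrite (le_trans (mx_norm_mul _ _))// ler_wpM2l// mulr_ge0.
Qed.

Definition exp_term p (A : 'M[R]_p) (k : nat) : 'M[R]_p := (k`!%:R)^-1 *: A ^+ k.

Lemma exp_term_norm p (A : 'M[R]_p) k : `|exp_term A k| <= exp_coeff (p%:R * `|A|) k.
Proof.
rewrite /exp_term /exp_coeff /= normrZ mulrC ler_pM// ?mx_pow_norm//.
by rewrite ger0_norm ?invr_ge0.
Qed.

(** Each entry is dominated by the exponential series of p |A|. *)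
Lemma expmx_cvg p (A : 'M[R]_p) : series (exp_term A) @ \oo --> expmx A.
Proof.
suff : cvgn (series (exp_term A)) by [].
have E i j m : series (exp_term A) m i j = series (fun k => exp_term A k i j) m.
  by rewrite /series /= summxE.
have C i j : cvgn (series (fun k => exp_term A k i j)).
  apply: normed_cvg; apply: (@series_le_cvg R _ (exp_coeff (p%:R * `|A|))).
  - by move=> k; exact: normr_ge0.
  - by move=> k; apply: exp_coeff_ge0; rewrite mulr_ge0.
  - by move=> k; apply: le_trans (exp_term_norm A k); exact: mx_entry_le.
  - exact: is_cvg_series_exp_coeff.
apply/cvg_ex; exists (\matrix_(i, j) limn (series (fun k => exp_term A k i j))).
apply/cvg_mxP => i j; rewrite mxE; apply: cvg_trans (C i j).
by apply: near_eq_cvg; near=> m; rewrite E.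
Unshelve. all: by end_near. Qed.

Lemma expmx_norm p (A : 'M[R]_p) : `|expmx A| <= expR (p%:R * `|A|).
Proof.
have C : `|series (exp_term A) m| @[m --> \oo] --> `|expmx A| by apply: cvg_norm; exact: expmx_cvg.
rewrite -(cvg_lim _ C)//; apply: limr_le; first by apply/cvg_ex; eexists; exact: C.
near=> m; rewrite /series /=.
apply: (le_trans (ler_norm_sum _ _ _)).
apply: (@le_trans _ _ (series (exp_coeff (p%:R * `|A|)) m)).
  by apply: ler_sum => k _; exact: exp_term_norm.
apply: nondecreasing_cvgn_le; last exact: is_cvg_series_exp_coeff.
by apply: nondecreasing_series => k _ _; apply: exp_coeff_ge0; rewrite mulr_ge0.
Unshelve. all: by end_near. Qed.

(** The relation passes to powers and to the sum of the series. Applied to block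
    matrices, it replaces the manipulation of power series. *)
Lemma expmx_intertwine p q (Q : 'M[R]_(q, p)) (Y : 'M[R]_p) (Z : 'M[R]_q) :
  Q *m Y = Z *m Q -> Q *m expmx Y = expmx Z *m Q.
Proof.
move=> QY.
have QYk k : Q *m Y ^+ k = Z ^+ k *m Q.
  elim: k => [|k IH]; first by rewrite !expr0; change (Q *m 1%:M = 1%:M *m Q); rewrite mulmx1 mul1mx.
  rewrite exprSr exprS; change (Q *m (Y ^+ k *m Y) = Z *m Z ^+ k *m Q).
  by rewrite mulmxA IH -mulmxA QY mulmxA; congr (_ *m _); rewrite -[LHS]/(_ * _) -exprSr exprS.
have C1 : Q *m series (exp_term Y) m @[m --> \oo] --> Q *m expmx Y.
  by apply: cvg_mulmx; [exact: cvg_cst|exact: expmx_cvg].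
have C2 : series (exp_term Z) m *m Q @[m --> \oo] --> expmx Z *m Q.
  by apply: cvg_mulmx; [exact: expmx_cvg|exact: cvg_cst].
have E : (fun m => Q *m series (exp_term Y) m) = (fun m => series (exp_term Z) m *m Q).
  apply/funext => m; rewrite /series /= mulmx_sumr mulmx_suml; apply: eq_bigr => k _.
  by rewrite -scalemxAr -scalemxAl QYk.
by rewrite E in C1; exact: (norm_cvg_unique C1 C2).
Qed.

Section Blocks.
Variable p : nat.
Implicit Types A B H : 'M[R]_p.

(** This block is the integral of e^(sA) H e^((1-s)B) over 0 <= s <= 1; for B = A it
    is the derivative of the exponential at A in the direction H. *)
Definition Ublock A H B : 'M[R]_p := ursubmx (expmx (block_mx A H 0 B)).

Lemma expmx_block A H B :
  expmx (block_mx A H 0 B) = block_mx (expmx A) (Ublock A H B) 0 (expmx B).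
Proof.
set Y := block_mx A H 0 B.
have E1 : expmx Y *m col_mx 1%:M 0 = col_mx 1%:M 0 *m expmx A.
  apply/esym; apply: expmx_intertwine.
  by rewrite mul_block_col mul_col_mx !(mul1mx, mul0mx, mulmx1, mulmx0, addr0).
have E2 : row_mx 0 1%:M *m expmx Y = expmx B *m row_mx 0 1%:M.
  apply: expmx_intertwine.
  by rewrite mul_row_block mul_mx_row !(mul1mx, mul0mx, mulmx1, mulmx0, add0r).
rewrite -[LHS]submxK; rewrite -[expmx Y]submxK in E1 E2.
move: E1; rewrite mul_block_col mul_col_mx !(mul1mx, mul0mx, mulmx1, mulmx0, addr0).
move=> /eq_col_mx[-> ->].
move: E2; rewrite mul_row_block mul_mx_row !(mul1mx, mul0mx, mulmx1, mulmx0, add0r).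
by move=> /eq_row_mx[_ ->].
Qed.

(** The row [1 1] intertwines the block matrix with A. *)
Lemma Ublock_diff A B : Ublock A (A - B) B = expmx A - expmx B.
Proof.
have : row_mx 1%:M 1%:M *m expmx (block_mx A (A - B) 0 B) = expmx A *m row_mx 1%:M 1%:M.
  apply: expmx_intertwine.
  by rewrite mul_row_block mul_mx_row !mul1mx !mulmx1 addr0 subrK.
rewrite expmx_block mul_row_block mul_mx_row !mul1mx !mulmx1 addr0 => /eq_row_mx[_ <-].
by rewrite addrK.
Qed.

(** Conjugation by diag (k, 1) scales the off-diagonal block. *)
Lemma Ublock_scale A H B (k : R) : Ublock A (k *: H) B = k *: Ublock A H B.
Proof.
have : block_mx k%:M 0 0 1%:M *m expmx (block_mx A H 0 B) =
    expmx (block_mx A (k *: H) 0 B) *m block_mx k%:M 0 0 1%:M.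
  apply: expmx_intertwine.
  rewrite !mulmx_block !(mul1mx, mul0mx, mulmx1, mulmx0, addr0, add0r).
  by rewrite !mul_scalar_mx mul_mx_scalar.
rewrite !expmx_block !mulmx_block !(mul1mx, mul0mx, mulmx1, mulmx0, addr0, add0r).
by rewrite !mul_scalar_mx => /eq_block_mx[_ <- _ _].
Qed.

(** The matrix [[A, 0, H1], [0, A, H2], [0, 0, B]] yields the block for
    k H1 + l H2 by combining its first two block rows with coefficients k and l. *)
Lemma Ublock_add A H1 H2 B : Ublock A (H1 + H2) B = Ublock A H1 B + Ublock A H2 B.
Proof.
pose W : 'M[R]_((p + p) + p) := block_mx (block_mx A 0 0 A) (col_mx H1 H2) 0 B.
have K (r : 'M[R]_(p, p + p)) H : r *m block_mx A 0 0 A = A *m r ->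
    r *m col_mx H1 H2 = H -> Ublock A H B = r *m ursubmx (expmx W).
  move=> rA rH.
  have : block_mx r 0 0 1%:M *m expmx W = expmx (block_mx A H 0 B) *m block_mx r 0 0 1%:M.
    apply: expmx_intertwine.
    by rewrite !mulmx_block !(mul1mx, mul0mx, mulmx1, mulmx0, addr0, add0r) rA rH.
  rewrite -{1}[expmx W]submxK expmx_block !mulmx_block.
  rewrite !(mul1mx, mul0mx, mulmx1, mulmx0, addr0, add0r).
  by move=> /eq_block_mx[_ <- _ _].
have id_row (k l : R) : row_mx k%:M l%:M *m block_mx A 0 0 A = A *m row_mx k%:M l%:M.
  by rewrite mul_row_block mul_mx_row !mulmx0 addr0 add0r !scalar_mxC.
have Kr (k l : R) : Ublock A (k *: H1 + l *: H2) B = row_mx k%:M l%:M *m ursubmx (expmx W).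
  by apply: K; rewrite ?id_row// mul_row_col !mul_scalar_mx.
have := Kr 1 1; have := Kr 1 0; have := Kr 0 1.
rewrite !scale1r !scale0r addr0 add0r => -> -> ->.
by rewrite -mulmxDl add_row_mx -!raddfD /= addr0 add0r.
Qed.
End Blocks.

Lemma expmx0 p : expmx (0 : 'M[R]_p) = 1%:M.
Proof.
have C := @expmx_cvg p 0.
have C2 : series (exp_term (0 : 'M[R]_p)) @ \oo --> (1%:M : 'M[R]_p).
  apply: cvg_trans (@cvg_cst _ (1%:M : 'M[R]_p) nat \oo _); apply: near_eq_cvg; near=> m.
  have m0 : (0 < m)%N by near: m; exact: nbhs_infty_gt.
  rewrite /series /= big_ltn// big_nat big1 => [|k /andP[k0 _]].
    by rewrite addr0 /exp_term fact0 invr1 scale1r expr0.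
  rewrite /exp_term; case: k k0 => // k _; rewrite exprS.
  by change ((k.+1`!%:R)^-1 *: (0 *m 0 ^+ k) = 0 :> 'M[R]_p); rewrite mul0mx scaler0.
exact: (norm_cvg_unique C C2).
Unshelve. all: by end_near. Qed.

Lemma block_norm p q r s (A : 'M[R]_(p, q)) (B : 'M[R]_(p, r)) (C : 'M[R]_(s, q)) (D : 'M[R]_(s, r)) (e : R) :
  0 <= e -> `|A| <= e -> `|B| <= e -> `|C| <= e -> `|D| <= e -> `|block_mx A B C D| <= e.
Proof.
move=> e0 Ae Be Ce De; apply: mx_norm_le => // i j; rewrite !mxE.
case: (fintype.split i) => k; rewrite !mxE; case: (fintype.split j) => l;
  exact: le_trans (mx_entry_le _ _ _) _.
Qed.

Lemma Ublock_norm p (A H B : 'M[R]_p) : `|Ublock A H B| <= `|expmx (block_mx A H 0 B)|.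
Proof. by apply: mx_norm_le => // i j; rewrite !mxE mx_entry_le. Qed.

(** By [Ublock_diff] the difference of two exponentials is |A - B| times a block
    with a direction of norm 1, and such blocks are bounded near A. *)
Lemma expmx_continuous p : continuous (@expmx R p).
Proof.
move=> A; have FA : Filter (nbhs A) := nbhs_filter A.
apply/(@cvgrPdist_le _ _ _ (nbhs A) FA) => e e0.
(* [r] bounds all blocks, and [L] the exponential of the block matrix *)
pose r := `|A| + 1; pose L := expR ((p + p)%:R * r).
have L0 : 0 < L by exact: expR_gt0.
have d0 : 0 < Num.min 1 (e / L) by rewrite lt_min ltr01 divr_gt0.
near=> B.
have : `|A - B| < Num.min 1 (e / L).
  by near: B; have := nbhsx_ballx A _ d0; apply: filterS => B; rewrite -ball_normE.
rewrite lt_min => /andP[AB1 ABe].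
have [->|nAB] := eqVneq A B; first by rewrite subrr normr0 ltW.
have nAB0 : 0 < `|A - B| by rewrite normr_gt0 subr_eq0.
rewrite -Ublock_diff -[X in Ublock _ X _](scale1r) -(mulfV (lt0r_neq0 nAB0)) -scalerA Ublock_scale.
rewrite normrZ normr_id -[leRHS](divfK (lt0r_neq0 L0)) ler_pM//; first exact: ltW.
apply: (le_trans (Ublock_norm _ _ _)); apply: (le_trans (expmx_norm _)).
rewrite ler_expR ler_wpM2l//.
have r0 : 0 <= r by rewrite addr_ge0.
have r1 : 1 <= r by rewrite lerDr.
apply: block_norm => //.
- by rewrite lerDl.
- by rewrite normrZ normfV normr_id mulVf// lt0r_neq0.
- by rewrite normr0.
- rewrite -[B](subKr A) (le_trans (ler_normB _ _))// lerD2l; exact: ltW.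
Unshelve. all: by end_near. Qed.
End Exp.

(** * Smoothness of the matrix exponential *)

Section ExpDiff.
Variable R : realType.

(** Replacing f y by f x changes the product by o(y - x) only. *)
Lemma caratheodory_differentiable (V W : normedModType R) (u : V -> R) (f : V -> W) (x : V) :
  (forall y, `|u y| <= `|y - x|) -> differentiable u x ->
  f y @[y --> x] --> f x -> differentiable (fun y => u y *: f y) x.
Proof.
move=> ux du fx.
have -> : (fun y => u y *: f y) = (fun y => u y *: f x) + (fun y => u y *: (f y - f x)).
  by apply/funext => y; rewrite [RHS]/GRing.add /= -scalerDr addrC subrK.
apply: differentiableD; first exact: differentiableZl.
apply: (proj1 (@small_diff R V W (fun y => u y *: (f y - f x)) x _ _)).
  by rewrite subrr scaler0.
move=> e e0; have := (@cvgrPdist_le _ _ _ (nbhs x) (nbhs_filter x) f (f x)).1 fx e e0.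
apply: filterS => y fy; rewrite normrZ mulrC ler_pM//.
by rewrite distrC.
Qed.

Section Exp.
Variable p : nat.
Implicit Types A B H : 'M[R]_p.

Lemma Ublock_sum A B (I : finType) (c : I -> R) (H : I -> 'M[R]_p) :
  Ublock A (\sum_i c i *: H i) B = \sum_i c i *: Ublock A (H i) B.
Proof.
elim: (index_enum I) => [|i s IH]; last by rewrite !big_cons Ublock_add Ublock_scale IH.
by rewrite !big_nil -(scale0r (0 : 'M[R]_p)) Ublock_scale !scale0r.
Qed.

Lemma cvg_block (T : Type) (F : set_system T) (FF : Filter F) p1 p2 q1 q2
    (f : T -> 'M[R]_(p1, q1)) (g : T -> 'M[R]_(p1, q2)) (h : T -> 'M[R]_(p2, q1))
    (k : T -> 'M[R]_(p2, q2)) (a : 'M[R]_(p1, q1)) (b : 'M[R]_(p1, q2))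
    (c : 'M[R]_(p2, q1)) (d : 'M[R]_(p2, q2)) :
  f @ F --> a -> g @ F --> b -> h @ F --> c -> k @ F --> d ->
  block_mx (f x) (g x) (h x) (k x) @[x --> F] --> block_mx a b c d.
Proof.
move=> /cvg_mxP fa /cvg_mxP gb /cvg_mxP hc /cvg_mxP kd; apply/cvg_mxP => i j.
rewrite -[i]splitK -[j]splitK; case: (fintype.split i) => i'; case: (fintype.split j) => j' /=.
- rewrite block_mxEul; under eq_fun do rewrite block_mxEul; exact: fa.
- rewrite block_mxEur; under eq_fun do rewrite block_mxEur; exact: gb.
- rewrite block_mxEdl; under eq_fun do rewrite block_mxEdl; exact: hc.
- rewrite block_mxEdr; under eq_fun do rewrite block_mxEdr; exact: kd.
Qed.

Lemma cvg_expmx (T : Type) (F : set_system T) (FF : Filter F) q (f : T -> 'M[R]_q) (A : 'M[R]_q) :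
  f @ F --> A -> expmx (f x) @[x --> F] --> expmx A.
Proof. by move=> fA; apply: (cvg_comp f (@expmx R q) fA); exact: expmx_continuous. Qed.

Lemma cvg_Ublock (T : Type) (F : set_system T) (FF : Filter F) (f g h : T -> 'M[R]_p) A H B :
  f @ F --> A -> g @ F --> H -> h @ F --> B ->
  Ublock (f x) (g x) (h x) @[x --> F] --> Ublock A H B.
Proof.
move=> fA gH hB.
have K : expmx (block_mx (f x) (g x) 0 (h x)) @[x --> F] --> expmx (block_mx A H 0 B).
  by apply: cvg_expmx; apply: cvg_block => //; exact: cvg_cst.
move/cvg_mxP: K => K; apply/cvg_mxP => i j.
rewrite /Ublock !mxE; under eq_fun do rewrite !mxE; exact: K.
Qed.

(** exp B - exp A is the sum of (B - A)_ij U(B, E_ij, A), with blocks that are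
    continuous in B. *)
Lemma differentiable_expmx A : differentiable (@expmx R p) A.
Proof.
have -> : @expmx R p = (fun=> expmx A) + \sum_(i < p) \sum_(j < p)
    (fun B => (B - A) i j *: Ublock B (delta_mx i j) A).
  apply/funext => B; change (expmx B = expmx A + (\sum_(i < p) \sum_(j < p)
    (fun B => (B - A) i j *: Ublock B (delta_mx i j) A)) B).
  rewrite -[LHS](subrK (expmx A)) addrC; congr (_ + _).
  rewrite fct_sumE -Ublock_diff [X in Ublock _ X _]matrix_sum_delta.
  rewrite (eq_bigr (fun i => 1 *: \sum_j (B - A) i j *: delta_mx i j)); last first.
    by move=> i _; rewrite scale1r.
  rewrite Ublock_sum; apply: eq_bigr => i _.
  by rewrite scale1r Ublock_sum fct_sumE.
apply: differentiableD; first exact: differentiable_cst.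
apply: differentiable_sum => i; apply: differentiable_sum => j.
apply: caratheodory_differentiable.
- by move=> B; exact: mx_entry_le.
- apply: (differentiable_comp (f := fun B => B - A) (g := fun M : 'M[R]_p => M i j)).
    by apply: differentiableB => //; exact: differentiable_cst.
  exact: differentiable_coord.
- by apply: (cvg_Ublock (nbhs_filter A)); [exact: cvg_id|exact: cvg_cst|exact: cvg_cst].
Qed.

Lemma derive_expmx n (X : 'rV[R]_n -> 'M[R]_p) v e : differentiable X v ->
  'D_e (fun w => expmx (X w)) v = Ublock (X v) ('D_e X v) (X v).
Proof.
move=> dX.
have dE : derivable (fun w => expmx (X w)) v e.
  by apply: diff_derivable; apply: differentiable_comp => //; exact: differentiable_expmx.
have dX' : derivable X v e by exact: diff_derivable.
have c1 : h^-1 *: (X (h *: e + v) - X v) @[h --> (0 : R)^'] --> 'D_e X v by exact: dX'.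
have c2 : h^-1 *: (expmx (X (h *: e + v)) - expmx (X v)) @[h --> (0 : R)^'] -->
  'D_e (fun w => expmx (X w)) v by exact: dE.
have cX : X (h *: e + v) @[h --> (0 : R)^'] --> X v.
  have /= K := differentiable_continuous dX.
  have L : (h *: e + v) @[h --> (0 : R)^'] --> v.
    rewrite -[X in _ --> X]add0r -(scale0r e); apply: cvgD; last exact: cvg_cst.
    by apply: cvgZr_tmp; exact: nbhs_dnbhs.
  exact: (cvg_comp _ X L).
have c3 : h^-1 *: (expmx (X (h *: e + v)) - expmx (X v)) @[h --> (0 : R)^'] -->
    Ublock (X v) ('D_e X v) (X v).
  have K : Ublock (X (h *: e + v)) (h^-1 *: (X (h *: e + v) - X v)) (X v) @[h --> (0 : R)^'] -->
    Ublock (X v) ('D_e X v) (X v) by apply: (cvg_Ublock (dnbhs_filter 0) cX c1); exact: cvg_cst.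
  apply: cvg_trans K; apply: near_eq_cvg; near=> h.
  by rewrite Ublock_scale Ublock_diff.
exact: (norm_cvg_unique c2 c3).
Unshelve. all: by end_near. Qed.

End Exp.

Section Fam.
Variables (n : nat) (I : Type) (F : set_system I) (FF : Filter F) (A : set I) (FA : F A)
  (U : set 'rV[R]_n).
Hypothesis oU : open U.

Lemma smM_pd p q (f : I -> 'rV[R]_n -> 'M[R]_(p, q)) fl j : smM F A U f fl ->
  smM F A U (fun k => pd j (f k)) (pd j fl).
Proof.
move=> H N i l; have [[df dl _] /(_ j) K] := H N.+1 i l.
have E (g : 'rV[R]_n -> 'M[R]_(p, q)) v : (forall i l, differentiable (fun v => g v i l) v) ->
    pd j (fun v => g v i l) v = pd j g v i l.
  move=> dg; rewrite /pd derive_mx ?mxE//; apply: diff_derivable.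
  exact/differentiable_mxP.
apply: (smN_eq FF FA oU _ _ K) => [k Ak v Uv|v Uv]; apply: E => i' l'.
- by have [[+ _ _] _] := H 1%N i' l'; apply.
- by have [[_ + _] _] := H 1%N i' l'; apply.
Qed.

Lemma smM_block p1 p2 q1 q2 (f : I -> 'rV[R]_n -> 'M[R]_(p1, q1)) fl
    (g : I -> 'rV[R]_n -> 'M[R]_(p1, q2)) gl (h : I -> 'rV[R]_n -> 'M[R]_(p2, q1)) hl
    (k : I -> 'rV[R]_n -> 'M[R]_(p2, q2)) kl :
  smM F A U f fl -> smM F A U g gl -> smM F A U h hl -> smM F A U k kl ->
  smM F A U (fun i v => block_mx (f i v) (g i v) (h i v) (k i v))
    (fun v => block_mx (fl v) (gl v) (hl v) (kl v)).
Proof.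
move=> sf sg sh sk N i j.
rewrite -[i]splitK -[j]splitK; case: (fintype.split i) => i'; case: (fintype.split j) => j' /=.
- apply: (smN_eq FF FA oU _ _ (sf N i' j')) => [m _ v _|v _]; by rewrite block_mxEul.
- apply: (smN_eq FF FA oU _ _ (sg N i' j')) => [m _ v _|v _]; by rewrite block_mxEur.
- apply: (smN_eq FF FA oU _ _ (sh N i' j')) => [m _ v _|v _]; by rewrite block_mxEdl.
- apply: (smN_eq FF FA oU _ _ (sk N i' j')) => [m _ v _|v _]; by rewrite block_mxEdr.
Qed.

(** Induction on the order, for matrices of all sizes at once: a partial derivative
    of exp X is a block of exp [[X, X'], [0, X]], whose argument is a family of
    the same kind and of twice the size. *)
Lemma smM_exp p (X : I -> 'rV[R]_n -> 'M[R]_p) Xl : smM F A U X Xl ->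
  smM F A U (fun k v => expmx (X k v)) (fun v => expmx (Xl v)).
Proof.
move=> sX N; elim: N p X Xl sX => [|N IH] p X Xl sX i j.
all: have d k : A k -> forall v, U v -> differentiable (X k) v
  by move=> Ak v Uv; apply/differentiable_mxP => i' j'; have [[+ _ _] _] := sX 1%N i' j'; apply.
all: have dl v : U v -> differentiable Xl v
  by move=> Uv; apply/differentiable_mxP => i' j'; have [[_ + _] _] := sX 1%N i' j'; apply.
all: have dE (Y : 'rV[R]_n -> 'M[R]_p) v : differentiable Y v ->
    differentiable (fun w => expmx (Y w)) v
  by move=> dY; apply: differentiable_comp => //; exact: differentiable_expmx.
all: have base : [/\ forall k, A k -> forall v, U v -> differentiable (fun v => expmx (X k v) i j) v,
      forall v, U v -> differentiable (fun v => expmx (Xl v) i j) v &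
      forall v, U v -> expmx (X q.1 q.2) i j @[q --> filter_prod F (nbhs v)] --> expmx (Xl v) i j].
1, 3: split=> [k Ak v Uv|v Uv|v Uv];
  [ by move: i j; apply/(differentiable_mxP (fun v => expmx (X k v))); apply: dE; exact: d
  | by move: i j; apply/(differentiable_mxP (fun v => expmx (Xl v))); apply: dE; exact: dl
  | move: i j; apply/cvg_mxP; apply: cvg_expmx; apply/cvg_mxP => i j;
    have [[_ _ +] _] := sX 1%N i j; exact ].
all: apply: smN_intro => // _ [<-] l.
have sB := smM_block sX (smM_pd l sX) (smM_const FF A U 0) sX.
apply: (smN_eq FF FA oU _ _ (IH _ _ _ sB (lshift p i) (rshift p j))).
- move=> k Ak v Uv; rewrite expmx_block block_mxEur /pd -derive_expmx; last exact: d.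
  by rewrite derive_mx ?mxE//; apply: diff_derivable; apply: dE; exact: d.
- move=> v Uv; rewrite expmx_block block_mxEur /pd -derive_expmx; last exact: dl.
  by rewrite derive_mx ?mxE//; apply: diff_derivable; apply: dE; exact: dl.
Qed.
End Fam.
End ExpDiff.

(** * Curves of matrices *)

Section MxCurves.
Variable R : realType.

Definition is_mxd p q (f : R -> 'M[R]_(p, q)) (t : R) (l : 'M[R]_(p, q)) :=
  h^-1 *: (f (t + h) - f t) @[h --> (0 : R)^'] --> l.

Let F0 : ProperFilter (0 : R)^' := _.
Let FF0 : Filter (0 : R)^' := dnbhs_filter _.
Let neq0 : \forall h \near (0 : R)^', h != 0.
Proof. exact: nbhs_dnbhs_neq. Qed.

Lemma is_mxd_entry p q (f : R -> 'M[R]_(p, q)) t l i j :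
  is_mxd f t l -> is_derive t (1 : R) (fun s => f s i j) (l i j).
Proof.
move=> /cvg_mxP/(_ i j) fl.
have D : h^-1 *: (f (h *: (1 : R) + t) i j - f t i j) @[h --> (0 : R)^'] --> l i j.
  apply: cvg_trans fl; apply: near_eq_cvg; near=> h.
  have -> : h *: (1 : R) + t = t + h by rewrite [h *: _]mulr1 addrC.
  by rewrite !mxE.
apply: DeriveDef; first by apply/cvg_ex; exists (l i j); exact: D.
exact: (cvg_lim _ D).
Unshelve. all: by end_near. Qed.

Lemma is_mxd_cvg p q (f : R -> 'M[R]_(p, q)) t l : is_mxd f t l ->
  f (t + h) @[h --> (0 : R)^'] --> f t.
Proof.
move=> fl; have H : f t + h *: (h^-1 *: (f (t + h) - f t)) @[h --> (0 : R)^'] --> f t + 0 *: l.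
  by apply: cvgD; [exact: cvg_cst|apply: cvgZ => //; exact: nbhs_dnbhs].
rewrite scale0r addr0 in H; apply: cvg_trans H; apply: near_eq_cvg.
by apply: filterS neq0 => h h0; rewrite scalerA mulfV// scale1r addrC subrK.
Qed.

Lemma is_mxd_mul p q r (f : R -> 'M[R]_(p, q)) (g : R -> 'M[R]_(q, r)) t fl gl :
  is_mxd f t fl -> is_mxd g t gl ->
  is_mxd (fun s => f s *m g s) t (fl *m g t + f t *m gl).
Proof.
move=> df dg; have cg := is_mxd_cvg dg.
have H : (h^-1 *: (f (t + h) - f t)) *m g (t + h) + f t *m (h^-1 *: (g (t + h) - g t))
    @[h --> (0 : R)^'] --> fl *m g t + f t *m gl.
  apply: cvgD; first exact: cvg_mulmx.
  by apply: cvg_mulmx => //; exact: cvg_cst.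
apply: cvg_trans H; apply: near_eq_cvg; near=> h.
by rewrite -scalemxAl -scalemxAr -scalerDr mulmxBl mulmxBr addrA subrK.
Unshelve. all: by end_near. Qed.

(** The case of [smM_inv] in which the variable of the functions ranges over
    R^0. *)
Lemma cvg_invmx (T : Type) (F : set_system T) (FF : Filter F) p (f : T -> 'M[R]_p)
    (A : 'M[R]_p) : (\forall x \near F, f x \in unitmx) -> A \in unitmx ->
  f @ F --> A -> invmx (f x) @[x --> F] --> invmx A.
Proof.
move=> uf uA /cvg_mxP fA.
pose u0 : 'rV[R]_0 := 0.
have S : smM F [set x | f x \in unitmx] setT (fun x (_ : 'rV[R]_0) => f x) (fun=> A).
  by move=> N i j; exact: smN_cst.
have K := smM_inv FF uf openT (fun k h _ _ => h) (fun _ _ => uA) S.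
apply/cvg_mxP => i j; have [_ _ /(_ u0 I) C] := smN_base (K 0%N i j).
apply: (cvg_comp (fun x => (x, u0)) (fun p => invmx (f p.1) i j)) C.
move=> B [[P Q] /= [FP Qu] PQ]; apply: filterS FP => x Px.
by apply: PQ; split=> //=; exact: nbhs_singleton Qu.
Qed.

Lemma is_mxd_inv p (f : R -> 'M[R]_p) t fl : (\forall s \near t, f s \in unitmx) ->
  is_mxd f t fl -> is_mxd (fun s => invmx (f s)) t (- (invmx (f t) *m fl *m invmx (f t))).
Proof.
move=> uf df; have ut := nbhs_singleton uf.
have uh : \forall h \near (0 : R)^', f (t + h) \in unitmx.
  apply: nbhs_dnbhs.
  have K : \forall h \near (0 : R), f (h + t) \in unitmx.
    by have := near_shift 0 t (fun s => is_true (f s \in unitmx)); rewrite subr0 => <-.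
  by apply: filterS K => h; rewrite addrC.
have ci := cvg_invmx FF0 uh ut (is_mxd_cvg df).
have H : - (invmx (f (t + h)) *m (h^-1 *: (f (t + h) - f t)) *m invmx (f t))
    @[h --> (0 : R)^'] --> - (invmx (f t) *m fl *m invmx (f t)).
  by apply: cvgN; apply: cvg_mulmx; [exact: cvg_mulmx|exact: cvg_cst].
apply: cvg_trans H; apply: near_eq_cvg; apply: filterS uh => h u.
rewrite -scalemxAr -scalemxAl -scalerN mulmxBr mulVmx// mulmxBl mul1mx mulmxK//.
by rewrite opprB.
Qed.

Lemma is_mxd_eq0_cst p q (J : set R) (f : R -> 'M[R]_(p, q)) : is_interval J -> J 0 ->
  (forall t, J t -> is_mxd f t 0) -> forall t, J t -> f t = f 0.
Proof.
move=> iJ J0 f0 t Jt; apply/matrixP => i j.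
have D s : J s -> is_derive s (1 : R) (fun s => f s i j) 0.
  by move=> Js; have := is_mxd_entry i j (f0 s Js); rewrite mxE.
have C s : J s -> {for s, continuous (fun s => f s i j)}.
  by move=> Js; apply: differentiable_continuous; apply/derivable1_diffP; have [] := D s Js.
have [t0|t0] := leP 0 t.
  have [| |c _] := @MVT_segment R (fun s => f s i j) (fun=> 0) 0 t t0.
  - by move=> x; rewrite in_itv /= => /andP[/ltW x0 /ltW xt]; apply: D; apply: (iJ 0 t) => //; rewrite x0.
  - apply: continuous_in_subspaceT => x; rewrite inE /= in_itv /= => xt.
    by apply: C; exact: (iJ 0 t).
  by rewrite mul0r => /eqP; rewrite subr_eq0 => /eqP.
have [| |c _] := @MVT_segment R (fun s => f s i j) (fun=> 0) t 0 (ltW t0).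
- by move=> x; rewrite in_itv /= => /andP[/ltW x0 /ltW xt]; apply: D; apply: (iJ t 0) => //; rewrite x0.
- apply: continuous_in_subspaceT => x; rewrite inE /= in_itv /= => xt.
  by apply: C; exact: (iJ t 0).
by rewrite mul0r => /eqP; rewrite subr_eq0 => /eqP.
Qed.

(** The powers of [[Y, 1], [0, Y]] have k Y^(k-1) in the corner, so that its
    exponential series is that of Y shifted by one. *)
Lemma Ublock_comm p (Y : 'M[R]_p) : Ublock Y 1%:M Y = expmx Y.
Proof.
pose Q := block_mx Y 1%:M 0 Y.
have P k : Q ^+ k.+1 = block_mx (Y ^+ k.+1) (k.+1%:R *: Y ^+ k) 0 (Y ^+ k.+1).
  elim: k => [|k IH]; first by rewrite !expr1 expr0 scale1r.
  rewrite exprS IH; change (Q *m block_mx (Y ^+ k.+1) (k.+1%:R *: Y ^+ k) 0 (Y ^+ k.+1) =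
    block_mx (Y ^+ k.+2) (k.+2%:R *: Y ^+ k.+1) 0 (Y ^+ k.+2)).
  rewrite mulmx_block !(mul0mx, mulmx0, mul1mx, addr0, add0r) -scalemxAr.
  have E m : Y *m Y ^+ m = Y ^+ m.+1 by rewrite exprS.
  by rewrite !E -[k.+2]addn1 natrD scalerDl scale1r.
have C1 : ursubmx (series (exp_term Q) (m + 1)%N) @[m --> \oo] --> Ublock Y 1%:M Y.
  apply/cvg_mxP => i j; have /cvg_mxP C := @expmx_cvg _ _ Q.
  have -> : Ublock Y 1%:M Y i j = expmx Q (lshift p i) (rshift p j) by rewrite !mxE.
  have C1 := C (lshift p i) (rshift p j); rewrite -(cvg_shiftn 1) in C1.
  apply: cvg_trans C1.
  by apply: near_eq_cvg; near=> m; rewrite !mxE.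
apply: (norm_cvg_unique C1); apply: cvg_trans (@expmx_cvg _ _ Y); apply: near_eq_cvg; near=> m.
apply/matrixP => i j; rewrite !mxE addn1 /series !summxE big_nat_recl//.
have -> : exp_term Q 0 (lshift p i) (rshift p j) = 0.
  rewrite /exp_term expr0.
  change (((0`!%:R)^-1 *: (1%:M : 'M[R]_(p + p))) (lshift p i) (rshift p j) = 0).
  by rewrite mxE scalar_mx_block block_mxEur mxE mulr0.
rewrite add0r; apply: eq_bigr => k _.
rewrite /exp_term P 2!mxE block_mxEur !mxE mulrA; congr (_ * _).
by rewrite factS natrM invfM mulrAC mulVf ?mul1r// pnatr_eq0.
Unshelve. all: by end_near. Qed.

Lemma Ublock_self p (A : 'M[R]_p) (t : R) : Ublock (t *: A) A (t *: A) = A *m expmx (t *: A).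
Proof.
rewrite -Ublock_comm.
have : block_mx A 0 0 1%:M *m expmx (block_mx (t *: A) 1%:M 0 (t *: A)) =
    expmx (block_mx (t *: A) A 0 (t *: A)) *m block_mx A 0 0 1%:M.
  apply: expmx_intertwine.
  by rewrite !mulmx_block !(mul1mx, mul0mx, mulmx1, mulmx0, addr0, add0r) -scalemxAr scalemxAl.
rewrite !expmx_block !mulmx_block !(mul1mx, mul0mx, mulmx1, mulmx0, addr0, add0r).
by move=> /eq_block_mx[_ <- _ _].
Qed.

Lemma expmx_comm p (A : 'M[R]_p) (s t : R) :
  (s *: A) *m expmx (t *: A) = expmx (t *: A) *m (s *: A).
Proof. by apply: expmx_intertwine; rewrite -!scalemxAl -!scalemxAr !scalerA mulrC. Qed.

Lemma is_mxd_exp p (A : 'M[R]_p) (t : R) :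
  is_mxd (fun s => expmx (s *: A)) t (A *m expmx (t *: A)).
Proof.
have c0 : (t + h) *: A @[h --> (0 : R)^'] --> t *: A.
  have th : t + h @[h --> (0 : R)^'] --> t.
    by rewrite -[X in _ --> X]addr0; apply: cvgD; [exact: cvg_cst|exact: nbhs_dnbhs].
  exact: (cvgZr_tmp th).
rewrite -Ublock_self.
have H : Ublock ((t + h) *: A) A (t *: A) @[h --> (0 : R)^'] --> Ublock (t *: A) A (t *: A).
  by apply: (cvg_Ublock FF0 c0); exact: cvg_cst.
apply: cvg_trans H; apply: near_eq_cvg; apply: filterS neq0 => h h0.
by rewrite -Ublock_diff -scalerBl addrAC subrr add0r Ublock_scale scalerA mulVf// scale1r.
Qed.

Lemma is_mxd_expN p (A : 'M[R]_p) (c t : R) :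
  is_mxd (fun s => expmx ((c - s) *: A)) t (- (A *m expmx ((c - t) *: A))).
Proof.
have H := @is_mxd_exp p A (c - t).
have H' : - ((-1 * h)^-1 *: (expmx ((c - t + -1 * h) *: A) - expmx ((c - t) *: A)))
    @[h --> (0 : R)^'] --> - (A *m expmx ((c - t) *: A)).
  apply: cvgN.
  have N1 : -1 != 0 :> R by rewrite oppr_eq0 oner_eq0.
  exact: (cvg_comp ( *%R (-1)) (fun h => h^-1 *: (expmx ((c - t + h) *: A) - expmx ((c - t) *: A)))
    (dnbhs0_scale N1) H).
apply: cvg_trans H'; apply: near_eq_cvg; near=> h.
by rewrite mulN1r invrN scaleNr opprK opprD addrA.
Unshelve. all: by end_near. Qed.

(** The derivative of r |-> e^(rA) e^((s+t-r)A) vanishes. *)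
Lemma expmx_add p (A : 'M[R]_p) (s t : R) :
  expmx (s *: A) *m expmx (t *: A) = expmx ((s + t) *: A).
Proof.
have D r : is_mxd (fun r => expmx (r *: A) *m expmx ((s + t - r) *: A)) r 0.
  have := is_mxd_mul (@is_mxd_exp p A r) (@is_mxd_expN p A (s + t) r).
  have -> : A *m expmx (r *: A) = expmx (r *: A) *m A by have := expmx_comm A 1 r; rewrite scale1r.
  by rewrite mulmxN -mulmxA subrr.
have iT : is_interval [set: R] by [].
have := is_mxd_eq0_cst iT I (fun r _ => D r) (t := s) I.
by rewrite scale0r expmx0 mul1mx subr0 addrC addKr addrC.
Qed.

Lemma expmx_unit p (A : 'M[R]_p) (t : R) : expmx (t *: A) \in unitmx.
Proof.
have := expmx_add A t (- t); rewrite subrr scale0r expmx0 => /mulmx1_unit[].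
by [].
Qed.

Lemma expmx_tr p (A : 'M[R]_p) : (expmx A)^T = expmx A^T.
Proof.
have C1 : (series (exp_term A) m)^T @[m --> \oo] --> (expmx A)^T.
  by apply: cvg_trmx; exact: expmx_cvg.
apply: (norm_cvg_unique C1); apply: cvg_trans (@expmx_cvg _ _ A^T).
apply: near_eq_cvg; near=> m; rewrite /series /= linear_sum; apply: eq_bigr => k _.
rewrite /exp_term linearZ /=; congr (_ *: _).
elim: k => [|k IH]; first by rewrite !expr0; change ((1%:M : 'M[R]_p) = 1%:M^T); rewrite trmx1.
rewrite exprS exprSr; change (A^T *m A^T ^+ k = (A ^+ k *m A)^T).
by rewrite trmx_mul IH.
Unshelve. all: by end_near. Qed.

End MxCurves.

(** * The curves g e^(tA) *)

Section ExpCurve.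
Variables (R : realType) (n : nat) (M : manifold R n).
Local Notation two_form := (two_form M).
Local Notation S2 := (@S2 R n M).
Local Notation Met := (@Met R n M).
Local Notation Sm := (@Sm R n M).

Let FF0 : Filter (0 : R)^' := dnbhs_filter _.
Let neq0 : (0 : R)^' [set h : R | h != 0].
Proof. exact: (nbhs_dnbhs_neq (0 : R)). Qed.

Variables (g a : two_form).
Hypotheses (Mg : Met g) (Sa : S2 a).

Definition gexp (t : R) : two_form := fmul g (fun x => expmx (t *: sharp g a x)).

Lemma gexpE t x : gexp t x = g x *m expmx (t *: (invmx (g x) *m a x)).
Proof. by []. Qed.

Lemma gmul_gexp b t x : gmul b g (gexp t) x = b x *m expmx (t *: sharp g a x).
Proof. by rewrite gmulE gexpE mulKmx//; exact: Met_unit. Qed.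

Definition locX (c : chart R n M) v := invmx (local_form c g v) *m local_form c a v.

(** The transposed frame intertwines g^-1 a with its expression in the chart. *)
Lemma local_gexp c v t : atlas M c -> cimg c v ->
  local_form c (gexp t) v = local_form c g v *m expmx (t *: locX c v).
Proof.
move=> Mc cv; have uP := frame_unit Mc cv; have ug := Met_unit (cinv c v) Mg.
have uT : (frame c v)^T \in unitmx by rewrite unitmx_tr.
rewrite /locX !local_formE gexpE.
set P := frame c v in uP uT *; set G := g _ in ug *; set A := a _.
have E : P^T *m (t *: (invmx (P *m G *m P^T) *m (P *m A *m P^T))) = (t *: (invmx G *m A)) *m P^T.
  by rewrite invmx_congr// -scalemxAr -scalemxAl !mulmxA (mulmxV uT) mul1mx (mulmxKV uP).
by rewrite -(mulmxA (P *m G) P^T) (expmx_intertwine E) !mulmxA.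
Qed.

Lemma smM_locX c : atlas M c ->
  smM (0 : R)^' [set h : R | h != 0] (cimg c) (fun=> locX c) (locX c).
Proof.
move=> Mc; have oc := open_cimg (c := c).
apply: (smM_mul FF0 neq0 oc); last by apply: smooth_smM => //; exact: S2_Sm.
apply: (smM_inv FF0 neq0 oc).
- by move=> k _ v cv; apply: local_form_unit => //; exact: Met_unit.
- by move=> v cv; apply: local_form_unit => //; exact: Met_unit.
- by apply: smooth_smM => //; exact: Met_Sm.
Qed.

Lemma Sm_gexp t : Sm (gexp t).
Proof.
move=> c Mc; have oc := open_cimg (c := c).
have H : smM (0 : R)^' [set h : R | h != 0] (cimg c) (fun=> local_form c (gexp t))
    (local_form c (gexp t)).
  have S := smM_mul FF0 neq0 oc (smooth_smM FF0 neq0 (Met_Sm Mg) Mc)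
    (smM_exp FF0 neq0 oc (smM_scale FF0 neq0 oc (@cvg_cst R t R (0 : R)^' FF0 : (fun=> t) @ _ --> t) (smM_locX Mc))).
  by apply: (smM_eq FF0 neq0 oc _ _ S) => [k _ v cv|v cv]; rewrite local_gexp.
by have /(smM_partials FF0 neq0 oc)[_ + _] := H; apply.
Qed.

(** For X = g^-1 a, the difference quotient is g U((t+h)X, X, tX) in a chart, and
    by [smM_exp] it converges as h -> 0 with all derivatives. *)
Lemma gexp_deriv t : h^-1 *: (gexp (t + h) - gexp t) @[h --> (0 : R)^'] --> gmul a g (gexp t).
Proof.
have Sl : Sm (gmul a g (gexp t)) by apply: Sm_gmul => //; [exact: S2_Sm|exact: Sm_gexp].
apply: (cvg_smM2 FF0 neq0) => // [h _|c Mc].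
  by apply: Sm_scale; apply: Sm_sub; exact: Sm_gexp.
have oc := open_cimg (c := c).
have th : t + h @[h --> (0 : R)^'] --> t.
  by rewrite -[X in _ --> X]addr0; apply: cvgD; [exact: cvg_cst|exact: nbhs_dnbhs].
have sX := smM_locX Mc.
have sB := smM_block FF0 neq0 oc (smM_scale FF0 neq0 oc th sX) sX
  (smM_const FF0 _ (cimg c) 0) (smM_scale FF0 neq0 oc (@cvg_cst R t R (0 : R)^' FF0 : (fun=> t) @ _ --> t) sX).
have sE := smM_exp FF0 neq0 oc sB.
have sU : smM (0 : R)^' [set h : R | h != 0] (cimg c)
    (fun h v => Ublock ((t + h) *: locX c v) (locX c v) (t *: locX c v))
    (fun v => Ublock (t *: locX c v) (locX c v) (t *: locX c v)).
  move=> N i j; apply: (smN_eq FF0 neq0 oc _ _ (sE N (lshift n i) (rshift n j))).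
  - by move=> k _ v _; rewrite !mxE.
  - by move=> v _; rewrite !mxE.
have S := smM_mul FF0 neq0 oc (smooth_smM FF0 neq0 (Met_Sm Mg) Mc) sU.
apply: (smM_eq FF0 neq0 oc _ _ S) => [h h0 v cv|v cv].
  rewrite local_formZ local_formB !local_gexp// -mulmxBr -Ublock_diff -scalerBl.
  by rewrite addrAC subrr add0r Ublock_scale -scalemxAr scalerA mulVf// scale1r.
have uG := local_form_unit Mc cv (Met_unit (cinv c v) Mg).
rewrite Ublock_self /gmul local_fmul_sharp//; last exact: Met_unit.
by rewrite local_gexp// mulmxA {1}/locX (mulKVmx uG) -(mulmxA (local_form c a v)) (mulKmx uG).
Qed.

Lemma expmx_sharp_tr t x : (expmx (t *: sharp g a x))^T *m g x = g x *m expmx (t *: sharp g a x).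
Proof.
rewrite expmx_tr; apply/esym; apply: expmx_intertwine.
have ug := Met_unit x Mg.
rewrite /sharp [(t *: _)^T]linearZ /= trmx_mul trmx_inv (S2_sym _ Sa) (S2_sym _ (Met_S2 Mg)).
by rewrite -scalemxAr -scalemxAl mulKVmx// mulmxKV.
Qed.

(** A is symmetric for g, hence g e^(tA) = (e^(tA/2))^T g e^(tA/2). *)
Lemma Met_gexp t : Met (gexp t).
Proof.
have E x : gexp t x = (expmx ((t / 2) *: sharp g a x))^T *m g x *m expmx ((t / 2) *: sharp g a x).
  rewrite expmx_sharp_tr -mulmxA expmx_add.
  by have -> : t / 2 + t / 2 = t by lra.
split; first split.
- by move=> x; rewrite E !trmx_mul trmxK (S2_sym _ (Met_S2 Mg)) mulmxA.
- exact: Sm_gexp.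
- move=> x v v0; rewrite E; set Q := expmx _.
  have uQ : Q^T \in unitmx by rewrite unitmx_tr expmx_unit.
  by have := posdef_congr uQ (Met_posdef x Mg); rewrite trmxK; apply.
Qed.

(** The form g A^k; the [k]th derivative of the curve is g A^k e^(tA). *)
Fixpoint gpow (k : nat) : two_form := if k is k'.+1 then gmul (gpow k') g a else g.

Lemma gpowS k : gpow k.+1 = gmul (gpow k) g a. Proof. by []. Qed.

Lemma Sm_gpow k : Sm (gpow k).
Proof.
by elim: k => [|k IH]; [exact: Met_Sm|apply: Sm_gmul => //; exact: S2_Sm].
Qed.

Lemma gpow_adj k x : gpow k x *m sharp g a x = (sharp g a x)^T *m gpow k x.
Proof.
have sgT : (sharp g a x)^T = a x *m invmx (g x).
  by rewrite /sharp trmx_mul trmx_inv (S2_sym _ Sa) (S2_sym _ (Met_S2 Mg)).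
have ug := Met_unit x Mg.
elim: k => [|k IH]; first by rewrite sgT /sharp mulKVmx// mulmxKV.
by rewrite gpowS gmulE -/(sharp g a x) {1}IH -!mulmxA.
Qed.

Lemma gpow_sym k x : (gpow k x)^T = gpow k x.
Proof.
elim: k => [|k IH]; first exact/S2_sym/Met_S2.
by rewrite gpowS gmulE -/(sharp g a x) trmx_mul IH gpow_adj.
Qed.

Definition dgexp k t : two_form := gmul (gpow k) g (gexp t).

Lemma dgexp0 t : dgexp 0 t = gexp t.
Proof. by apply: two_formP => x; rewrite /dgexp gmul_gexp. Qed.

Lemma dgexp_S2 k t : S2 (dgexp k t).
Proof.
split=> [x|]; last by apply: Sm_gmul => //; [exact: Sm_gpow|exact: Sm_gexp].
rewrite /dgexp gmul_gexp trmx_mul gpow_sym expmx_tr; apply/esym; apply: expmx_intertwine.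
by rewrite [(t *: _)^T]linearZ /= -scalemxAr -scalemxAl gpow_adj.
Qed.

Lemma dgexp_deriv k t : h^-1 *: (dgexp k (t + h) - dgexp k t) @[h --> (0 : R)^'] --> dgexp k.+1 t.
Proof.
have H : gmul (gpow k) g (h^-1 *: (gexp (t + h) - gexp t)) @[h --> (0 : R)^'] -->
    gmul (gpow k) g (gmul a g (gexp t)).
  apply: cvg_gmul => //; try exact: cvg_cst.
  - by near=> h; exact: Sm_gpow.
  - by near=> h.
  - by near=> h; apply: Sm_scale; apply: Sm_sub; exact: Sm_gexp.
  - exact: Sm_gpow.
  - by apply: Sm_gmul => //; [exact: S2_Sm|exact: Sm_gexp].
  - exact: gexp_deriv.
rewrite gmulA -gpowS in H; apply: cvg_trans H; apply: near_eq_cvg; near=> h.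
by rewrite gmulZr gmulDr gmulNr.
Unshelve. all: by end_near. Qed.

Section OnInterval.
Variables (J : set R) (u : R -> two_form).
Hypotheses (oJ : open J) (uE : forall t, J t -> u t = gexp t).

Lemma cder_limit (w : R -> two_form) (t : R) (l : two_form) :
  h^-1 *: (w (t + h) - w t) @[h --> (0 : R)^'] --> l <->
  dquot (w : R^o -> two_form) t 1 @ (0 : R)^' --> l.
Proof.
suff -> : dquot (w : R^o -> two_form) t 1 = fun h : R => h^-1 *: (w (t + h) - w t) by [].
by apply/funext => h; rewrite /dquot [h *: _]mulr1.
Qed.

Lemma iter_cder_gexp k t : J t -> iter k (@cder R n M) u t = dgexp k t /\
  dquot (iter k (@cder R n M) u : R^o -> two_form) t 1 @ (0 : R)^' --> dgexp k.+1 t.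
Proof.
have near_J (s : R) : J s -> \forall h \near (0 : R)^', J (s + h).
  move=> Js; apply: nbhs_dnbhs.
  have K : \forall h \near (0 : R), J (h + s).
    have := near_shift 0 s J; rewrite subr0 => <-; exact: open_nbhs_nbhs.
  by apply: filterS K => h; rewrite addrC.
have step (w : R -> two_form) k' : (forall s, J s -> w s = dgexp k' s) -> forall s, J s ->
    dquot (w : R^o -> two_form) s 1 @ (0 : R)^' --> dgexp k'.+1 s.
  move=> wE s Js; apply/cder_limit; apply: cvg_trans (@dgexp_deriv k' s).
  by apply: near_eq_cvg; apply: filterS (near_J s Js) => h Jh; rewrite !wE.
suff E : forall s, J s -> iter k (@cder R n M) u s = dgexp k s.
  by move=> Jt; split; [exact: E|exact: step].
elim: k => [|k IH] s Js; first by rewrite /= uE// dgexp0.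
rewrite iterS /cder /dder; apply: xget_unique; first exact: step.
by move=> l fl; exact: (cvg_form_unique _ fl (step _ _ IH s Js)).
Qed.

Lemma smooth_curve_gexp : smooth_curve J u.
Proof.
move=> k t Jt; have [E D] := iter_cder_gexp k Jt.
by split; [rewrite E; exact: dgexp_S2|exists (dgexp k.+1 t)].
Qed.
End OnInterval.

End ExpCurve.

(** * Geodesics *)

Section Geodesics.
Variables (R : realType) (n : nat) (M : manifold R n) (cM : compact [set: M]).
Local Notation two_form := (two_form M).
Local Notation S2 := (@S2 R n M).
Local Notation Met := (@Met R n M).

Lemma conn_cst (w g : two_form) : conn (cst w) (cst w) g = - gmul w g w.
Proof.
rewrite /conn (is_dd_dder (is_dd_cst (w : two_form) g (cst w g))) sub0r.
apply: two_formP => y; move: (gmul w g w) => m.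
change (- (2^-1 *: (m y + m y)) = - m y); congr (- _).
by move: (m y : 'M[R]_n) => X; rewrite scalerDr -scalerDl (_ : 2^-1 + 2^-1 = 1 :> R) ?scale1r//; lra.
Qed.

Lemma cder_eval (w : R -> two_form) (t : R) x :
  dderivable (w : R^o -> two_form) t 1 -> is_mxd (fun s => w s x) t (cder w t x).
Proof.
move=> [l wl]; have wE : cder w t = l.
  by apply: xget_unique => // l' wl'; exact: (cvg_form_unique _ wl' wl).
rewrite wE; have K : (h^-1 *: (w (t + h) - w t)) x @[h --> (0 : R)^'] --> l x.
  have C : h^-1 *: (w (t + h) - w t) @[h --> (0 : R)^'] --> l by apply/cder_limit.
  exact: (cvg_eval (dnbhs_filter (0 : R)) C).
exact: K.
Qed.

Section Geo.
Variables (nabla : vfield M -> vfield M -> vfield M).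
Hypothesis nablaE : forall a b, smooth_field a -> smooth_field b ->
  forall g, Met g -> nabla a b g = conn a b g.
Variables (g a : two_form) (J : set R) (u : R -> two_form).
Hypotheses (Mg : Met g) (Sa : S2 a) (oJ : open J) (iJ : is_interval J) (J0 : J 0).

Lemma nabla_cst w h : S2 w -> Met h -> nabla (cst w) (cst w) h = - gmul w h w.
Proof.
by move=> Sw Mh; rewrite nablaE ?conn_cst//; exact: (smooth_field_cst cM Sw).
Qed.

(** u' = u A and u'' = u' A, hence u'' = u' u^-1 u', which is the geodesic
    equation. *)
Lemma gexp_geodesic : (forall t, J t -> u t = gexp g a t) ->
  geodesic nabla J u /\ u 0 = g /\ cder u 0 = a.
Proof.
move=> uE.
have K k t : J t -> iter k (@cder R n M) u t = dgexp g a k t.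
  by move=> Jt; have [] := iter_cder_gexp Mg Sa oJ uE k Jt.
split; [split|split].
- exact: (smooth_curve_gexp Mg Sa oJ uE).
- move=> t Jt; have Mt := Met_gexp Mg Sa t; rewrite uE//; split=> //.
  have K1 : cder u t = dgexp g a 1 t := K 1%N t Jt.
  have K2 : cder (cder u) t = dgexp g a 2 t := K 2%N t Jt.
  rewrite K2 K1 nabla_cst//; last exact: dgexp_S2.
  apply/eqP; rewrite subr_eq0; apply/eqP; apply: two_formP => x.
  have D k : dgexp g a k t x = gpow g a k x *m expmx (t *: sharp g a x).
    exact: gmul_gexp.
  have C : expmx (t *: sharp g a x) *m sharp g a x = sharp g a x *m expmx (t *: sharp g a x).
    by have := expmx_comm (sharp g a x) 1 t; rewrite scale1r.
  have DS k : dgexp g a k.+1 t x = dgexp g a k t x *m sharp g a x.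
    rewrite !D -mulmxA C mulmxA.
    exact: (congr1 (mulmx^~ _) (gmulE _ _ _ _)).
  have G1 : dgexp g a 1 t x = gexp g a t x *m sharp g a x by rewrite DS dgexp0.
  by rewrite gmulE DS {3}G1 mulKmx//; exact: Met_unit.
- by rewrite uE//; apply: two_formP => x; rewrite gexpE scale0r expmx0 mulmx1.
- transitivity (dgexp g a 1 0); first exact: (K 1%N 0 J0).
  apply: two_formP => x; rewrite /dgexp (gmul_gexp _ Mg) scale0r expmx0 mulmx1.
  by rewrite gpowS gmulE mulKVmx//; exact: Met_unit.
Qed.

(** At each point of [M] the equation is u'' = u' u^-1 u'. So u^-1 u' has zero
    derivative and equals A, and then u e^(-tA) has zero derivative. *)
Lemma geodesic_gexp : geodesic nabla J u -> u 0 = g -> cder u 0 = a ->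
  forall t, J t -> u t = gexp g a t.
Proof.
move=> [sm geo] u0 u0' t Jt; apply: two_formP => x.
pose U s := u s x; pose U1 s := cder u s x; pose U2 s := cder (cder u) s x.
have uU s : J s -> U s \in unitmx by move=> Js; apply: Met_unit; exact: (geo s Js).1.
have dU s : J s -> is_mxd U s (U1 s).
  by move=> Js; apply: cder_eval; exact: (sm 0%N s Js).2.
have dU1 s : J s -> is_mxd U1 s (U2 s).
  by move=> Js; apply: cder_eval; exact: (sm 1%N s Js).2.
have eqn s : J s -> U2 s = U1 s *m (invmx (U s) *m U1 s).
  move=> Js; have [Ms] := geo s Js; rewrite nabla_cst//; last exact: (sm 1%N s Js).1.
  by move/eqP; rewrite subr_eq0 => /eqP E; rewrite /U2 E.
pose A := sharp g a x.
have VA s : J s -> invmx (U s) *m U1 s = A.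
  move=> Js.
  have D r : J r -> is_mxd (fun r => invmx (U r) *m U1 r) r 0.
    move=> Jr; have uN : \forall q \near r, U q \in unitmx.
      have : nbhs r J by exact: open_nbhs_nbhs.
      by apply: filterS => q; exact: uU.
    have := is_mxd_mul (is_mxd_inv uN (dU r Jr)) (dU1 r Jr).
    by rewrite eqn// mulNmx -!mulmxA addNr.
  by rewrite (is_mxd_eq0_cst iJ J0 D Js) /U /U1 u0 u0'.
have U1E s : J s -> U1 s = U s *m A.
  by move=> Js; rewrite -(VA s Js) mulKVmx// uU.
have W s : J s -> U s *m expmx ((0 - s) *: A) = g x.
  move=> Js.
  have D r : J r -> is_mxd (fun r => U r *m expmx ((0 - r) *: A)) r 0.
    move=> Jr; have := is_mxd_mul (dU r Jr) (@is_mxd_expN R n A 0 r).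
    by rewrite U1E// mulmxN -mulmxA subrr.
  by rewrite (is_mxd_eq0_cst iJ J0 D Js) subr0 scale0r expmx0 mulmx1 /U u0.
change (U t = g x *m expmx (t *: A)).
by rewrite -(W t Jt) -mulmxA expmx_add sub0r addNr scale0r expmx0 mulmx1.
Qed.
End Geo.
End Geodesics.

Theorem theorem2p2 (R : realType) (n : nat) (M : manifold R n)
    (cM : compact [set: M]) (O : orientation M) (P : partition_of_unity O)
    (g0 : two_form M) (g0M : Met g0) :
  let ip := weak_metric P g0 in
  (forall nabla : vfield M -> vfield M -> vfield M,
    levi_civita ip nabla <->
    forall a b, smooth_field a -> smooth_field b -> forall g, Met g ->
      nabla a b g = dder b g (a g) -
        2^-1 *: (fmul (a g) (sharp g (b g)) + fmul (b g) (sharp g (a g)))) /\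
  forall nabla : vfield M -> vfield M -> vfield M, levi_civita ip nabla ->
  [/\ forall a b c, smooth_field a -> smooth_field b -> smooth_field c ->
        forall g, Met g ->
        curvature nabla a b c g =
          - 4^-1 *: fmul g (comm (comm (sharp g (a g)) (sharp g (b g)))
                                 (sharp g (c g))),
      forall a b, smooth_field a -> smooth_field b -> forall g, Met g ->
        ip g (a g) (a g) = 1 -> ip g (b g) (b g) = 1 -> ip g (a g) (b g) = 0 ->
        sectional_curvature ip nabla a b g =
          4^-1 * vol_integral P g0 (fun x =>
            \tr (comm (sharp g (a g)) (sharp g (b g)) x ^+ 2))
    & forall g a, Met g -> S2 a ->
        forall J : set R, open J -> is_interval J -> J 0 ->
        forall u : R -> two_form M,
          (geodesic nabla J u /\ u 0 = g /\ cder u 0 = a) <->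
          (forall t, J t -> u t = fmul g (fun x => expmx (t *: sharp g a x)))].
Proof.
move=> ip; split.
  move=> nabla; split=> [LC|E]; first exact: (levi_civita_formula cM g0M LC).
  exact: (formula_levi_civita cM P g0M E).
move=> nabla LC; split.
- exact: (nabla_curvature cM g0M LC).
- by move=> a b sa sb g Mg _ _ _; exact: (nabla_sectional cM g0M LC sa sb Mg).
- move=> g a Mg Sa J oJ iJ J0 u; have E := levi_civita_formula cM g0M LC; split.
    by move=> [geo [u0 u0']]; exact: (geodesic_gexp cM E oJ iJ J0 geo u0 u0').
  exact: (gexp_geodesic cM E Mg Sa oJ J0).
Qed.
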